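(* Let $u:[0,T]\times[0,L]\to\mathbb{R}$ be a weak admissible solution of $\partial_tu+\partial_xF(u)=0$ with periodic boundary conditions such that $u\in BMV([0,T]\times[0,L])$. Let $N_x,N_t\in\mathbb{N}$, $\Delta t=T/N_t$, $h=L/N_x$, $x_m=mh$, $t_k=k\Delta t$. Then for any $\epsilon>0$, any integer $\ell\ge3$ and any activation function $\sigma$ for which there are constants $\sigma_-<\sigma_+$ with $\lim_{x\to-\infty}\sigma(x)=\sigma_-$, $\lim_{x\to\infty}\sigma(x)=\sigma_+$, there exists a network $\eta=\eta(\epsilon):\mathbb{R}^2\to\mathbb{R}$ with an architecture of type (A) with $\ell$ hidden layers and activation function $\sigma$ such that: (i) for all $k\in\{1,\dots,N_t\}$, $m\in\{1,\dots,N_x\}$, $$\Big|\int_{x_{m-1}}^{x_m}\eta(t_k,x)-\eta(t_{k-1},x)\,dx+\int_{t_{k-1}}^{t_k}F(\eta)(t,x_m)-F(\eta)(t,x_{m-1})\,dt\Big|\le\epsilon;$$ (ii) for all $k\in\{1,\dots,N_t\}$, $m\in\{1,\dots,N_x\}$, $$\int_{x_{m-1}}^{x_m}S(\eta)(t_k,x)-S(\eta)(t_{k-1},x)\,dx+\int_{t_{k-1}}^{t_k}Q(\eta)(t,x_m)-Q(\eta)(t,x_{m-1})\,dt\le\epsilon;$$ (iii) $\operatorname{EMVar}(\eta;[0,T]\times[0,L])\le2\big(\operatorname{MVar}(u;[0,T]\times[0,L])+\|u\|_{L^\infty([0,T]\times[0,L])}\big)$; (iv) $\|\eta(0,\cdot)-u(0,\cdot)\|_{L^1([0,L])}\le\epsilon$;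 (v) $\Big|\int_0^TF(\eta(t,0))-F(\eta(t,L))\,dt\Big|\le\epsilon$.
   Context: Setting: $T,L>0$; $F\in C^2(\mathbb{R})$ strictly convex; the initial data are $u_0=u(0,\cdot)\in L^\infty([0,L])$. Weak admissible solution (periodic boundary conditions): let $PT$ be the set of $\varphi\in C_c^\infty([0,T)\times[0,L])$ with $D^\alpha\varphi(t,0)=D^\alpha\varphi(t,L)$ for all $\alpha\in\mathbb{N}_0^2$, $t\in[0,T)$. $u\in L^1([0,T]\times[0,L])$ is a weak admissible solution if $\int_0^T\int_0^Lu\,\partial_t\varphi+F(u)\,\partial_x\varphi\,dx\,dt=-\int_0^Lu_0\varphi(0,x)\,dx$ for all $\varphi\in PT$, and there exist locally Lipschitz $S,Q:\mathbb{R}\to\mathbb{R}$ with $S$ strictly convex, $Q'=F'S'$ a.e., such that $\int_0^T\int_0^LS(u)\,\partial_t\varphi+Q(u)\,\partial_x\varphi\,dx\,dt\ge-\int_0^LS(u_0)\varphi(0,x)\,dx$ for all nonnegative $\varphi\in PT$. In the theorem, $(S,Q)$ is the entropy-entropy flux pair for which $u$ satisfies this inequality. It is classical that for each $u_0\in L^\infty([0,L])$ there is a unique admissible weak solution in $C([0,T];L^1([0,L]))\cap L^\infty([0,T]\times[0,L])$. BMV: for $x,y\in\mathbb{R}^d$ write $x\le y$ if $x_i\le y_i$ for all $i$; $g:\mathbb{R}^d\to\mathbb{R}$ is nondecreasing if $g(x)\le g(y)$ whenever $x\le y$; $\odot$ is componentwise multiplication; $\{-1,1\}^d=\{s_i:i\in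 J\}$, $J=\{1,\dots,2^d\}$. $f:U\subset\mathbb{R}^d\to\mathbb{R}$ is in $BMV(U)$ if there are nondecreasing $f_i:\mathbb{R}^d\to\mathbb{R}$ with $f(x)=\sum_{i\in J}f_i(s_i\odot x)$ for all $x\in U$; $\operatorname{MVar}(f;U)=\inf\sum_{i\in J}(\sup_{x\in U}f_i(s_i\odot x)-\inf_{x\in U}f_i(s_i\odot x))$ over all such decompositions. A network with architecture of type (A), $\ell$ hidden layers and nondecreasing activation function $\sigma:\mathbb{R}\to\mathbb{R}$ (activation functions in this architecture are always nondecreasing) is a map $\eta(z)=\sum_{i=1}^K\eta_i(\mathbf{s}_i\odot z)$ with $\mathbf{s}_i\in\{-1,1\}^d$ and $\eta_i(z)=A_{\ell+1,i}\hat\sigma(A_{\ell,i}\hat\sigma(\cdots\hat\sigma(A_{1,i}z+b_{1,i})\cdots)+b_{\ell,i})+b_{\ell+1,i}$, where $\hat\sigma$ is $\sigma$ applied componentwise, and all matrices $A_{l,i}$, $l=1,\dots,\ell+1$, are real with nonnegative entries and, together with the real vectors $b_{l,i}$, of compatible sizes. Its estimated M-variation is $\operatorname{EMVar}(\eta;U)=\sum_{i=1}^K(\sup_{z\in U}\eta_i(\mathbf{s}_i\odot z)-\inf_{z\in U}\eta_i(\mathbf{s}_i\odot z))$. *)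

(* Defs.v *)
From HB Require Import structures.
From mathcomp Require Import all_boot all_order all_algebra.
From mathcomp Require Import all_classical all_reals all_analysis.

Set Implicit Arguments.
Unset Strict Implicit.
Unset Printing Implicit Defensive.

Import Order.TTheory GRing.Theory Num.Theory.
Import numFieldNormedType.Exports.

Local Open Scope classical_set_scope.
Local Open Scope ring_scope.

(** ** Real functions of one variable *)

Definition C2 (R : realType) (f : R -> R) : Prop :=
  [/\ forall x, derivable f x 1,
      forall x, derivable (derive1 f) x 1 &
      continuous (derive1 (derive1 f))].

Definition strictly_convex (R : realType) (f : R -> R) : Prop :=
  forall x y a : R, x != y -> 0 < a < 1 ->
    f (a * x + (1 - a) * y) < a * f x + (1 - a) * f y.

Definition locally_lipschitz (R : realType) (f : R -> R) : Prop :=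
  forall a : R, exists2 r : R, 0 < r & [lipschitz f x | x in ball a r].

(** ** Lebesgue spaces *)

(** Measurability in the library is Borel measurability.  A Lebesgue measurable
    function is one that agrees almost everywhere with a Borel one; the
    library's [integral] (defined through simple functions from below) and
    essential supremum take the expected values on such functions. *)
Definition ae_measurable_fun (d : measure_display) (T : measurableType d)
    (R : realType) (mu : {measure set T -> \bar R}) (D : set T)
    (f : T -> R) : Prop :=
  exists2 g : T -> R, measurable_fun D g & {ae mu, forall p, D p -> f p = g p}.

Definition in_L1 (d : measure_display) (T : measurableType d) (R : realType)
    (mu : {measure set T -> \bar R}) (D : set T) (f : T -> R) : Prop :=
  exists2 g : T -> R, mu.-integrable D (EFin \o g) &
    {ae mu, forall p, D p -> f p = g p}.

(** Extending by zero outside [D] does not change the essential supremum of the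
    absolute value. *)
Definition Linfty_norm (d : measure_display) (T : measurableType d)
    (R : realType) (mu : {measure set T -> \bar R}) (D : set T)
    (f : T -> R) : \bar R :=
  Lnorm mu +oo%E (EFin \o (f \_ D)).

Definition in_Linfty (d : measure_display) (T : measurableType d)
    (R : realType) (mu : {measure set T -> \bar R}) (D : set T)
    (f : T -> R) : Prop :=
  ae_measurable_fun mu D f /\ (Linfty_norm mu D f < +oo)%E.

Definition lebesgue2 (R : realType) :
    {measure set (measurableTypeR R * measurableTypeR R)%type -> \bar R} :=
  (@lebesgue_measure R \x @lebesgue_measure R)%E.

Definition rect (R : realType) (T L : R) : set (R * R) :=
  `[0, T]%classic `*` `[0, L]%classic.

(** ** Test functions *)

(** Points of the plane are pairs (t, x). *)
Definition pd_t (R : realType) (phi : R * R -> R) : R * R -> R :=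
  fun p => 'D_((1 : R), (0 : R)) phi p.

Definition pd_x (R : realType) (phi : R * R -> R) : R * R -> R :=
  fun p => 'D_((0 : R), (1 : R)) phi p.

Definition pd (R : realType) (i j : nat) (phi : R * R -> R) : R * R -> R :=
  iter i (@pd_t R) (iter j (@pd_x R) phi).

Fixpoint Ck (R : realType) (k : nat) (phi : R * R -> R) : Prop :=
  match k with
  | 0 => continuous phi
  | k'.+1 => [/\ forall p, differentiable phi p,
                 Ck k' (pd_t phi) & Ck k' (pd_x phi)]
  end.

Definition smooth (R : realType) (phi : R * R -> R) : Prop :=
  forall k, Ck k phi.

(** A smooth function on [0, T) x [0, L] (up to the boundary) is given by a
    smooth function on the plane; only its values on [0, T) x [0, L] matter,
    and they determine all the derivatives there.  The support has to be compact
    in [0, T) x [0, L], so that [phi] vanishes for t close to T, but it is not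
    required to vanish at t = 0, x = 0 or x = L. *)
Definition periodic_test (R : realType) (T L : R) (phi : R * R -> R) : Prop :=
  [/\ smooth phi,
      (exists K : set (R * R),
         [/\ compact K, K `<=` `[0, T[%classic `*` `[0, L]%classic &
             forall p, (`[0, T[%classic `*` `[0, L]%classic) p -> ~ K p ->
               phi p = 0]) &
      forall (i j : nat) (t : R), 0 <= t < T ->
        pd i j phi (t, 0) = pd i j phi (t, L)].

(** ** Weak admissible solutions *)

Definition weak_lhs (R : realType) (T L : R) (v w : R * R -> R)
    (phi : R * R -> R) : R :=
  \int[@lebesgue_measure R]_(t in `[0, T])
    \int[@lebesgue_measure R]_(x in `[0, L])
      (v (t, x) * pd_t phi (t, x) + w (t, x) * pd_x phi (t, x)).

Definition weak_solution (R : realType) (T L : R) (F : R -> R)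
    (u0 : R -> R) (u : R * R -> R) : Prop :=
  forall phi, periodic_test T L phi ->
    weak_lhs T L u (F \o u) phi =
    - \int[@lebesgue_measure R]_(x in `[0, L]) (u0 x * phi (0, x)).

Definition entropy_pair (R : realType) (F S Q : R -> R) : Prop :=
  [/\ locally_lipschitz S, locally_lipschitz Q, strictly_convex S &
      {ae @lebesgue_measure R, forall y,
         [/\ derivable Q y 1, derivable S y 1 &
             derive1 Q y = derive1 F y * derive1 S y]}].

Definition entropy_inequality (R : realType) (T L : R) (S Q : R -> R)
    (u0 : R -> R) (u : R * R -> R) : Prop :=
  forall phi, periodic_test T L phi ->
    (forall p, (`[0, T[%classic `*` `[0, L]%classic) p -> 0 <= phi p) ->
    weak_lhs T L (S \o u) (Q \o u) phi >=
    - \int[@lebesgue_measure R]_(x in `[0, L]) (S (u0 x) * phi (0, x)).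

(** [u] is a weak admissible solution with initial data [u0] when this holds for
    some [S] and [Q]; they are kept as parameters because later statements refer
    to the pair for which [u] is admissible. *)
Definition weak_admissible_solution (R : realType) (T L : R) (F S Q : R -> R)
    (u0 : R -> R) (u : R * R -> R) : Prop :=
  [/\ in_L1 (lebesgue2 R) (rect T L) u,
      weak_solution T L F u0 u,
      entropy_pair F S Q &
      entropy_inequality T L S Q u0 u].

(** ** Functions of bounded M-variation *)

(** [false] encodes the sign 1 and [true] the sign -1. *)
Definition signs (d : nat) := {ffun 'I_d -> bool}.

Definition flip (R : realType) (d : nat) (s : signs d) (z : 'cV[R]_d) :
    'cV[R]_d :=
  \col_i ((-1) ^+ s i * z i 0).

Definition cV_nondecreasing (R : realType) (d : nat) (g : 'cV[R]_d -> R) :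
    Prop :=
  forall x y : 'cV[R]_d, (forall i, x i 0 <= y i 0) -> g x <= g y.

Definition M_decomposition (R : realType) (d : nat) (U : set 'cV[R]_d)
    (f : 'cV[R]_d -> R) (fs : signs d -> 'cV[R]_d -> R) : Prop :=
  (forall s, cV_nondecreasing (fs s)) /\
  (forall z, U z -> f z = \sum_(s : signs d) fs s (flip s z)).

Definition BMV (R : realType) (d : nat) (U : set 'cV[R]_d)
    (f : 'cV[R]_d -> R) : Prop :=
  exists fs, M_decomposition U f fs.

Definition osc (R : realType) (d : nat) (U : set 'cV[R]_d)
    (g : 'cV[R]_d -> R) : \bar R :=
  (ereal_sup [set (g z)%:E | z in U] - ereal_inf [set (g z)%:E | z in U])%E.

Definition MVar (R : realType) (d : nat) (U : set 'cV[R]_d)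
    (f : 'cV[R]_d -> R) : \bar R :=
  ereal_inf [set v | exists2 fs, M_decomposition U f fs &
    v = (\sum_(s : signs d) osc U (fun z => fs s (flip s z)))%E].

(** ** Networks with architecture of type (A) *)

(** [mlp R l m]: the weights of a scalar network with [l] hidden layers and [m]
    inputs.  The widths of the hidden layers are arbitrary. *)
Inductive mlp (R : realType) : nat -> nat -> Type :=
| mlp_out (m : nat) (A : 'M[R]_(1, m)) (b : R) : mlp R 0 m
| mlp_hidden (l m n : nat) (A : 'M[R]_(n, m)) (b : 'cV[R]_n) :
    mlp R l n -> mlp R l.+1 m.

Fixpoint mlp_eval (R : realType) (sigma : R -> R) (l m : nat)
    (N : mlp R l m) : 'cV[R]_m -> R :=
  match N in mlp _ l m return 'cV[R]_m -> R with
  | mlp_out m A b => fun z => (A *m z) 0 0 + b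
  | mlp_hidden l m n A b N' =>
      fun z => mlp_eval sigma N' (map_mx sigma (A *m z + b))
  end.

Fixpoint mlp_ge0 (R : realType) (l m : nat) (N : mlp R l m) : Prop :=
  match N with
  | mlp_out m A b => forall i j, 0 <= A i j
  | mlp_hidden l m n A b N' => (forall i j, 0 <= A i j) /\ mlp_ge0 N'
  end.

(** [EMVar] depends on the summands and not only on the function they define, so
    a network is represented by its weights. *)
Record netA (R : realType) (d l : nat) := NetA {
  netA_size : nat;
  netA_sign : 'I_netA_size -> signs d;
  netA_part : 'I_netA_size -> mlp R l d;
  netA_ge0 : forall i, mlp_ge0 (netA_part i)
}.

Definition netA_eval (R : realType) (sigma : R -> R) (d l : nat)
    (N : netA R d l) (z : 'cV[R]_d) : R :=
  \sum_(i < netA_size N) mlp_eval sigma (netA_part i) (flip (netA_sign i) z).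

Definition EMVar (R : realType) (sigma : R -> R) (d l : nat)
    (U : set 'cV[R]_d) (N : netA R d l) : \bar R :=
  (\sum_(i < netA_size N)
     osc U (fun z => mlp_eval sigma (netA_part i)
                       (flip (netA_sign i) z)))%E.

(** ** Identification of column vectors of size 2 with pairs (t, x) *)

Definition cV2 (R : realType) (t x : R) : 'cV[R]_2 :=
  \col_(i < 2) (if i == 0 then t else x).

Definition pair2 (R : realType) (z : 'cV[R]_2) : R * R := (z 0 0, z 1 0).

Definition rectV (R : realType) (T L : R) : set 'cV[R]_2 :=
  [set z | rect T L (pair2 z)].

(* Main.v *)
Require Import Defs.
From HB Require Import structures.
From mathcomp Require Import all_boot all_order all_algebra.
From mathcomp Require Import all_classical all_reals all_analysis.
From mathcomp Require Import ring lra.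

Set Implicit Arguments.
Unset Strict Implicit.
Unset Printing Implicit Defensive.

Import Order.TTheory GRing.Theory Num.Theory.
Import numFieldNormedType.Exports.

Local Open Scope classical_set_scope.
Local Open Scope ring_scope.

(** On the rectangle, a function of bounded M-variation is a sum of components
    that are monotone in [t] and in [x] separately.  A decomposition can be chosen
    whose oscillations add up to at most twice the M-variation
    ([near_optimal_decomposition]).  Three hidden layers of threshold units compute
    comparisons with finitely many points, conjunctions, and disjunctions;
    this suffices to interpolate a monotone function at finitely many points
    by a monotone network that never leaves the range of the function
    ([monotone_interpolation]).  Replacing every component by such a
    network bounds the estimated M-variation without any loss; the error of the
    network shows only in the other claims.

    The difficulty is that these claims concern the values of the network on
    finitely many lines, while the weak formulation sees [u] almost
    everywhere only, so that the values of [u] on a grid line may be wrong.  One-sided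
    limits of [u] are reliable, however.  The network is therefore fitted not to
    [u] but to [u] composed with a contraction of each axis, by a factor close to
    1: time is contracted towards 0, so that the initial line stays where
    it is, and space towards the middle of the first cell, so that every space node moves
    strictly inside of (0, L), to a known side ([contract]).  The integral
    over a line of the monotone function that dominates the increments of [u] is
    monotone in the position of the line; hence it varies little on a short
    interval on one side of a node, and the contracted node lies in such a window
    ([contract_window]).

    Testing the equation with a product of smooth steps whose
    transitions take place in these windows gives the balance on the contracted
    cell, up to the variation over the windows and to their distance from
    the nodes ([balance_inequality]).  All functions involved are dominated by
    monotone functions, which settles their measurability and lets every
    estimate be made on increments.  The conservation law, read with both signs, and the entropy inequality
    are the same statement for the pairs (id, F), (- id, - F) and (S, Q), composed
    with a truncation that makes them bounded and Lipschitz.  The cell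
    balances are claims (i) and (ii); claim (v) comes from a test function that is
    constant near both ends of [0, L] and vanishes between the extreme contracted
    nodes ([boundary_balance]).

    Finally, the network and the contracted [u] are close at the nodes of a fine
    grid, and their components are monotone in the same directions; between two
    neighbouring nodes they thus differ by at most an increment of a monotone
    function.  These increments telescope, which makes the two functions close in
    L1 on every grid line ([line_close]), and this is stable under Lipschitz
    functions. *)

(** * Monotone networks interpolate monotone functions *)

Lemma mlp_eval_nondecreasing (R : realType) (sigma : R -> R) (l m : nat)
    (N : mlp R l m) :
  {homo sigma : x y / x <= y} -> mlp_ge0 N ->
  cV_nondecreasing (mlp_eval sigma N).
Proof.
move=> smono; elim: N => [{}m A b|{}l {}m n A b N IH] /=.
  move=> A0 x y xy; rewrite lerD2r !mxE; apply: ler_sum => i _.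
  exact: ler_wpM2l.
move=> [A0 N0] x y xy; apply: (IH N0) => i; rewrite !mxE; apply: smono.
rewrite lerD2r; apply: ler_sum => j _; exact: ler_wpM2l.
Qed.

(** Writing [v] as a sum of equal steps, one for each level below [v], loses at
    most one step.  This replaces sorting the values of a function: its superlevel
    sets at equidistant levels determine it up to [del]. *)
Lemma level_sum (R : realType) (v lo del : R) (n : nat) :
  0 <= del -> lo <= v <= lo + n%:R * del ->
  lo + \sum_(k < n) del * (lo + k.+1%:R * del <= v)%R%:R <= v
    <= lo + \sum_(k < n) del * (lo + k.+1%:R * del <= v)%R%:R + del.
Proof.
move=> del0 /andP[lov vhi].
have lowerP m : lo + \sum_(k < m) del * (lo + k.+1%:R * del <= v)%R%:R <= v.
  elim: m => [|m IH]; first by rewrite big_ord0 addr0.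
  rewrite big_ord_recr /=; case: (lerP (lo + m.+1%:R * del) v) => h; last first.
    by rewrite mulr0 addr0.
  rewrite mulr1; apply: le_trans h; rewrite addrA -natr1 mulrDl mul1r addrA lerD2r.
  rewrite lerD2l mulr_natl -[X in _ *+ X]card_ord -sumr_const.
  by apply: ler_sum => i _; rewrite ler_piMr// lern1 leq_b1.
rewrite lowerP /=; elim: n vhi => [|n IH] vhi.
  by rewrite big_ord0 addr0 (le_trans vhi)// mul0r addr0 lerDl.
rewrite big_ord_recr /=; case: (lerP v (lo + n%:R * del)) => h.
  apply: (le_trans (IH h)); rewrite -!addrA lerD2l lerD2l lerDr.
  exact: mulr_ge0.
have all1 : \sum_(k < n) del * (lo + k.+1%:R * del <= v)%R%:R = n%:R * del.
  rewrite mulr_natl -[X in _ *+ X]card_ord -sumr_const; apply: eq_bigr => i _.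
  rewrite (_ : (_ <= v)%R = true) ?mulr1//; apply: le_trans (ltW h).
  by rewrite lerD2l ler_wpM2r// ler_nat.
rewrite all1; apply: (le_trans vhi).
rewrite -natr1 mulrDl mul1r; rewrite !addrA lerD2r lerDl.
exact: mulr_ge0.
Qed.

(** Rescaling the range of the activation function to [0, 1] turns units into
    approximate truth values; [unsquash] is the inverse, on a whole layer. *)
Definition squash (R : realType) (sm sp y : R) : R := (y - sm) / (sp - sm).

Definition unsquash (R : realType) (sm sp : R) (n : nat) (y : 'cV[R]_n) :
    'cV[R]_n := \col_i (sm + (sp - sm) * y i 0).

(** A network approximately computes a function [w] of truth values when inputs
    close to 0 or 1 give outputs close to [w].  The bounds [lo] and [hi] hold for
    every input with entries in [0, 1], also far from truth values; they keep the
    oscillation of the network under control where nothing is known about its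
    inputs. *)
Definition gate_net (R : realType) (sigma : R -> R) (sm sp : R) (n q : nat)
    (lo hi : R) (w : ('I_n -> bool) -> R) : Prop :=
  forall eps : R, 0 < eps -> exists N : mlp R q n, exists2 kap : R, 0 < kap &
    [/\ mlp_ge0 N,
        forall y : 'cV[R]_n, (forall i, 0 <= y i 0 <= 1) ->
          lo <= mlp_eval sigma N (unsquash sm sp y) <= hi &
        forall (y : 'cV[R]_n) (e : 'I_n -> bool),
          (forall i, `|y i 0 - (e i)%:R| <= kap) ->
          `|mlp_eval sigma N (unsquash sm sp y) - w e| <= eps].

Lemma gate_net_out (R : realType) (sigma : R -> R) (sm sp : R) (n : nat)
    (lo del : R) : sm < sp -> 0 <= del ->
  gate_net sigma sm sp (n := n) 0 lo (lo + n%:R * del)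
    (fun e => lo + \sum_(i < n) del * (e i)%:R).
Proof.
move=> smp del0 eps eps0.
have D0 : sp - sm != 0 by rewrite subr_eq0 gt_eqF.
have Dp : 0 < sp - sm by rewrite subr_gt0.
pose N := mlp_out (\row_(j < n) (del / (sp - sm)))
  (lo - n%:R * (del / (sp - sm) * sm)).
have NE (y : 'cV[R]_n) : mlp_eval sigma N (unsquash sm sp y) =
    lo + \sum_(i < n) del * y i 0.
  rewrite /= mxE addrCA; congr (_ + _).
  rewrite mulr_natl -[X in _ *+ X]card_ord -sumr_const -sumrB.
  by apply: eq_bigr => i _; rewrite !mxE; field.
exists N; exists (eps / (1 + n%:R * del)).
  by rewrite divr_gt0// ltr_pwDl// mulr_ge0.
split.
- by move=> i j /=; rewrite mxE divr_ge0// ltW.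
- move=> y y01; rewrite NE lerDl lerD2l; apply/andP; split.
    by apply: sumr_ge0 => i _; rewrite mulr_ge0//; case/andP: (y01 i).
  rewrite mulr_natl -[X in _ *+ X]card_ord -sumr_const.
  by apply: ler_sum => i _; rewrite ler_piMr//; case/andP: (y01 i).
- move=> y e ye; rewrite NE opprD addrACA subrr add0r -sumrB.
  apply: le_trans (ler_norm_sum _ _ _) _.
  apply: (@le_trans _ _ (\sum_(i < n) del * (eps / (1 + n%:R * del)))).
    apply: ler_sum => i _; rewrite -mulrBr normrM (ger0_norm del0).
    exact: ler_wpM2l.
  have p0 : 0 < 1 + n%:R * del by rewrite ltr_pwDl// mulr_ge0.
  rewrite sumr_const card_ord -[leLHS]mulr_natl !mulrA ler_pdivrMr// mulrC.
  by rewrite ler_pM2l// lerDr.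
Qed.

Lemma squash01 (R : realType) (sigma : R -> R) (sm sp : R) :
  {homo sigma : x y / x <= y} -> sm < sp ->
  sigma x @[x --> -oo] --> sm -> sigma x @[x --> +oo] --> sp ->
  forall y, 0 <= squash sm sp (sigma y) <= 1.
Proof.
move=> smono smp cm cp y; have Dp : 0 < sp - sm by rewrite subr_gt0.
rewrite /squash divr_ge0 ?subr_ge0 ?(ltW smp)//=; last first.
  rewrite -(cvg_lim _ cm)//; apply: limr_le; first by apply/cvg_ex; exists sm.
  by exists y; split; [exact: num_real|move=> z /ltW /smono].
rewrite ler_pdivrMr// mul1r lerD2r.
rewrite -(cvg_lim _ cp)//; apply: limr_ge; first by apply/cvg_ex; exists sp.
by exists y; split; [exact: num_real|move=> z /ltW /smono].
Qed.

Lemma squash_threshold (R : realType) (sigma : R -> R) (sm sp : R) :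
  sm < sp ->
  sigma x @[x --> -oo] --> sm -> sigma x @[x --> +oo] --> sp ->
  forall kap : R, 0 < kap -> exists2 Lam : R, 0 < Lam &
    (forall y, Lam <= y -> `|squash sm sp (sigma y) - 1| <= kap) /\
    (forall y, y <= - Lam -> `|squash sm sp (sigma y)| <= kap).
Proof.
move=> smp cm cp kap kap0; have Dp : 0 < sp - sm by rewrite subr_gt0.
have e0 : 0 < kap * (sp - sm) by rewrite mulr_gt0.
move/cvgrPdist_le : cm => /(_ _ e0) [M [_ HM]].
move/cvgrPdist_le : cp => /(_ _ e0) [P [_ HP]].
exists (1 + `|M| + `|P|); first by rewrite -addrA ltr_pwDl// addr_ge0.
split=> y hy.
  have : P < y by apply: lt_le_trans hy; have := ler_norm P; have := normr_ge0 M; lra.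
  move/HP => /=; rewrite distrC => h.
  have -> : squash sm sp (sigma y) - 1 = (sigma y - sp) / (sp - sm).
    by rewrite /squash; field; rewrite gt_eqF.
  by rewrite normrM normfV (gtr0_norm Dp) ler_pdivrMr.
have : y < M.
  apply: le_lt_trans hy _; have := normr_ge0 P.
  by have := ler_norm (- M); rewrite normrN; lra.
move/HM => /=; rewrite distrC => h.
by rewrite /squash normrM normfV (gtr0_norm Dp) ler_pdivrMr.
Qed.

(** One more layer in front computes gates that are given by affine forms: a
    form that separates the two truth values by a margin does so for nearby
    inputs as well, and multiplying it by a large factor pushes the activation
    function close to its limits. *)
Lemma gate_net_layer (R : realType) (sigma : R -> R) (sm sp : R)
    (n n' q : nat) (lo hi : R) (w : ('I_n' -> bool) -> R)
    (A : 'M[R]_(n', n)) (b : 'cV[R]_n') (G : ('I_n -> bool) -> 'I_n' -> bool) :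
  {homo sigma : x y / x <= y} -> sm < sp ->
  sigma x @[x --> -oo] --> sm -> sigma x @[x --> +oo] --> sp ->
  (forall i j, 0 <= A i j) ->
  (forall e i, if G e i then 2^-1 <= \sum_j A i j * (e j)%:R + b i 0
               else \sum_j A i j * (e j)%:R + b i 0 <= - 2^-1) ->
  gate_net sigma sm sp q lo hi w ->
  gate_net sigma sm sp q.+1 lo hi (w \o G).
Proof.
move=> smono smp cm cp A0 AG Hw eps eps0.
have [N' [kap' kap'0 [N'0 N'b N'w]]] := Hw _ eps0.
have [Lam Lam0 [LamP LamN]] := squash_threshold smp cm cp kap'0.
have Dp : 0 < sp - sm by rewrite subr_gt0.
have D0 : sp - sm != 0 by rewrite gt_eqF.
pose a := 1 + \sum_i \sum_j A i j.
have a1 : 1 <= a by rewrite lerDl; apply: sumr_ge0 => i _; apply: sumr_ge0.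
pose N := mlp_hidden (\matrix_(i, j) (4 * Lam * A i j / (sp - sm)))
  (\col_i (4 * Lam * (b i 0 - \sum_j A i j / (sp - sm) * sm))) N'.
have NE (y : 'cV[R]_n) : mlp_eval sigma N (unsquash sm sp y) =
    mlp_eval sigma N' (unsquash sm sp
     (\col_i squash sm sp (sigma (4 * Lam * (\sum_j A i j * y j 0 + b i 0))))).
  rewrite /=; congr (mlp_eval _ _ _); apply/colP => i; rewrite !mxE.
  rewrite /squash [(sp - sm) * _]mulrC divfK// [RHS]addrC subrK; congr (sigma _).
  rewrite [in RHS]mulrDr [in LHS]mulrBr addrCA -[RHS]addrC; congr (_ + _).
  rewrite !mulr_sumr -sumrN -big_split /=; apply: eq_bigr => j _.
  by rewrite !mxE; field.
have s01 := squash01 smono smp cm cp.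
(* This tolerance keeps the affine forms within 1/4 of their values at truth
   values, thus at distance at least 1/4 from the threshold 0. *)
exists N; exists (4 * a)^-1.
  by rewrite invr_gt0 mulr_gt0// (lt_le_trans _ a1).
split.
- split => // i j; rewrite !mxE divr_ge0 ?(ltW Dp)// mulr_ge0//.
  by rewrite mulr_ge0// ltW.
- by move=> y y01; rewrite NE; apply: N'b => i; rewrite mxE.
- move=> y e ye; rewrite NE; apply: N'w => i; rewrite mxE.
  have dlt : `|\sum_j A i j * y j 0 - \sum_j A i j * (e j)%:R| <= 4^-1.
    rewrite -sumrB; apply: le_trans (ler_norm_sum _ _ _) _.
    apply: (@le_trans _ _ (\sum_j A i j * (4 * a)^-1)).
      apply: ler_sum => j _; rewrite -mulrBr normrM (ger0_norm (A0 _ _)).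
      exact: ler_wpM2l.
    rewrite -mulr_suml invfM mulrCA ger_pMr//.
    rewrite ler_pdivrMr ?(lt_le_trans _ a1)// mul1r.
    apply: (@le_trans _ _ (\sum_i \sum_j A i j)); last by rewrite lerDr.
    rewrite (bigD1 i)//= lerDl; apply: sumr_ge0 => k _; exact: sumr_ge0.
  have := AG e i; case: (G e i) => h /=.
    apply: LamP; rewrite -mulrA [leLHS](_ : _ = Lam * (4 * 4^-1)); last by field.
    rewrite [4 * (Lam * _)]mulrCA ler_pM2l// ler_pM2l//.
    by move: dlt; rewrite ler_norml => /andP[]; lra.
  rewrite subr0; apply: LamN.
  rewrite [leRHS](_ : _ = 4 * Lam * (- 4^-1)); last by field.
  rewrite ler_pM2l ?mulr_gt0//.
  by move: dlt; rewrite ler_norml => /andP[]; lra.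
Qed.

(** Layers that transmit truth values adjust the depth to the prescribed one. *)
Lemma gate_net_identity (R : realType) (sigma : R -> R) (sm sp : R)
    (n p q : nat) (lo hi : R) (w : ('I_n -> bool) -> R) :
  {homo sigma : x y / x <= y} -> sm < sp ->
  sigma x @[x --> -oo] --> sm -> sigma x @[x --> +oo] --> sp ->
  gate_net sigma sm sp q lo hi w ->
  gate_net sigma sm sp (p + q) lo hi w.
Proof.
move=> smono smp cm cp; elim: p => [//|p IH] /IH h; rewrite addSn.
apply: (@gate_net_layer _ _ _ _ _ _ _ _ _ _ 1%:M (const_mx (- 2^-1)) (fun e => e)
  smono smp cm cp _ _ h).
  by move=> i j; rewrite mxE ler0n.
move=> e i; rewrite (bigD1 i)//= big1 ?addr0; last first.
  by move=> j ji; rewrite mxE eq_sym (negbTE ji) mul0r.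
by rewrite !mxE eqxx; case: (e i) => /=; lra.
Qed.

Lemma gate_net_or (R : realType) (sigma : R -> R) (sm sp : R)
    (n n' q : nat) (lo hi : R) (w : ('I_n' -> bool) -> R)
    (D : 'I_n' -> {set 'I_n}) :
  {homo sigma : x y / x <= y} -> sm < sp ->
  sigma x @[x --> -oo] --> sm -> sigma x @[x --> +oo] --> sp ->
  gate_net sigma sm sp q lo hi w ->
  gate_net sigma sm sp q.+1 lo hi
    (fun e : 'I_n -> bool => w (fun i => [exists j in D i, e j])).
Proof.
move=> smono smp cm cp h.
apply: (@gate_net_layer _ _ _ _ _ _ _ _ _ _ (\matrix_(i, j) (j \in D i)%:R)
  (const_mx (- 2^-1)) (fun e i => [exists j in D i, e j]) smono smp cm cp _ _ h).
  by move=> i j; rewrite mxE ler0n.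
move=> e i; rewrite mxE; case: ifPn.
  move=> /existsP[j /andP[jD ej]]; rewrite (bigD1 j)//= mxE jD ej mulr1 /=.
    suff : 0 <= \sum_(k < n | k != j) (\matrix_(i0, j0) (j0 \in D i0)%:R) i k * (e k)%:R :> R by lra.
  by apply: sumr_ge0 => k _; rewrite mxE mulr_ge0.
move=> /existsPn H; rewrite big1 ?add0r// => j _.
rewrite mxE; have := H j; rewrite negb_and; case/orP => /negbTE ->.
  by rewrite mul0r.
by rewrite mulr0.
Qed.

Lemma gate_net_and (R : realType) (sigma : R -> R) (sm sp : R)
    (I : finType) (d n q : nat) (lo hi : R) (w : ('I_n -> bool) -> R)
    (c : 'I_n -> 'I_d -> 'I_#|I|) :
  {homo sigma : x y / x <= y} -> sm < sp ->
  sigma x @[x --> -oo] --> sm -> sigma x @[x --> +oo] --> sp ->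
  gate_net sigma sm sp q lo hi w ->
  gate_net sigma sm sp q.+1 lo hi
    (fun e : 'I_#|I| -> bool => w (fun i => [forall j, e (c i j)])).
Proof.
move=> smono smp cm cp h.
have E (e : 'I_#|I| -> bool) (i : 'I_n) : \sum_j (\matrix_(i, k) (\sum_(j < d) (c i j == k)%:R))
    i j * (e j)%:R = \sum_(j < d) (e (c i j))%:R :> R.
  under eq_bigr do rewrite mxE mulr_suml.
  rewrite exchange_big /=; apply: eq_bigr => j _.
  rewrite (bigD1 (c i j))//= eqxx mul1r big1 ?addr0// => k kc.
  by rewrite eq_sym (negbTE kc) mul0r.
apply: (@gate_net_layer _ _ _ _ _ _ _ _ _ _
  (\matrix_(i, k) (\sum_(j < d) (c i j == k)%:R))
  (const_mx (2^-1 - d%:R)) (fun e i => [forall j, e (c i j)]) smono smp cm cp _ _ h).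
  by move=> i j; rewrite mxE; apply: sumr_ge0.
move=> e i; rewrite E mxE; case: ifPn.
  move=> /forallP H; under eq_bigr do rewrite H.
  by rewrite sumr_const card_ord /=; lra.
move=> /forallPn[j ej]; rewrite (bigD1 j)//= (negbTE ej) add0r.
suff : \sum_(i0 < d | i0 != j) (e (c i i0))%:R <= d%:R - 1 :> R by lra.
apply: (@le_trans _ _ (\sum_(i0 < d | i0 != j) 1)).
  by apply: ler_sum => k _; rewrite lern1 leq_b1.
have -> : d%:R = \sum_(i0 < d) 1 :> R by rewrite sumr_const card_ord.
by rewrite [in leRHS](bigD1 j)//= [1 + _]addrC addrK.
Qed.

Lemma min_gap (R : realType) (I : finType) (f : I -> R) :
  exists2 r : R, 0 < r & forall i, 0 < f i -> r <= f i.
Proof.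
exists (\big[Num.min/1]_(i | 0 < f i) f i).
  by elim/big_ind: _ => // x y x0 y0; rewrite lt_min x0.
by move=> i fi; rewrite (bigD1 i)//= ge_min lexx.
Qed.

Lemma half_pos (R : realFieldType) (e : R) : 0 < e -> 0 < e / 2.
Proof. by move=> e0; rewrite divr_gt0. Qed.

(** At the points [P i], the monotone function [g] reaches a level exactly if the
    point dominates some [P j] at which [g] does.  The layers
    compute, in this order, the comparisons of coordinates with those of the
    [P j], the conjunctions of the comparisons over the coordinates, the
    disjunctions of the latter over the [j] at which [g] reaches a level, and
    the sum over the levels.  The points being finitely many, the comparisons can be shifted by
    half the least gap, so that no [P i] lies close to a threshold. *)
Lemma monotone_interpolation (R : realType) (sigma : R -> R) (sm sp : R)
    (d l m : nat) (g : 'cV[R]_d -> R) (P : 'I_m -> 'cV[R]_d) (lo hi eps : R) :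
  {homo sigma : x y / x <= y} -> sm < sp ->
  sigma x @[x --> -oo] --> sm -> sigma x @[x --> +oo] --> sp ->
  (3 <= l)%N -> cV_nondecreasing g -> lo <= hi ->
  (forall i, lo <= g (P i) <= hi) -> 0 < eps ->
  exists N : mlp R l d,
    [/\ mlp_ge0 N,
        forall z, lo <= mlp_eval sigma N z <= hi &
        forall i, `|mlp_eval sigma N (P i) - g (P i)| <= eps].
Proof.
move=> smono smp cm cp l3 gmono lohi gP eps0.
have [n n0 hn] : exists2 n : nat, (0 < n)%N & (hi - lo) / n%:R <= eps / 2.
  exists (Num.truncn ((hi - lo) / (eps / 2))).+1 => //.
  rewrite ler_pdivrMr// mulrC -ler_pdivrMr ?divr_gt0//.
  by apply/ltW/truncnS_gt.
pose del := (hi - lo) / n%:R.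
have del0 : 0 <= del by rewrite divr_ge0// subr_ge0.
have hiE : lo + n%:R * del = hi.
  by rewrite /del; field; rewrite pnatr_eq0 -lt0n.
pose lev (k : 'I_n) := lo + k.+1%:R * del.
pose J := ('I_m * 'I_d)%type.
pose idx (i : 'I_m) (c : 'I_d) : 'I_#|{: J}| := enum_rank (i, c).
pose D (k : 'I_n) := [set i : 'I_m | lev k <= g (P i)]%SET.
have H := gate_net_out sigma n lo smp del0.
have {}H := gate_net_identity (l - 3) smono smp cm cp H.
have {}H := gate_net_or D smono smp cm cp H.
have {H} := gate_net_and idx smono smp cm cp H.
rewrite addn0 => H.
have [N' [kap kap0 [N'0 N'b N'w]]] := H (eps / 2) (half_pos eps0).
have [r r0 rP] := min_gap (fun j : J * 'I_m => P j.1.1 j.1.2 0 - P j.2 j.1.2 0).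
have [Lam Lam0 [LamP LamN]] := squash_threshold smp cm cp kap0.
have s01 := squash01 smono smp cm cp.
have D0 : sp - sm != 0 by rewrite subr_eq0 gt_eqF.
(* Thresholds are moved down by [r / 2], half the least gap; the slope [lam] turns
   this distance into [Lam]. *)
pose lam := 2 * Lam / r.
have lam0 : 0 < lam by rewrite divr_gt0// mulr_gt0.
pose pc (j : 'I_#|{: J}|) := P (enum_val j).1 (enum_val j).2 0.
pose N := mlp_hidden
  (\matrix_(j < #|{: J}|, c < d) (lam * ((enum_val j).2 == c)%:R))
  (\col_j (lam * (r / 2 - pc j))) N'.
have NE z : mlp_eval sigma N z = mlp_eval sigma N' (unsquash sm sp
    (\col_j squash sm sp (sigma (lam * (z (enum_val j).2 0 - pc j + r / 2))))).
  rewrite /=; congr (mlp_eval _ _ _); apply/colP => j; rewrite !mxE.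
  rewrite /squash [(sp - sm) * _]mulrC divfK// [RHS]addrC subrK; congr (sigma _).
  rewrite (bigD1 (enum_val j).2)//= mxE eqxx big1; last first.
    by move=> c cj; rewrite mxE eq_sym (negbTE cj) mulr0 mul0r.
  by rewrite /=; ring.
have lE : ((l - 3).+2.+1 = l)%N by rewrite -addn3 subnK.
have [M [M0 Mb Mi]] : exists M : mlp R (l - 3).+2.+1 d, [/\ mlp_ge0 M,
    forall z, lo <= mlp_eval sigma M z <= hi &
    forall i, `|mlp_eval sigma M (P i) - g (P i)| <= eps].
  exists N; split.
  - split => // i j; rewrite mxE mulr_ge0// ltW//.
  - by move=> z; rewrite NE -hiE; apply: N'b => j; rewrite mxE.
  - move=> i; rewrite NE.
    pose e (j : 'I_#|{: J}|) := pc j <= P i (enum_val j).2 0.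
    set y := \col_j _.
    have ye j : `|y j 0 - (e j)%:R| <= kap.
      rewrite mxE /e; case: (lerP (pc j) (P i (enum_val j).2 0)) => h /=.
        apply: LamP; rewrite (_ : Lam = lam * (r / 2)); last first.
          by rewrite /lam; field; rewrite gt_eqF.
        by rewrite ler_pM2l// lerDr subr_ge0.
      rewrite subr0; apply: LamN; rewrite (_ : Lam = lam * (r / 2)); last first.
        by rewrite /lam; field; rewrite gt_eqF.
      rewrite -mulrN ler_pM2l//.
      have := rP (enum_val j, i); rewrite /= subr_gt0 => /(_ h).
      by rewrite /pc; lra.
    have := N'w y e ye.
    set W := (X in `|_ - X| <= _).
    have -> : W = lo + \sum_(k < n) del * (lev k <= g (P i))%R%:R.
      rewrite /W; congr (_ + _); apply: eq_bigr => k _; congr (_ * _%:R).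
      congr nat_of_bool; apply/existsP/idP.
        move=> [j /andP[]]; rewrite inE => jk /forallP ej.
        apply: (le_trans jk); apply: gmono => c.
        by have := ej c; rewrite /e /pc /idx enum_rankK.
      move=> ik; exists i; rewrite inE ik /=; apply/forallP => c.
      by rewrite /e /pc /idx enum_rankK.
    have /andP[] := @level_sum R (g (P i)) lo del n del0 ltac:(by rewrite hiE).
    rewrite -/lev; set Z := lo + _; move=> h1 h2.
    have : del <= eps / 2 by [].
    by rewrite !ler_norml => h3 /andP[h4 h5]; apply/andP; split; lra.
by move: lE M M0 Mb Mi => -> M M0 Mb Mi; exists M.
Qed.

(** * Smooth functions of one variable *)

(** The recursion on the derivative lets closure under the operations follow from
    the rules for first derivatives. *)
Fixpoint smooth_upto (R : realType) (k : nat) (f : R -> R) : Prop :=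
  match k with
  | 0 => continuous f
  | k'.+1 => (forall x, derivable f x 1) /\ smooth_upto k' (derive1 f)
  end.

Definition smooth1 (R : realType) (f : R -> R) : Prop :=
  forall k, smooth_upto k f.

Lemma derivable_continuous (R : realType) (f : R -> R) :
  (forall x, derivable f x 1) -> continuous f.
Proof.
by move=> df x; apply/differentiable_continuous/derivable1_diffP; exact: df.
Qed.

Lemma smooth_upto_pred (R : realType) (k : nat) (f : R -> R) :
  smooth_upto k.+1 f -> smooth_upto k f.
Proof.
elim: k f => [|k IH] f; first by move=> [df _]; exact: derivable_continuous.
by move=> [df sf]; split => //; exact: IH.
Qed.

Lemma smooth1_cst (R : realType) (c : R) : smooth1 (fun=> c).
Proof.
move=> k; elim: k c => [|k IH] c /=; first exact: cst_continuous.
split; first by move=> x; exact: derivable_cst.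
by rewrite (_ : derive1 _ = fun=> 0)//; apply/funext => x; rewrite derive1_cst.
Qed.

Lemma smooth_uptoD (R : realType) (k : nat) (f g : R -> R) :
  smooth_upto k f -> smooth_upto k g -> smooth_upto k (fun x => f x + g x).
Proof.
elim: k f g => [|k IH] f g /=.
  by move=> cf cg x; apply: continuousD; [exact: cf|exact: cg].
move=> [df sf] [dg sg]; split => [x|]; first exact: derivableD.
rewrite (_ : derive1 _ = fun x => derive1 f x + derive1 g x); first exact: IH.
by apply/funext => x; rewrite !derive1E deriveD.
Qed.

Lemma smooth_uptoM (R : realType) (k : nat) (f g : R -> R) :
  smooth_upto k f -> smooth_upto k g -> smooth_upto k (fun x => f x * g x).
Proof.
elim: k f g => [|k IH] f g.
  by move=> cf cg x; apply: continuousM; [exact: cf|exact: cg].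
move=> sf sg; have [df sf'] := sf; have [dg sg'] := sg.
split => [x|]; first exact: derivableM.
rewrite (_ : derive1 _ = fun x => f x * derive1 g x + g x * derive1 f x).
  apply: smooth_uptoD; apply: IH => //; exact: smooth_upto_pred.
by apply/funext => x; rewrite !derive1E deriveM.
Qed.

Lemma smooth_uptoV (R : realType) (k : nat) (f : R -> R) :
  (forall x, 0 < f x) -> smooth_upto k f -> smooth_upto k (fun x => (f x)^-1).
Proof.
move=> f0; elim: k => [|k IH].
  by move=> cf x; apply: continuousV; [rewrite gt_eqF|exact: cf].
move=> sf; have [df sf'] := sf; have f0' x : f x != 0 by rewrite gt_eqF.
split => [x|]; first exact: derivableV.
rewrite (_ : derive1 _ = fun x => (-1 * derive1 f x) * ((f x)^-1 * (f x)^-1)).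
  have h := IH (smooth_upto_pred sf).
  apply: smooth_uptoM; last exact: smooth_uptoM.
  by apply: smooth_uptoM => //; exact: smooth1_cst.
apply/funext => x; rewrite !derive1E deriveV//.
by rewrite /GRing.scale /=; field.
Qed.

Lemma derive1_affine (R : realType) (f : R -> R) (a b x : R) :
  (forall x, derivable f x 1) ->
  derivable (fun y => f (a * y + b)) x 1 /\
  derive1 (fun y => f (a * y + b)) x = a * derive1 f (a * x + b).
Proof.
move=> df.
have h : is_derive x 1 (fun y : R => a * y + b) a.
  have -> : (fun y : R => a * y + b) = (a \*: id) + cst b by [].
  by apply: is_derive_eq; rewrite addr0 /GRing.scale /= mulr1.
have hf : is_derive (a * x + b) 1 f (derive1 f (a * x + b)).
  by rewrite derive1E; exact: derivableP.
have [dc vc] := @is_derive1_comp _ f (fun y => a * y + b) x _ _ hf h.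
split; first exact: dc.
by rewrite derive1E mulrC -vc.
Qed.

Lemma smooth_upto_affine (R : realType) (k : nat) (f : R -> R) (a b : R) :
  smooth_upto k f -> smooth_upto k (fun y => f (a * y + b)).
Proof.
elim: k f => [|k IH] f /=.
  move=> cf x; apply: (@continuous_comp _ _ _ (fun y => a * y + b) f).
    by apply: continuousD; [apply: continuousM|]; exact: cst_continuous || exact: id.
  exact: cf.
move=> [df sf]; split => [x|]; first by case: (derive1_affine a b x df).
rewrite (_ : derive1 _ = fun x => a * derive1 f (a * x + b)).
  by apply: smooth_uptoM; [exact: smooth1_cst|exact: IH].
by apply/funext => x; case: (derive1_affine a b x df).
Qed.

(** This handles the derivative of the flat functions at the origin. *)
Lemma is_derive_quadratic (R : realType) (f : R -> R) (C : R) :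
  f 0 = 0 -> (forall h, `|f h| <= C * h ^+ 2) -> is_derive (0 : R) 1 f 0.
Proof.
move=> f0 fC.
have H : h^-1 *: (f (h *: 1 + 0) - f 0) @[h --> 0^'] --> (0 : R).
  apply/cvgr0Pnorm_le => e e0.
  have C0 : 0 < `|C| + 1 by rewrite ltr_wpDl.
  near=> h; have h0 : h != 0 by near: h; exact: nbhs_dnbhs_neq.
  rewrite f0 subr0 addr0 /GRing.scale /= mulr1 normrM normfV mulrC.
  rewrite ler_pdivrMr ?normr_gt0//; apply: (le_trans (fC h)).
  have -> : h ^+ 2 = `|h| * `|h| by rewrite -expr2 real_normK ?num_real.
  rewrite mulrA ler_pM2r ?normr_gt0//.
  have hd : `|h| <= e / (`|C| + 1).
    near: h; apply: dnbhs0_le; exact: divr_gt0.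
  apply: (@le_trans _ _ ((`|C| + 1) * `|h|)).
    by rewrite ler_wpM2r//; apply: (le_trans (ler_norm C)); rewrite lerDl.
  by rewrite mulrC -ler_pdivlMr.
apply: DeriveDef; first by apply/cvg_ex; exists 0.
exact: cvg_lim H.
Unshelve. all: by end_near.
Qed.

(** * A smooth transition from 0 to 1 *)

(** The functions [p(1/x) exp(-1/x)], extended by 0 to [x <= 0], are stable under
    differentiation, which gives all the derivatives of [exp(-1/x)] at once. *)
Definition flat_exp (R : realType) (p : {poly R}) (x : R) : R :=
  if 0 < x then p.[x^-1] * expR (- x^-1) else 0.

Lemma poly_expR_bounded (R : realType) (p : {poly R}) :
  exists C : R, forall y, 0 < y -> `|p.[y] * expR (- y)| <= C.
Proof.
(* [y ^+ n <= n`! * expR y] bounds each monomial. *)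
exists (\sum_(i < size p) `|p`_i| * i`!%:R) => y y0.
rewrite horner_coef mulr_suml; apply: le_trans (ler_norm_sum _ _ _) _.
apply: ler_sum => i _; rewrite -mulrA normrM; apply: ler_wpM2l => //.
rewrite ger0_norm; last by rewrite mulr_ge0 ?expR_ge0// exprn_ge0// ltW.
rewrite expRN ler_pdivrMr ?expR_gt0//.
case: (i : nat) => [|n].
  by rewrite expr0 mul1r -expR0 ler_expR ltW.
rewrite mulrC -ler_pdivrMr ?ltr0n ?fact_gt0//.
by apply: le_trans (expR_ge1Dxn n (ltW y0)); rewrite lerDr.
Qed.

(** Since [y ^+ 2] times a polynomial in [y] is still beaten by the exponential,
    these functions vanish to second order at the origin. *)
Lemma flat_exp_quadratic (R : realType) (p : {poly R}) :
  exists C : R, forall x, `|flat_exp p x| <= C * x ^+ 2.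
Proof.
have [C HC] := poly_expR_bounded (p * 'X^2); exists C => x.
have C0 : 0 <= C by apply: le_trans (HC 1 ltr01); exact: normr_ge0.
rewrite /flat_exp; case: ifPn => x0; last by rewrite normr0 mulr_ge0// sqr_ge0.
have xi0 : 0 < x^-1 by rewrite invr_gt0.
have := HC _ xi0; rewrite hornerM hornerXn mulrAC normrM.
rewrite [X in _ * X]ger0_norm ?sqr_ge0// exprVn ler_pdivrMr//.
by rewrite exprn_gt0.
Qed.

Lemma is_derive_flat_exp (R : realType) (p : {poly R}) (x : R) :
  is_derive x 1 (flat_exp p) (flat_exp ('X^2 * (p - p^`())) x).
Proof.
have [x0|x0|->] := ltgtP x 0.
- have xn : \forall y \near x, flat_exp p y = 0.
    near=> y; rewrite /flat_exp ltNge (_ : y <= 0)//.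
    by apply/ltW; near: y; exact: lt_nbhsl.
  rewrite {2}/flat_exp ltNge (ltW x0) /=.
  apply: (@near_eq_is_derive _ _ _ (cst 0)) => //.
  by apply: filterS xn => y ->.
- have -> : flat_exp ('X^2 * (p - p^`())) x =
      (- x ^- 2) * (p^`()).[x^-1] * expR (- x^-1)
      + p.[x^-1] * (expR (- x^-1) * x ^- 2).
    rewrite /flat_exp x0 hornerM hornerXn hornerD hornerN -exprVn.
    by ring.
  have xn0 : x != 0 by rewrite gt_eqF.
  have xn : \forall y \near x, p.[y^-1] * expR (- y^-1) = flat_exp p y.
    near=> y; rewrite /flat_exp (_ : 0 < y)//.
    by near: y; exact: lt_nbhsr.
  apply: (@near_eq_is_derive _ R R (fun y : R => p.[y^-1] * expR (- y^-1)) _ _ _ _ xn).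
  have iV : is_derive x 1 (fun y : R => y^-1) (- x ^- 2).
    apply: is_derive_eq (is_deriveV (f := id) xn0 (is_derive_id x 1)) _.
    by rewrite /GRing.scale /= mulr1.
  have iN : is_derive x 1 (fun y : R => - y^-1) (x ^- 2).
    by apply: is_derive_eq (is_deriveN iV) _; rewrite opprK.
  have ie : is_derive x 1 (fun y => expR (- y^-1)) (expR (- x^-1) * x ^- 2).
    exact: (@is_derive1_comp _ expR (fun y => - y^-1)).
  have ip : is_derive x 1 (fun y => p.[y^-1]) (p^`().[x^-1] * (- x ^- 2)).
    exact: (@is_derive1_comp _ (horner p) (fun y => y^-1)).
  apply: is_derive_eq (is_deriveM ip ie) _.
  by rewrite /GRing.scale /=; ring.
- rewrite {2}/flat_exp ltxx.
  have [C HC] := flat_exp_quadratic p.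
  by apply: is_derive_quadratic HC; rewrite /flat_exp ltxx.
Unshelve. all: by end_near.
Qed.

Lemma smooth_flat_exp (R : realType) (p : {poly R}) : smooth1 (flat_exp p).
Proof.
have df (q : {poly R}) x : derivable (flat_exp q) x 1.
  by case: (is_derive_flat_exp q x).
move=> k; elim: k p => [|k IH] p /=; first exact: derivable_continuous.
split=> [x|]; first exact: df.
rewrite (_ : derive1 _ = flat_exp ('X^2 * (p - p^`()))); first exact: IH.
by apply/funext => x; rewrite derive1E; case: (is_derive_flat_exp p x).
Qed.

(** The standard quotient: the denominator is positive because [x] and [1 - x] are
    not both nonpositive. *)
Definition transition (R : realType) (x : R) : R :=
  flat_exp 1 x * (flat_exp 1 x + flat_exp 1 (-1 * x + 1))^-1.

Lemma flat_exp1_ge0 (R : realType) (x : R) : 0 <= flat_exp 1 x.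
Proof.
by rewrite /flat_exp; case: ifP => // _; rewrite hornerC mul1r expR_ge0.
Qed.

Lemma flat_exp1_gt0 (R : realType) (x : R) : 0 < x -> 0 < flat_exp 1 x.
Proof. by rewrite /flat_exp => ->; rewrite hornerC mul1r expR_gt0. Qed.

Lemma flat_exp1_le0 (R : realType) (x : R) : x <= 0 -> flat_exp 1 x = 0.
Proof. by rewrite /flat_exp ltNge => ->. Qed.

Lemma flat_exp1_nondecreasing (R : realType) :
  {homo @flat_exp R 1 : x y / x <= y}.
Proof.
move=> x y xy; have [x0|x0] := lerP x 0.
  by rewrite (flat_exp1_le0 x0) flat_exp1_ge0.
have y0 := lt_le_trans x0 xy.
rewrite /flat_exp x0 y0 !hornerC !mul1r ler_expR lerN2 lef_pV2//.
Qed.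

Lemma transition_den_gt0 (R : realType) (x : R) :
  0 < flat_exp 1 x + flat_exp 1 (-1 * x + 1).
Proof.
have [x0|x0] := lerP x 0.
  by rewrite ltr_wpDl// ?flat_exp1_ge0// flat_exp1_gt0//; lra.
by rewrite ltr_pwDl ?flat_exp1_ge0// flat_exp1_gt0.
Qed.

Lemma smooth_transition (R : realType) : smooth1 (@transition R).
Proof.
move=> k; apply: smooth_uptoM; first exact: smooth_flat_exp.
apply: smooth_uptoV; first exact: transition_den_gt0.
apply: smooth_uptoD; first exact: smooth_flat_exp.
exact: (smooth_upto_affine (-1) 1 (@smooth_flat_exp R 1 k)).
Qed.

Lemma transition_le0 (R : realType) (x : R) : x <= 0 -> transition x = 0.
Proof. by move=> x0; rewrite /transition (flat_exp1_le0 x0) mul0r. Qed.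

Lemma transition_ge1 (R : realType) (x : R) : 1 <= x -> transition x = 1.
Proof.
move=> x1; rewrite /transition [X in _ + X]flat_exp1_le0; last by lra.
by rewrite addr0 mulfV// gt_eqF// flat_exp1_gt0// (lt_le_trans ltr01 x1).
Qed.

Lemma transition_nondecreasing (R : realType) :
  {homo @transition R : x y / x <= y}.
Proof.
move=> x y xy; rewrite /transition.
rewrite ler_pdivrMr ?transition_den_gt0// mulrAC ler_pdivlMr ?transition_den_gt0//.
rewrite !mulrDr [flat_exp 1 y * flat_exp 1 x]mulrC lerD2l.
apply: ler_pM; rewrite ?flat_exp1_ge0//; apply: flat_exp1_nondecreasing => //.
by lra.
Qed.

Definition smooth_step (R : realType) (p q : R) (y : R) : R :=
  transition ((q - p)^-1 * y + - (p / (q - p))).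

Lemma smooth_stepE (R : realType) (p q y : R) : 
  smooth_step p q y = transition ((y - p) / (q - p)).
Proof. by rewrite /smooth_step mulrC -mulrBl. Qed.

Lemma smooth_smooth_step (R : realType) (p q : R) : smooth1 (smooth_step p q).
Proof. by move=> k; apply: smooth_upto_affine; exact: smooth_transition. Qed.

Lemma smooth_step_le (R : realType) (p q y : R) :
  p < q -> y <= p -> smooth_step p q y = 0.
Proof.
move=> pq yp; rewrite smooth_stepE transition_le0//.
by rewrite ler_pdivrMr ?subr_gt0// mul0r subr_le0.
Qed.

Lemma smooth_step_ge (R : realType) (p q y : R) :
  p < q -> q <= y -> smooth_step p q y = 1.
Proof.
move=> pq yp; rewrite smooth_stepE transition_ge1//.
by rewrite ler_pdivlMr ?subr_gt0// mul1r lerD2r.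
Qed.

Lemma smooth_step_nondecreasing (R : realType) (p q : R) :
  p < q -> {homo smooth_step p q : x y / x <= y}.
Proof.
move=> pq x y xy; rewrite !smooth_stepE; apply: transition_nondecreasing.
by rewrite ler_pM2r ?invr_gt0 ?subr_gt0// lerD2r.
Qed.

Lemma smooth_step_itv (R : realType) (p q y : R) :
  p < q -> 0 <= smooth_step p q y <= 1.
Proof.
move=> pq; apply/andP; split.
  have [yp|/ltW py] := lerP y p; first by rewrite smooth_step_le.
  by rewrite -(smooth_step_le pq (lexx p)); exact: smooth_step_nondecreasing.
have [qy|/ltW yq] := lerP q y; first by rewrite smooth_step_ge.
by rewrite -(smooth_step_ge pq (lexx q)); exact: smooth_step_nondecreasing.
Qed.

(** Adding [e * y] makes [f] increasing; then let [e] tend to 0. *)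
Lemma nondecreasing_derive1_ge0 (R : realType) (f : R -> R) (x : R) :
  {homo f : x y / x <= y} -> (forall x, derivable f x 1) -> 0 <= derive1 f x.
Proof.
move=> fmono df; apply/ler_addgt0Pr => e e0.
have hd (y : R) : is_derive y 1 (fun y => f y + e * y) (derive1 f y + e).
  have -> : (fun y => f y + e * y) = f + (e \*: id) by [].
  apply: is_derive_eq (is_deriveD (derivableP (df y)) _) _.
  by rewrite derive1E /GRing.scale /= mulr1.
have -> : derive1 f x + e = derive1 (fun y => f y + e * y) x.
  by rewrite [in RHS]derive1E; case: (hd x).
have dg (y : R) : derivable (fun y => f y + e * y) y 1 by case: (hd y).
apply: (@incr_derive1_ge0 _ _ setT) => //; last by rewrite interiorT.
by move=> a b _ _ ab; rewrite ler_ltD ?ltr_pM2l// fmono// ltW.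
Qed.

Lemma smooth_step_derive_ge0 (R : realType) (p q y : R) :
  p < q -> 0 <= derive1 (smooth_step p q) y.
Proof.
move=> pq; apply: nondecreasing_derive1_ge0.
  exact: smooth_step_nondecreasing.
by case: (smooth_smooth_step p q 1).
Qed.

Lemma locally_constant_derive1n (R : realType) (f : R -> R) (c x : R) (j : nat) :
  (\forall y \near x, f y = c) ->
  \forall y \near x, derive1n j f y = if j == 0%N then c else 0.
Proof.
elim: j => [|j IH] H; first by rewrite derive1n0.
have {}H := IH H; move/nbhs_interior : H; apply: filterS => y yH.
rewrite derive1nS derive1E /=; set d := (if _ then _ else _) in yH.
have -> : 'D_1 (derive1n j f) y = 'D_1 (cst d) y by exact: near_eq_derive.
by rewrite derive_cst.
Qed.

Lemma smooth_step_derive_out (R : realType) (p q y : R) :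
  p < q -> (y < p) || (q < y) -> derive1 (smooth_step p q) y = 0.
Proof.
move=> pq /orP[yp|qy].
  have : \forall z \near y, smooth_step p q z = 0.
    near=> z; apply: smooth_step_le => //; apply/ltW; near: z; exact: lt_nbhsl.
  by move/(locally_constant_derive1n 1)/nbhs_singleton; rewrite derive1n1.
have : \forall z \near y, smooth_step p q z = 1.
  near=> z; apply: smooth_step_ge => //; apply/ltW; near: z; exact: lt_nbhsr.
by move/(locally_constant_derive1n 1)/nbhs_singleton; rewrite derive1n1.
Unshelve. all: by end_near.
Qed.

(** * Products as test functions *)

Definition tensor (R : realType) (a b : R -> R) (p : R * R) : R :=
  a p.1 * b p.2.

(** Along an axis only one factor varies: the difference quotients of the
    two sides coincide. *)
Lemma derive_tensor_t (R : realType) (a b : R -> R) (t x : R) :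
  'D_((1 : R), (0 : R)) (tensor a b) (t, x) = 'D_1 (fun s => a s * b x) t.
Proof.
apply: (congr1 (fun g : R -> R => lim (g h @[h --> 0^']))).
by apply/funext => h; rewrite /tensor /= scaler0 add0r.
Qed.

Lemma derive_tensor_x (R : realType) (a b : R -> R) (t x : R) :
  'D_((0 : R), (1 : R)) (tensor a b) (t, x) = 'D_1 (fun y => a t * b y) x.
Proof.
apply: (congr1 (fun g : R -> R => lim (g h @[h --> 0^']))).
by apply/funext => h; rewrite /tensor /= scaler0 add0r.
Qed.

Lemma pd_t_tensor (R : realType) (a b : R -> R) :
  (forall x, derivable a x 1) -> pd_t (tensor a b) = tensor (derive1 a) b.
Proof.
move=> da; apply/funext => -[t x]; rewrite /pd_t derive_tensor_t.
by rewrite -derive1E derive1Mr// derive1E.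
Qed.

Lemma pd_x_tensor (R : realType) (a b : R -> R) :
  (forall x, derivable b x 1) -> pd_x (tensor a b) = tensor a (derive1 b).
Proof.
move=> db; apply/funext => -[t x]; rewrite /pd_x derive_tensor_x.
by rewrite -derive1E derive1Ml// derive1E.
Qed.

Lemma differentiable_fst (R : realType) (p : R * R) :
  differentiable (fst : R * R -> R) p.
Proof.
have fl : linear (fst : (R * R)%type -> R^o) by [].
pose fM := GRing.isLinear.Build _ _ _ _ _ fl.
pose f : {linear (R * R)%type -> R^o} := HB.pack (fst : (R * R)%type -> R^o) fM.
by apply: (@linear_differentiable _ _ _ f p) => q; exact: cvg_fst.
Qed.

Lemma differentiable_snd (R : realType) (p : R * R) :
  differentiable (snd : R * R -> R) p.
Proof.
have fl : linear (snd : (R * R)%type -> R^o) by [].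
pose fM := GRing.isLinear.Build _ _ _ _ _ fl.
pose f : {linear (R * R)%type -> R^o} := HB.pack (snd : (R * R)%type -> R^o) fM.
by apply: (@linear_differentiable _ _ _ f p) => q; exact: cvg_snd.
Qed.

Lemma differentiable_tensor (R : realType) (a b : R -> R) (p : R * R) :
  (forall x, derivable a x 1) -> (forall x, derivable b x 1) ->
  differentiable (tensor a b) p.
Proof.
move=> da db; apply: differentiableM.
  apply: (@differentiable_comp _ _ _ _ (fst : R * R -> R) a).
    exact: differentiable_fst.
  exact/derivable1_diffP.
apply: (@differentiable_comp _ _ _ _ (snd : R * R -> R) b).
  exact: differentiable_snd.
exact/derivable1_diffP.
Qed.

Lemma smooth_derive1n (R : realType) (a : R -> R) (j : nat) :
  smooth1 a -> smooth1 (derive1n j a).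
Proof.
elim: j => [|j IH] sa; first by rewrite derive1n0.
by move=> k; rewrite derive1nS; case: (IH sa k.+1).
Qed.

Lemma smooth_tensor (R : realType) (a b : R -> R) :
  smooth1 a -> smooth1 b -> smooth (tensor a b).
Proof.
move=> sa sb k; elim: k a b sa sb => [|k IH] a b sa sb /=.
  have [da _] := sa 1%N; have [db _] := sb 1%N.
  by move=> p; apply: differentiable_continuous; exact: differentiable_tensor.
have [da _] := sa 1%N; have [db _] := sb 1%N; split.
- by move=> p; exact: differentiable_tensor.
- rewrite pd_t_tensor//; apply: IH => //.
  by move=> n; case: (sa n.+1).
- rewrite pd_x_tensor//; apply: IH => //.
  by move=> n; case: (sb n.+1).
Qed.

Lemma pd_tensor (R : realType) (a b : R -> R) (i j : nat) :
  smooth1 a -> smooth1 b ->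
  pd i j (tensor a b) = tensor (derive1n i a) (derive1n j b).
Proof.
move=> sa sb; rewrite /pd.
have -> : iter j (@pd_x R) (tensor a b) = tensor a (derive1n j b).
  elim: j => [|j IH]; first by rewrite derive1n0.
  rewrite iterS IH pd_x_tensor -?derive1nS// => x.
  by case: (smooth_derive1n j sb 1).
elim: i => [|i IH]; first by rewrite derive1n0.
rewrite iterS IH pd_t_tensor -?derive1nS// => x.
by case: (smooth_derive1n i sa 1).
Qed.

(** Periodicity of all derivatives holds because the factor in [x] equals the same
    constant near both ends. *)
Lemma tensor_periodic_test (R : realType) (T L tau c : R) (a b : R -> R) :
  0 < L -> tau < T -> smooth1 a -> smooth1 b ->
  (forall t, tau <= t -> a t = 0) ->
  (\forall x \near (0 : R), b x = c) -> (\forall x \near L, b x = c) ->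
  periodic_test T L (tensor a b).
Proof.
move=> L0 tauT sa sb a0 b0 bL; split; first exact: smooth_tensor.
  exists (`[0, tau]%classic `*` `[0, L]%classic); split.
  - by apply: compact_setX; exact: segment_compact.
  - move=> [t x] /= [t0 x0]; split => //; move: t0; rewrite !in_itv /=.
    by move=> /andP[-> tt]; exact: le_lt_trans tauT.
  - move=> [t x] /= [t0 x0] H; rewrite /tensor /= a0 ?mul0r//.
    rewrite leNgt; apply/negP => tt; apply: H; split => //.
    by move: t0; rewrite /= !in_itv /= => /andP[-> _]; exact: ltW.
move=> i j t _; rewrite pd_tensor// /tensor /=; congr (_ * _).
rewrite (nbhs_singleton (locally_constant_derive1n j b0)).
by rewrite (nbhs_singleton (locally_constant_derive1n j bL)).
Qed.

(** * Integrals of locally bounded Borel functions *)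

Local Notation rint a b f := (\int[@lebesgue_measure _]_(x in `[a, b]) f x) (only parsing).

(** A class of functions with integrable restrictions to all bounded intervals
    that is stable under sums and products, so that linearity and monotonicity of
    the integral apply without side conditions. *)
Definition tame (R : realType) (f : R -> R) : Prop :=
  measurable_fun setT f /\
  forall a b : R, exists M, forall x, a <= x <= b -> `|f x| <= M.

Lemma tame_cst (R : realType) (c : R) : tame (fun=> c).
Proof. by split; [exact: measurable_cst|move=> a b; exists `|c|]. Qed.

Lemma tameD (R : realType) (f g : R -> R) :
  tame f -> tame g -> tame (fun x => f x + g x).
Proof.
move=> [mf bf] [mg bg]; split; first exact: measurable_realfun.measurable_funD.
move=> a b; have [M HM] := bf a b; have [N HN] := bg a b; exists (M + N) => x xab.
by apply: le_trans (ler_normD _ _) _; apply: lerD; [exact: HM|exact: HN].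
Qed.

Lemma tameM (R : realType) (f g : R -> R) :
  tame f -> tame g -> tame (fun x => f x * g x).
Proof.
move=> [mf bf] [mg bg]; split; first exact: measurable_realfun.measurable_funM.
move=> a b; have [M HM] := bf a b; have [N HN] := bg a b; exists (M * N) => x xab.
by rewrite normrM; apply: ler_pM => //; [exact: HM|exact: HN].
Qed.

Lemma tameN (R : realType) (f : R -> R) : tame f -> tame (fun x => - f x).
Proof.
move=> tf; rewrite (_ : (fun x => - f x) = fun x => -1 * f x).
  by apply: tameM => //; exact: tame_cst.
by apply/funext => x; rewrite mulN1r.
Qed.

Lemma tameB (R : realType) (f g : R -> R) :
  tame f -> tame g -> tame (fun x => f x - g x).
Proof. by move=> tf tg; apply: tameD => //; exact: tameN. Qed.

Lemma tame_norm (R : realType) (f : R -> R) : tame f -> tame (fun x => `|f x|).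
Proof.
move=> [mf bf]; split; first exact: measurableT_comp.
by move=> a b; have [M HM] := bf a b; exists M => x xab; rewrite normr_id HM.
Qed.

Lemma tame_sum (R : realType) (I : Type) (s : seq I) (f : I -> R -> R) :
  (forall i, tame (f i)) -> tame (fun x => \sum_(i <- s) f i x).
Proof.
move=> tf; elim: s => [|i s IH].
  rewrite (_ : (fun x => _) = fun=> 0); first exact: tame_cst.
  by apply/funext => x; rewrite big_nil.
rewrite (_ : (fun x => _) = fun x => f i x + \sum_(j <- s) f j x).
  exact: tameD.
by apply/funext => x; rewrite big_cons.
Qed.

Lemma tame_nondecreasing (R : realType) (f : R -> R) :
  {homo f : x y / x <= y} -> tame f.
Proof.
move=> fm; split; first exact: measurable_realfun.nondecreasing_measurable.
move=> a b; exists (`|f a| + `|f b|) => x /andP[ax xb].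
have := fm _ _ ax; have := fm _ _ xb.
have := ler_norm (f b); have := ler_norm (- f a); rewrite normrN.
have := normr_ge0 (f a); have := normr_ge0 (f b).
by rewrite ler_norml => ? ? ? ? ? ?; apply/andP; split; lra.
Qed.

(** The function is the difference of the nondecreasing functions [g + H] and [H].
    Everything that is built from [u] is measurable for
    this reason. *)
Lemma tame_dominated (R : realType) (H g : R -> R) :
  (forall x y, x <= y -> `|g y - g x| <= H y - H x) -> tame g.
Proof.
move=> gH.
have Hm : {homo H : x y / x <= y}.
  by move=> x y xy; have := gH _ _ xy; have := normr_ge0 (g y - g x); lra.
have gHm : {homo (fun x => g x + H x) : x y / x <= y}.
  by move=> x y xy; have := gH _ _ xy; rewrite ler_norml => /andP[]; lra.
rewrite (_ : g = fun x => (g x + H x) - H x).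
  by apply: tameB; exact: tame_nondecreasing.
by apply/funext => x; rewrite addrK.
Qed.

Lemma tame_continuous (R : realType) (f : R -> R) : continuous f -> tame f.
Proof.
move=> cf; split; first exact: measurable_realfun.continuous_measurable_fun.
move=> a b; have [ab|ba] := lerP a b; last first.
  by exists 0 => x /andP[ax xb]; have := le_lt_trans (le_trans ax xb) ba; rewrite ltxx.
have cw : {within `[a, b], continuous f} by exact: continuous_subspaceT.
have [c _ hc] := EVT_max ab cw; have [d _ hd] := EVT_min ab cw.
exists (`|f c| + `|f d|) => x xab.
have := hc x; rewrite in_itv /= => /(_ xab); have := hd x; rewrite in_itv /= => /(_ xab).
have := ler_norm (f c); have := ler_norm (- f d); rewrite normrN.
have := normr_ge0 (f c); have := normr_ge0 (f d).
by rewrite ler_norml => ? ? ? ? ? ?; apply/andP; split; lra.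
Qed.

Lemma tame_integrable (R : realType) (f : R -> R) (a b : R) :
  tame f -> (@lebesgue_measure R).-integrable `[a, b] (EFin \o f).
Proof.
move=> [mf bf]; apply: measurable_bounded_integrable.
- exact: measurable_itv.
- by rewrite /= lebesgue_measure_itv /=; case: ifP => _; rewrite ?ltry// -EFinB ltry.
- exact: measurable_funTS.
- have [M HM] := bf a b; exists M; split; first exact: num_real.
  move=> N MN x; rewrite /= in_itv /= => xab; exact: le_trans (HM _ xab) (ltW MN).
Qed.

Lemma rintD (R : realType) (f g : R -> R) (a b : R) : tame f -> tame g ->
  rint a b (fun x => f x + g x) = rint a b f + rint a b g.
Proof. by move=> tf tg; apply: RintegralD => //; exact: tame_integrable. Qed.

Lemma rintB (R : realType) (f g : R -> R) (a b : R) : tame f -> tame g ->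
  rint a b (fun x => f x - g x) = rint a b f - rint a b g.
Proof. by move=> tf tg; apply: RintegralB => //; exact: tame_integrable. Qed.

Lemma rintZ (R : realType) (f : R -> R) (a b r : R) : tame f ->
  rint a b (fun x => r * f x) = r * rint a b f.
Proof. by move=> tf; apply: RintegralZl => //; exact: tame_integrable. Qed.

Lemma eq_rint (R : realType) (f g : R -> R) (a b : R) :
  (forall x, a <= x <= b -> f x = g x) -> rint a b f = rint a b g.
Proof.
by move=> fg; apply: eq_Rintegral => x; rewrite inE /= in_itv /=; exact: fg.
Qed.

Lemma le_rint (R : realType) (f g : R -> R) (a b : R) : tame f -> tame g ->
  (forall x, a <= x <= b -> f x <= g x) -> rint a b f <= rint a b g.
Proof.
by move=> tf tg fg; apply: le_Rintegral => //; exact: tame_integrable.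
Qed.

Lemma rint_cst (R : realType) (a b c : R) : a <= b ->
  rint a b (fun=> c) = c * (b - a).
Proof.
move=> ab; rewrite Rintegral_cst//; congr (_ * _).
rewrite /= lebesgue_measure_itv /= lte_fin.
by case: ltP => //= ba; apply/eqP; rewrite eq_sym subr_eq0 eq_le ab ba.
Qed.

Lemma rint_norm (R : realType) (f : R -> R) (a b : R) : tame f ->
  `|rint a b f| <= rint a b (fun x => `|f x|).
Proof. by move=> tf; apply: le_normr_Rintegral => //; exact: tame_integrable. Qed.

Lemma rint_dist_le (R : realType) (f g h : R -> R) (a b : R) :
  tame f -> tame g -> tame h ->
  (forall x, a <= x <= b -> `|f x - g x| <= h x) ->
  `|rint a b f - rint a b g| <= rint a b h.
Proof.
move=> tf tg th fgh; rewrite -rintB//.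
apply: le_trans (rint_norm _ _ (tameB tf tg)) _; apply: le_rint => //.
exact/tame_norm/tameB.
Qed.

Lemma rint_split (R : realType) (f : R -> R) (a b c : R) : tame f ->
  a <= b -> b <= c -> rint a c f = rint a b f + rint b c f.
Proof.
move=> tf ab bc.
have := @Rintegral_itvB R f (BLeft a) (BRight c) b (tame_integrable a c tf).
rewrite !bnd_simp => /(_ ab bc).
rewrite Rintegral_itv_obnd_cbnd; first by move=> <-; rewrite addrC subrK.
apply: integrableS (tame_integrable b c tf) => //.
by apply: subset_itvr; rewrite bnd_simp.
Qed.

Lemma rint_bound (R : realType) (f : R -> R) (a b c : R) : a <= b -> tame f ->
  (forall x, a <= x <= b -> `|f x| <= c) -> `|rint a b f| <= c * (b - a).
Proof.
move=> ab tf fc; apply: le_trans (rint_norm _ _ tf) _; rewrite -rint_cst//.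
apply: le_rint => //; [exact: tame_norm|exact: tame_cst].
Qed.

Lemma rint_ge0 (R : realType) (f : R -> R) (a b : R) :
  (forall x, a <= x <= b -> 0 <= f x) -> 0 <= rint a b f.
Proof. by move=> f0; apply: Rintegral_ge0 => x; rewrite /= in_itv /=; exact: f0. Qed.

Lemma rint_derive1 (R : realType) (f : R -> R) (a b : R) : a < b ->
  (forall x, derivable f x 1) -> continuous (derive1 f) ->
  rint a b (derive1 f) = f b - f a.
Proof.
move=> ab df cdf; have cf : continuous f by exact: derivable_continuous.
have cw : {within `[a, b], continuous (derive1 f)} by exact: continuous_subspaceT.
have cLR : derivable_oo_LRcontinuous f a b.
  split; first by move=> x _; exact: df.
    exact: (cvg_at_right_filter (cf a)).
  exact: (cvg_at_left_filter (cf b)).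
by rewrite /Rintegral (continuous_FTC2 ab cw cLR (fun x _ => erefl)).
Qed.

(** * Smooth steps against integrals *)

Lemma tame_smooth (R : realType) (f : R -> R) : smooth1 f -> tame f.
Proof. by move=> sf; apply: tame_continuous; exact: (sf 0%N). Qed.

Lemma tame_derive_smooth (R : realType) (f : R -> R) :
  smooth1 f -> tame (derive1 f).
Proof. by move=> sf; apply: tame_continuous; case: (sf 1%N). Qed.

Lemma tame_step (R : realType) (p q : R) : tame (smooth_step p q).
Proof. exact/tame_smooth/smooth_smooth_step. Qed.

Lemma tame_step_derive (R : realType) (p q : R) : tame (derive1 (smooth_step p q)).
Proof. exact/tame_derive_smooth/smooth_smooth_step. Qed.

Lemma rint_step_derive (R : realType) (p q len : R) : 0 <= p -> p < q -> q <= len ->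
  rint 0 len (derive1 (smooth_step p q)) = 1.
Proof.
move=> p0 pq ql; have [ds cs] := smooth_smooth_step p q 1.
rewrite rint_derive1//; last by lra.
by rewrite smooth_step_ge// smooth_step_le// subr0.
Qed.

(** The derivative of the step is a probability density carried by [[p, q]]. *)
Lemma step_evaluation (R : realType) (G : R -> R) (p q len xs D : R) :
  0 <= p -> p < q -> q <= len -> tame G ->
  (forall y, p <= y <= q -> `|G y - G xs| <= D) ->
  `|rint 0 len (fun y => derive1 (smooth_step p q) y * G y) - G xs| <= D.
Proof.
move=> p0 pq ql tG GD.
have one := rint_step_derive p0 pq ql; have ts := tame_step_derive p q.
have -> : G xs = rint 0 len (fun y => G xs * derive1 (smooth_step p q) y).
  by rewrite rintZ// one mulr1.
rewrite -[leRHS]mulr1 -one -rintZ//; apply: rint_dist_le.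
- exact: tameM.
- by apply: tameM => //; exact: tame_cst.
- by apply: tameM => //; exact: tame_cst.
move=> y _; rewrite [X in _ - X]mulrC -mulrBr normrM.
rewrite (ger0_norm (smooth_step_derive_ge0 y pq)) [leLHS]mulrC.
have [yp|py] := ltP y p.
  by rewrite smooth_step_derive_out ?yp// !mulr0.
have [qy|yq] := ltP q y.
  by rewrite smooth_step_derive_out ?qy ?orbT// !mulr0.
apply: ler_wpM2r; first exact: smooth_step_derive_ge0.
by apply: GD; rewrite py.
Qed.

(** The step differs from the indicator of [[x, len]] only within [mu] of [x]. *)
Lemma step_tail (R : realType) (f : R -> R) (p q len x mu C : R) :
  0 <= p -> p < q -> q <= len -> 0 <= x <= len -> x - mu <= p -> q <= x + mu ->
  tame f -> (forall y, `|f y| <= C) ->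
  `|rint 0 len (fun y => smooth_step p q y * f y) - rint x len f| <= 2 * mu * C.
Proof.
move=> p0 pq ql /andP[x0 xl] xp qx tf fC.
have ts := tame_step p q.
have C0 : 0 <= C by apply: le_trans (fC 0).
pose m := Num.max 0 (x - mu); pose M := Num.min len (x + mu).
have m0 : 0 <= m by rewrite /m le_max lexx.
have mu0 : 0 <= mu by lra.
have mx : m <= x by rewrite /m ge_max x0; lra.
have mp : m <= p by rewrite /m ge_max p0.
have xM : x <= M by rewrite /M le_min xl; lra.
have Ml : M <= len by rewrite /M ge_min lexx.
have qM : q <= M by rewrite /M le_min ql.
have xm : x - m <= mu by have := le_max (x - mu) 0 (x - mu); rewrite lexx orbT -/m; lra.
have Mx : M - x <= mu.
  by have := ge_min (x + mu) len (x + mu); rewrite lexx orbT -/M; lra.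
have tsf : tame (fun y => smooth_step p q y * f y) by exact: tameM.
have Z1 : rint 0 m (fun y => smooth_step p q y * f y) = 0.
  rewrite -[RHS](mul0r (m - 0)) -rint_cst//; apply: eq_rint => y /andP[_ ym].
  by rewrite smooth_step_le ?mul0r//; lra.
have Z2 : rint M len (fun y => smooth_step p q y * f y - f y) = 0.
  rewrite -[RHS](mul0r (len - M)) -rint_cst//; apply: eq_rint => y /andP[My _].
  by rewrite smooth_step_ge ?mul1r ?subrr//; lra.
rewrite (rint_split tsf x0 xl) -addrA -rintB// (rint_split tsf m0 mx) Z1 add0r.
rewrite (rint_split (tameB tsf tf) xM Ml) Z2 addr0.
apply: le_trans (ler_normD _ _) _.
rewrite -mulrA mulr_natl mulr2n; apply: lerD.
  apply: le_trans (rint_bound mx tsf (c := C) _) _ => [y _|].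
    rewrite normrM -[leRHS]mul1r; apply: ler_pM => //.
    by have /andP[] := smooth_step_itv y pq; move=> ? ?; rewrite ger0_norm.
  by rewrite mulrC ler_wpM2r.
apply: le_trans (rint_bound xM (tameB tsf tf) (c := C) _) _ => [y _|].
  rewrite -{2}(mul1r (f y)) -mulrBl normrM -[leRHS]mul1r; apply: ler_pM => //.
  by have /andP[] := smooth_step_itv y pq => ? ?; rewrite ler_norml; apply/andP; split; lra.
by rewrite mulrC ler_wpM2r.
Qed.

(** * Evaluation at time and space nodes *)

(** What the balance law uses of a step in time.  The form covers the
    steps that rise in a window and the one for the initial time, at which the
    term [th 0 * G 0] takes over from the derivative. *)
Definition time_step (R : realType) (T : R) (H : R -> R) (om mu t ts : R)
    (th : R -> R) : Prop :=
  [/\ smooth1 th, forall s, 0 <= th s <= 1,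
      forall (G : R -> R) (C : R), 0 <= C ->
        (forall s s', s <= s' -> `|G s' - G s| <= C * H s' - C * H s) ->
        `|rint 0 T (fun s => derive1 th s * G s) + th 0 * G 0 - G ts| <= C * om &
      forall (f : R -> R) (C : R), tame f -> (forall s, `|f s| <= C) ->
        `|rint 0 T (fun s => th s * f s) - rint t T f| <= 2 * mu * C].

(** A node [x], the point [xs] that replaces it, and an interval [[p, q]] around
    [xs] in which a smooth step can rise; all of them lie within [mu] of [x], and
    [[p, q]] is interior, so that the step is constant near both ends. *)
Definition window (R : realType) (len mu x xs p q : R) : Prop :=
  [/\ 0 < p, p < q, q < len, p <= xs <= q &
      [/\ 0 <= x <= len, x - mu <= p & q <= x + mu]].

Lemma window_time_step (R : realType) (T : R) (H : R -> R) (om mu t ts p q : R) :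
  {homo H : x y / x <= y} -> window T mu t ts p q -> H q - H p <= om ->
  time_step T H om mu t ts (smooth_step p q).
Proof.
move=> Hm [p0 pq qT pts [tT tp qt]] Hom; split.
- exact: smooth_smooth_step.
- by move=> s; exact: smooth_step_itv.
- move=> G C C0 GH; rewrite (smooth_step_le pq (ltW p0)) mul0r addr0.
  apply: step_evaluation => //; try exact: ltW.
    exact: (tame_dominated (H := fun s => C * H s)).
  have key s s' : p <= s <= q -> p <= s' <= q -> s <= s' -> `|G s' - G s| <= C * om.
    move=> /andP[ps sq] /andP[ps' sq'] ss'; apply: le_trans (GH _ _ ss') _.
    rewrite -mulrBr; apply: ler_wpM2l => //.
    by have := Hm _ _ ps; have := Hm _ _ sq'; lra.
  move=> y py; have [yt|/ltW ty] := lerP ts y; first exact: key.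
  by rewrite distrC; exact: key.
- by move=> f C tf fC; apply: step_tail => //; exact: ltW.
Qed.

(** A step that has risen before time 0 contributes nothing through its
    derivative, and the initial term of the weak formulation is the exact value at
    time 0. *)
Lemma initial_time_step (R : realType) (T : R) (H : R -> R) (om mu : R) :
  0 < T -> 0 <= om -> 0 <= mu ->
  time_step T H om mu 0 0 (smooth_step (- 2) (- 1)).
Proof.
move=> T0 om0 mu0; have pq : (- 2 : R) < - 1 by lra.
split.
- exact: smooth_smooth_step.
- by move=> s; exact: smooth_step_itv.
- move=> G C C0 GH; rewrite (smooth_step_ge pq) ?mul1r; last by lra.
  rewrite (@eq_rint _ _ (fun=> 0)) ?rint_cst ?(ltW T0)//; last first.
    by move=> s /andP[s0 _]; rewrite smooth_step_derive_out ?mul0r//; apply/orP; lra.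
  by rewrite mul0r add0r subrr normr0 mulr_ge0.
- move=> f C tf fC.
  have -> : rint 0 T (fun s => smooth_step (- 2) (- 1) s * f s) = rint 0 T f.
    by apply: eq_rint => s /andP[s0 _]; rewrite smooth_step_ge ?mul1r//; lra.
  by rewrite subrr normr0 !mulr_ge0// (le_trans _ (fC 0)).
Qed.

(** * The balance law on a box, from one test function *)

(** The field is kept together with functions that are monotone in one variable and
    dominate its increments: compositions, slices and line integrals
    of [U] inherit such bounds, which do for them what traces and total
    variation measures would do. *)
Definition bv_field (R : realType) (U V1 V2 : R -> R -> R) : Prop :=
  [/\ forall x t t', t <= t' -> `|U t' x - U t x| <= V1 t' x - V1 t x,
      forall t x x', x <= x' -> `|U t x' - U t x| <= V2 t x' - V2 t x,
      forall t, tame (V1 t) & forall x, tame (V2^~ x)].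

Definition lip_bounded (R : realType) (C : R) (A : R -> R) : Prop :=
  (forall v w, `|A v - A w| <= C * `|v - w|) /\ (forall v, `|A v| <= C).

Lemma lip_bounded_ge0 (R : realType) (C : R) (A : R -> R) :
  lip_bounded C A -> 0 <= C.
Proof. by move=> [_ hA]; apply: le_trans (hA 0). Qed.

Lemma tame_field_x (R : realType) (U V1 V2 : R -> R -> R) (A : R -> R) (C t : R) :
  bv_field U V1 V2 -> lip_bounded C A -> tame (fun x => A (U t x)).
Proof.
move=> [_ Ux _ _] hA; apply: (@tame_dominated _ (fun x => C * V2 t x)) => x y xy.
rewrite -mulrBr; apply: le_trans (hA.1 _ _) _.
by apply: ler_wpM2l; [exact: lip_bounded_ge0 hA|exact: Ux].
Qed.

Lemma tame_field_t (R : realType) (U V1 V2 : R -> R -> R) (A : R -> R) (C x : R) :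
  bv_field U V1 V2 -> lip_bounded C A -> tame (fun t => A (U t x)).
Proof.
move=> [Ut _ _ _] hA; apply: (@tame_dominated _ (fun t => C * V1 t x)) => s t st.
rewrite -mulrBr; apply: le_trans (hA.1 _ _) _.
by apply: ler_wpM2l; [exact: lip_bounded_ge0 hA|exact: Ut].
Qed.

(** Integrals of [U] over space slices again have increments dominated by a
    monotone function of time; this is why slices are tame in [t]. *)
Lemma slice_dominated (R : realType) (U V1 V2 : R -> R -> R) (A b : R -> R)
    (C N L s t : R) :
  bv_field U V1 V2 -> lip_bounded C A -> tame b ->
  (forall x, 0 <= x <= L -> `|b x| <= N) -> 0 <= L -> s <= t ->
  `|rint 0 L (fun x => A (U t x) * b x) - rint 0 L (fun x => A (U s x) * b x)|
  <= (N * C) * rint 0 L (V1 t) - (N * C) * rint 0 L (V1 s).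
Proof.
move=> bvU hA tb bN L0 st; have [Ut _ tV1 _] := bvU.
have C0 := lip_bounded_ge0 hA.
have -> : (N * C) * rint 0 L (V1 t) - (N * C) * rint 0 L (V1 s) =
    rint 0 L (fun x => (N * C) * (V1 t x - V1 s x)).
  by rewrite rintZ ?rintB ?mulrBr//; exact: tameB.
apply: rint_dist_le.
- by apply: tameM => //; exact: tame_field_x bvU hA.
- by apply: tameM => //; exact: tame_field_x bvU hA.
- apply: tameM; first exact: tame_cst.
  exact: tameB.
move=> x xL; rewrite -mulrBl normrM mulrC -[leRHS]mulrA; apply: ler_pM => //.
  exact: bN.
apply: le_trans (hA.1 _ _) _; apply: ler_wpM2l => //; exact: Ut.
Qed.

Lemma tame_bounded (R : realType) (f : R -> R) (a b : R) : tame f ->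
  exists2 N, 0 <= N & forall x, a <= x <= b -> `|f x| <= N.
Proof.
move=> [_ /(_ a b) [M HM]]; exists `|M| => // x xab.
exact: le_trans (HM _ xab) (ler_norm _).
Qed.

Lemma tame_slice (R : realType) (U V1 V2 : R -> R -> R) (A b : R -> R) (C L : R) :
  bv_field U V1 V2 -> lip_bounded C A -> tame b -> 0 <= L ->
  tame (fun t => rint 0 L (fun x => A (U t x) * b x)).
Proof.
move=> bvU hA tb L0; have [N N0 bN] := tame_bounded 0 L tb.
apply: (@tame_dominated _ (fun t => (N * C) * rint 0 L (V1 t))) => s t st.
exact: (slice_dominated bvU hA tb bN L0 st).
Qed.

Lemma ler_distB_add (R : realDomainType) (x x' y y' d d' : R) :
  `|x - y| <= d -> `|x' - y'| <= d' -> `|(x - x') - (y - y')| <= d + d'.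
Proof.
move=> h h'; rewrite (_ : x - x' - (y - y') = (x - y) - (x' - y')); last by ring.
apply: le_trans (ler_normB _ _) _; exact: lerD.
Qed.

Lemma subr_common (R : comNzRingType) (w x y x' y' : R) :
  (w + x - y) - (w + x' - y') = (x - y) - (x' - y').
Proof. by ring. Qed.

Lemma ler_dist_addl (R : realDomainType) (x y d : R) : `|x - y| <= d -> x <= y + d.
Proof. by move=> h; rewrite -lerBlDl; exact: le_trans (ler_norm _) h. Qed.

(** The bound is uniform in the position inside of the window, hence can be
    integrated in time afterwards: evaluation in [x] is done for each time
    separately, and only [V2] is integrated. *)
Lemma space_evaluation (R : realType) (U V1 V2 : R -> R -> R) (B : R -> R)
    (C L s p q xs : R) :
  bv_field U V1 V2 -> lip_bounded C B -> 0 < p -> p < q -> q < L ->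
  p <= xs <= q ->
  `|rint 0 L (fun x => derive1 (smooth_step p q) x * B (U s x)) - B (U s xs)|
  <= C * (V2 s q - V2 s p).
Proof.
move=> bvU hB p0 pq qL /andP[pxs xsq]; have [_ Ux _ _] := bvU.
apply: step_evaluation; [exact: ltW|by []|exact: ltW|exact: tame_field_x bvU hB|].
have mono x y : x <= y -> V2 s x <= V2 s y.
  by move=> /(Ux s) h; rewrite -subr_ge0; exact: le_trans h.
have key x y : p <= x -> y <= q -> x <= y ->
    `|B (U s y) - B (U s x)| <= C * (V2 s q - V2 s p).
  move=> px yq xy; apply: le_trans (hB.1 _ _) _.
  apply: ler_wpM2l; first exact: lip_bounded_ge0 hB.
  by apply: le_trans (Ux _ _ _ xy) _; apply: lerB; exact: mono.
move=> y /andP[py yq]; have [xy|/ltW yx] := lerP xs y; first exact: key.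
by rewrite distrC; exact: key.
Qed.

Lemma balance_arith (R : realFieldType) (om mu C SG Sk Sa KG Gs Gs' Js Js' X : R) :
  SG <= Gs - Gs' + (2 * C * om + 2 * C * om) ->
  Sk <= KG + (C * om + C * om) ->
  KG <= X + (2 * mu * (2 * C) + 2 * mu * (2 * C)) ->
  `|Gs - Js| <= 2 * mu * C + 2 * mu * C -> `|Gs' - Js'| <= 2 * mu * C + 2 * mu * C ->
  Sa = SG + Sk -> 0 <= Sa ->
  Js' - Js - X <= 6 * C * om + 16 * C * mu.
Proof.
rewrite !ler_norml => h1 h2 h3 /andP[h4 h5] /andP[h6 h7] -> h8; lra.
Qed.

(** The test function is [a(t) b(x)].  Its time derivative is concentrated near
    [ts] and [ts'], and evaluates the slices [G]; its space derivative is
    concentrated near [xsi] and [xsj], and evaluates the flux.  What remains are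
    integrals against steps, which are close to integrals over intervals.  The
    constant [c] allows both functions that vanish near the ends of
    [[0, L]] and functions that do not. *)
Lemma balance_inequality (R : realType) (T L : R) (A B : R -> R) (C om mu : R)
    (U V1 V2 : R -> R -> R) (t ts t' ts' : R) (th th' : R -> R)
    (c xi xsi pi qi xj xsj pj qj : R) :
  0 < T -> 0 < L -> bv_field U V1 V2 ->
  lip_bounded C A -> lip_bounded C B -> 0 <= c <= 1 ->
  time_step T (fun s => rint 0 L (V1 s)) om mu t ts th ->
  time_step T (fun s => rint 0 L (V1 s)) om mu t' ts' th' ->
  window L mu xi xsi pi qi ->
  rint 0 T (fun s => V2 s qi) - rint 0 T (fun s => V2 s pi) <= om ->
  window L mu xj xsj pj qj ->
  rint 0 T (fun s => V2 s qj) - rint 0 T (fun s => V2 s pj) <= om ->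
  let a s := th s - th' s in
  let b x := c + smooth_step pi qi x - smooth_step pj qj x in
  let J s := c * rint 0 L (fun x => A (U s x)) +
    rint xi L (fun x => A (U s x)) - rint xj L (fun x => A (U s x)) in
  let k s := B (U s xsi) - B (U s xsj) in
  0 <= rint 0 T (fun s => rint 0 L (fun x =>
         A (U s x) * (derive1 a s * b x) + B (U s x) * (a s * derive1 b x)))
       + rint 0 L (fun x => A (U 0 x) * (a 0 * b x)) ->
  J ts' - J ts - (rint t T k - rint t' T k) <= 6 * C * om + 16 * C * mu.
Proof.
move=> T0 L0 bvU hA hB /andP[c0 c1] [sth th01 thE thI] [sth' th01' thE' thI'].
move=> wi Hi wj Hj a b J k.
have [Ut Ux tV1 tV2] := bvU; have C0 := lip_bounded_ge0 hA.
have [pi0 piqi qiL xsiW [xiL xipi qixi]] := wi.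
have [pj0 pjqj qjL xsjW [xjL xjpj qjxj]] := wj.
pose chi := smooth_step pi qi; pose chj := smooth_step pj qj.
have tchi : tame chi := tame_step pi qi.
have tchj : tame chj := tame_step pj qj.
have tchi' : tame (derive1 chi) := tame_step_derive pi qi.
have tchj' : tame (derive1 chj) := tame_step_derive pj qj.
have tb : tame b by apply: tameB => //; apply: tameD => //; exact: tame_cst.
have dth s : derivable th s 1 by case: (sth 1%N).
have dth' s : derivable th' s 1 by case: (sth' 1%N).
have dchi x : derivable chi x 1 by case: (smooth_smooth_step pi qi 1).
have dchj x : derivable chj x 1 by case: (smooth_smooth_step pj qj 1).
have aE s : derive1 a s = derive1 th s - derive1 th' s.
  by rewrite !derive1E deriveB.
have bE x : derive1 b x = derive1 chi x - derive1 chj x.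
  rewrite !derive1E deriveB//; last exact: derivableD.
  by rewrite deriveD// derive_cst add0r.
have tth : tame th := tame_smooth sth.
have tth' : tame th' := tame_smooth sth'.
have tdth : tame (derive1 th) := tame_derive_smooth sth.
have tdth' : tame (derive1 th') := tame_derive_smooth sth'.
have ta : tame a by exact: tameB.
have ta' : tame (derive1 a) by rewrite (funext aE); exact: tameB.
have tb' : tame (derive1 b) by rewrite (funext bE); exact: tameB.
pose G s := rint 0 L (fun x => A (U s x) * b x).
pose K s := rint 0 L (fun x => B (U s x) * derive1 b x).
have tG : tame G := tame_slice bvU hA tb (ltW L0).
have tK : tame K := tame_slice bvU hB tb' (ltW L0).
have tAx s : tame (fun x => A (U s x)) := tame_field_x s bvU hA.
have tBx s : tame (fun x => B (U s x)) := tame_field_x s bvU hB.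
have b2 x : 0 <= x <= L -> `|b x| <= 2.
  move=> _; have := smooth_step_itv x piqi; have := smooth_step_itv x pjqj.
  rewrite /b; move: (smooth_step pi qi x) (smooth_step pj qj x) c0 c1.
  clear => y z c0 c1 /andP[? ?] /andP[? ?].
  by rewrite ler_norml; apply/andP; split; lra.
have Gdom s s' (ss' : s <= s') := slice_dominated bvU hA tb b2 (ltW L0) ss'.
have C20 : 0 <= 2 * C by rewrite mulr_ge0.
have S1 : rint 0 T (fun s => derive1 a s * G s) + a 0 * G 0
    <= G ts - G ts' + (2 * C * om + 2 * C * om).
  have := ler_distB_add (thE _ _ C20 Gdom) (thE' _ _ C20 Gdom).
  move/ler_dist_addl; apply: le_trans; rewrite le_eqVlt; apply/orP; left; apply/eqP.
  rewrite opprD addrACA -mulrBl; congr (_ + _).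
  rewrite -rintB; [|exact: tameM|exact: tameM].
  by apply: eq_rint => s _; rewrite aE mulrBl.
(* The error of the evaluation in [x] at time [s]; its integral over time is what
   the windows make small. *)
pose D s := C * (V2 s qi - V2 s pi) + C * (V2 s qj - V2 s pj).
have tD : tame D.
  by apply: tameD; apply: tameM; try exact: tame_cst; exact: tameB.
have tk : tame k by apply: tameB; exact: tame_field_t bvU hB.
have KD s : `|K s - k s| <= D s.
  have -> : K s = rint 0 L (fun x => derive1 chi x * B (U s x))
                - rint 0 L (fun x => derive1 chj x * B (U s x)).
    rewrite -rintB; [|exact: tameM|exact: tameM].
    by apply: eq_rint => x _; rewrite bE mulrC mulrBl.
  apply: ler_distB_add.
    exact: (space_evaluation s bvU hB pi0 piqi qiL xsiW).
  exact: (space_evaluation s bvU hB pj0 pjqj qjL xsjW).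
have a1 s : `|a s| <= 1.
  have := th01 s; have := th01' s; rewrite /a; move: (th s) (th' s).
  clear => y z /andP[? ?] /andP[? ?].
  by rewrite ler_norml; apply/andP; split; lra.
have S2 : rint 0 T (fun s => a s * K s) <=
    rint 0 T (fun s => a s * k s) + (C * om + C * om).
  apply: ler_dist_addl; apply: (@le_trans _ _ (rint 0 T D)).
    apply: rint_dist_le; [exact: tameM|exact: tameM|exact: tD|move=> s _].
    by rewrite -mulrBr normrM -[leRHS]mul1r; exact: ler_pM.
  have tE p q : tame (fun s => V2 s q - V2 s p) by exact: tameB.
  have tE' p q : tame (fun s => C * (V2 s q - V2 s p)).
    by apply: tameM => //; exact: tame_cst.
  by rewrite /D rintD// !rintZ// !rintB//; apply: lerD; exact: ler_wpM2l.
have k2 s : `|k s| <= 2 * C.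
  rewrite mulr_natl mulr2n; apply: le_trans (ler_normB _ _) _.
  by apply: lerD; exact: hB.2.
have S3 : rint 0 T (fun s => a s * k s) <=
    rint t T k - rint t' T k + (2 * mu * (2 * C) + 2 * mu * (2 * C)).
  have -> : rint 0 T (fun s => a s * k s) =
      rint 0 T (fun s => th s * k s) - rint 0 T (fun s => th' s * k s).
    rewrite -rintB; [|exact: tameM|exact: tameM].
    by apply: eq_rint => s _; rewrite /a mulrBl.
  exact: ler_dist_addl (ler_distB_add (thI _ _ tk k2) (thI' _ _ tk k2)).
have S4 s : `|G s - J s| <= 2 * mu * C + 2 * mu * C.
  have ev x p q : 0 < p -> p < q -> q < L -> 0 <= x <= L -> x - mu <= p -> q <= x + mu ->
      `|rint 0 L (fun y => smooth_step p q y * A (U s y)) - rint x L (fun y => A (U s y))|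
      <= 2 * mu * C.
    move=> p0 pq qL xL xp qx.
    by apply: (step_tail (ltW p0) pq (ltW qL)) => // y; exact: hA.2.
  have -> : G s = c * rint 0 L (fun x => A (U s x))
      + rint 0 L (fun x => chi x * A (U s x)) - rint 0 L (fun x => chj x * A (U s x)).
    have tcA : tame (fun x => c * A (U s x)) by apply: tameM => //; exact: tame_cst.
    rewrite -rintZ// -rintD//; last exact: tameM.
    rewrite -rintB; [|by apply: tameD => //; exact: tameM|exact: tameM].
    by apply: eq_rint => x _; rewrite /b mulrC mulrBl mulrDl.
  by rewrite /J subr_common; apply: ler_distB_add; exact: ev.
have Sa : rint 0 T (fun s => rint 0 L (fun x =>
         A (U s x) * (derive1 a s * b x) + B (U s x) * (a s * derive1 b x)))
    + rint 0 L (fun x => A (U 0 x) * (a 0 * b x)) =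
    rint 0 T (fun s => derive1 a s * G s) + a 0 * G 0 + rint 0 T (fun s => a s * K s).
  rewrite addrAC -rintD; [|exact: tameM|exact: tameM].
  congr (_ + _).
    apply: eq_rint => s _; rewrite /G /K -!rintZ; [|exact: tameM|exact: tameM].
    rewrite -rintD; [|by apply: tameM; [exact: tame_cst|exact: tameM]..].
    by apply: eq_rint => x _; rewrite !(mulrCA (derive1 a s)) !(mulrCA (a s)).
  rewrite /G -rintZ; last exact: tameM.
  by apply: eq_rint => x _; rewrite (mulrCA (a 0)).
exact: (balance_arith S1 S2 S3 (S4 ts) (S4 ts') Sa).
Qed.

(** * Sums of monotone functions along a line *)

(** The sign by which a component becomes nondecreasing. *)
Definition sgb (R : realType) (b : bool) (y : R) : R := (-1) ^+ b * y.

Lemma sgb_norm (R : realType) (b : bool) (x y : R) :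
  `|sgb b x - sgb b y| = `|x - y|.
Proof. by rewrite /sgb -mulrBr normrM normr_sign mul1r. Qed.

Lemma sgbK (R : realType) (b : bool) : involutive (@sgb R b).
Proof. by move=> y; rewrite /sgb mulrA -expr2 sqrr_sign mul1r. Qed.

Lemma tame_signed (R : realType) (b : bool) (g : R -> R) :
  {homo (fun y => sgb b (g y)) : x y / x <= y} -> tame g.
Proof.
move=> gm; rewrite (_ : g = fun y => (-1) ^+ b * sgb b (g y)).
  by apply: tameM; [exact: tame_cst|exact: tame_nondecreasing].
by apply/funext => y; rewrite -/(sgb b _) sgbK.
Qed.

(** Two functions that are monotone in the same direction, and that are close at
    the ends of an interval up to a displacement of the ends by [r], are close
    inside up to the increment over a slightly longer interval. *)
Lemma signed_sandwich (R : realType) (b : bool) (e g : R -> R)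
    (y0 y1 z0 z1 y r del : R) :
  {homo (fun y => sgb b (e y)) : x y / x <= y} ->
  {homo (fun y => sgb b (g y)) : x y / x <= y} ->
  y0 <= y <= y1 -> 0 <= r -> y - r <= z0 -> z1 <= y + r ->
  `|e y0 - g z0| <= del -> `|e y1 - g z1| <= del ->
  `|e y - g y| <= del + (sgb b (g (y + r)) - sgb b (g (y - r))).
Proof.
move=> em gm /andP[y0y yy1] r0 rz0 z1r h0 h1.
move: (em _ _ y0y) (em _ _ yy1) (gm _ _ rz0) (gm _ _ z1r) h0 h1.
have yr : y <= y + r by rewrite lerDl.
have ry : y - r <= y by rewrite gerBl.
move: (gm _ _ yr) (gm _ _ ry); rewrite -(sgb_norm b (e y)) -(sgb_norm b (e y0)) -(sgb_norm b (e y1)).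
move: (sgb b (e y)) (sgb b (g y)) (sgb b (e y0)) (sgb b (e y1)) (sgb b (g z0)) (sgb b (g z1)) (sgb b (g (y + r))) (sgb b (g (y - r))).
clear => a1 a2 a3 a4 a5 a6 a7 a8 ? ? ? ? ? ?.
by rewrite !ler_norml => /andP[? ?] /andP[? ?]; apply/andP; split; lra.
Qed.

Lemma cell_exists (R : realType) (m : nat) (d y : R) :
  (0 < m)%N -> 0 <= y <= m%:R * d ->
  exists2 i : nat, (i < m)%N & i%:R * d <= y <= i.+1%:R * d.
Proof.
elim: m => [//|[|m] IH] _ /andP[y0 ym].
  by exists 0%N => //; rewrite mul0r y0.
have [h|/ltW h] := lerP y (m.+1%:R * d).
  have [//|i im hi] := IH isT _; first by rewrite y0.
  by exists i => //; exact: leq_trans im _.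
by exists m.+1 => //; rewrite h.
Qed.

(** Cut [[0, len]] into intervals of length [r]: on each of them the
    increment is at most that of [V] over three consecutive intervals, and the sum
    of these telescopes. *)
Lemma cells_integral_le (R : realType) (V e : R -> R) (len D r : R) (n : nat) :
  {homo V : x y / x <= y} -> tame e -> 0 < r -> n%:R * r = len ->
  (forall y, 0 <= y <= len -> e y <= D + (V (y + r) - V (y - r))) ->
  rint 0 len e <= len * D + 3 * r * (V (len + r) - V (- r)).
Proof.
move=> Vm te r0 nr he.
(* The six values of [V] are what is left of the sum over the first [m] intervals
   of the increments from the left neighbour to the right one. *)
have H m : (m <= n)%N -> rint 0 (m%:R * r) e <= m%:R * r * D +
    r * (V (m.+1%:R * r) + V (m%:R * r) + V (m%:R * r - r) - V r - V 0 - V (- r)).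
  elim: m => [|m IH] mn.
    rewrite mul0r mul1r add0r.
    rewrite (@eq_rint _ _ (fun=> e 0)); last first.
      by move=> x; rewrite -eq_le => /eqP <-.
    rewrite rint_cst// subr0 mulr0 mul0r add0r.
    by rewrite [V r + _ + _]addrC addrA [V (- r) + _]addrC; nra.
  have m0 : 0 <= m%:R * r by rewrite mulr_ge0// ltW.
  have mS : m%:R * r <= m.+1%:R * r by rewrite ler_pM2r// ler_nat.
  rewrite (rint_split te m0 mS); have {}IH := IH (ltnW mn).
  have E : m.+1%:R * r = m%:R * r + r by rewrite -natr1 mulrDl mul1r.
  have E2 : m.+2%:R * r = m%:R * r + r + r by rewrite -natr1 mulrDl mul1r E.
  have bnd : rint (m%:R * r) (m.+1%:R * r) e <=
      (D + (V (m.+2%:R * r) - V (m%:R * r - r))) * r.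
    have -> : (D + (V (m.+2%:R * r) - V (m%:R * r - r))) * r =
      rint (m%:R * r) (m.+1%:R * r) (fun=> D + (V (m.+2%:R * r) - V (m%:R * r - r))).
      by rewrite rint_cst// E [_ + r]addrC addrK.
    apply: le_rint => //; first exact: tame_cst.
    move=> y /andP[my yS]; apply: (le_trans (he _ _)).
      rewrite (le_trans m0 my) -nr (le_trans yS)// ler_pM2r// ler_nat//.
    rewrite lerD2l; apply: lerB; apply: Vm.
      by rewrite E2 lerD2r -E.
    by rewrite lerD2r.
  apply: (le_trans (lerD IH bnd)); rewrite E2 E addrK.
  clear; move: (V (m%:R * r + r + r)) (V (m%:R * r + r)) (V (m%:R * r)) (V (m%:R * r - r)) (V r) (V 0) (V (-r)) => a1 a2 a3 a4 a5 a6 a7.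
  by rewrite le_eqVlt; apply/orP; left; apply/eqP; ring.
rewrite -{1}nr; apply: (le_trans (H n (leqnn n))).
rewrite -natr1 mulrDl mul1r nr lerD2l -mulrA mulrCA ler_pM2l//.
have len0 : 0 <= len by rewrite -nr mulr_ge0// ltW.
have h1 : V len <= V (len + r) by apply: Vm; rewrite lerDl ltW.
have h2 : V (len - r) <= V (len + r).
  by apply: Vm; apply: lerD => //; rewrite ge0_cp// ltW.
have h3 : V (- r) <= V 0 by apply: Vm; rewrite oppr_le0 ltW.
have h4 : V (- r) <= V r by apply: Vm; rewrite ge0_cp// ltW.
move: h1 h2 h3 h4.
move: (V len) (V (len + r)) (V (len - r)) (V (- r)) (V r) (V 0).
by clear => a1 a2 a3 a4 a5 a6 *; lra.
Qed.

(** The parameter is chosen such that 0 gives the identity and that, for fixed [y],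
    the value moves monotonically towards [c]. *)
Definition contract (R : realType) (c kap y : R) : R := c + (1 - kap) * (y - c).

Lemma contract_nondecreasing (R : realType) (c kap : R) : kap <= 1 ->
  {homo contract c kap : x y / x <= y}.
Proof.
move=> k1 x y xy; rewrite lerD2l ler_wpM2l ?subr_ge0//; by rewrite lerD2r.
Qed.

Lemma contract_dist (R : realType) (c kap y len : R) :
  0 <= kap -> 0 <= c <= len -> 0 <= y <= len ->
  `|contract c kap y - y| <= kap * len.
Proof.
move=> k0 /andP[c0 cl] /andP[y0 yl].
rewrite (_ : contract c kap y - y = kap * (c - y)); last by rewrite /contract; ring.
rewrite normrM (ger0_norm k0); apply: ler_wpM2l => //.
by rewrite ler_norml; apply/andP; split; lra.
Qed.

Lemma contract_itv (R : realType) (c kap y len : R) :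
  0 <= kap <= 1 -> 0 <= c <= len -> 0 <= y <= len -> 0 <= contract c kap y <= len.
Proof.
move=> /andP[k0 k1] /andP[c0 cl] /andP[y0 yl].
rewrite (_ : contract c kap y = kap * c + (1 - kap) * y); last by rewrite /contract; ring.
have h1 := mulr_ge0 k0 c0; have h3 := ler_wpM2l k0 cl.
have k1' : 0 <= 1 - kap by rewrite subr_ge0.
have h2 := mulr_ge0 k1' y0; have h4 := ler_wpM2l k1' yl.
by rewrite addr_ge0//=; lra.
Qed.

(** The components are compared with those of the contracted function at the nodes
    [k * d]; the contraction moves a point by at most [kap * len], whence the
    condition on [r]. *)
Lemma line_close (R : realType) (I : finType) (b : I -> bool)
    (e g : I -> R -> R) (c kap d del r len : R) (m n : nat) :
  (forall i, {homo (fun y => sgb (b i) (e i y)) : x y / x <= y}) ->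
  (forall i, {homo (fun y => sgb (b i) (g i y)) : x y / x <= y}) ->
  0 <= kap -> 0 <= c <= len -> 0 < d -> (0 < m)%N -> m%:R * d = len ->
  0 < r -> n%:R * r = len -> d + kap * len <= r ->
  (forall k i, (k <= m)%N -> `|e i (k%:R * d) - g i (contract c kap (k%:R * d))| <= del) ->
  rint 0 len (fun y => `|\sum_i e i y - \sum_i g i y|) <=
    len * (#|I|%:R * del) + 3 * r * (\sum_i sgb (b i) (g i (len + r))
                                   - \sum_i sgb (b i) (g i (- r))).
Proof.
move=> em gm k0 clen d0 m0 md r0 nr dr H.
apply: (@cells_integral_le _ (fun y => \sum_i sgb (b i) (g i y)) _ _ _ _ n) => //.
- by move=> x y xy; apply: ler_sum => i _; exact: gm.
- apply: tame_norm; apply: tameB; apply: tame_sum => i.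
    exact: tame_signed (em i).
  exact: tame_signed (gm i).
move=> y /andP[y0 yl]; rewrite -sumrB; apply: le_trans (ler_norm_sum _ _ _) _.
have [k km /andP[ky yk]] : exists2 k : nat, (k < m)%N & k%:R * d <= y <= k.+1%:R * d.
  by apply: cell_exists => //; rewrite y0 md.
rewrite mulr_natl -[X in X + _]sumr_const -sumrB -big_split /=.
have kd (j : nat) : (j <= m)%N -> 0 <= j%:R * d <= len.
  by move=> jm; rewrite mulr_ge0 ?(ltW d0)//= -md ler_pM2r// ler_nat.
have kS : k.+1%:R * d = k%:R * d + d by rewrite -natr1 mulrDl mul1r.
have c1 := contract_dist k0 clen (kd k (ltnW km)).
have c2 := contract_dist k0 clen (kd k.+1 km).
apply: ler_sum => i _.
apply: (@signed_sandwich _ (b i) (e i) (g i) (k%:R * d) (k.+1%:R * d)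
  (contract c kap (k%:R * d)) (contract c kap (k.+1%:R * d))) => //.
- by rewrite ky.
- exact: ltW.
- move: c1 c2; rewrite ler_norml => /andP[? ?] _; lra.
- move: c2; rewrite ler_norml => /andP[? ?]; lra.
- by apply: H; exact: ltnW.
- exact: H.
Qed.

(** A nondecreasing function is within [om] of its infimum over the positive reals
    at all small positive arguments. *)
Lemma monotone_right_osc (R : realType) (f : R -> R) (om : R) :
  {homo f : x y / x <= y} -> 0 < om ->
  \forall kap \near 0^'+, f (2 * kap) - f kap <= om.
Proof.
move=> fm om0.
pose S := [set f k | k in `]0, +oo[%classic].
have Si : has_inf S.
  split; first by exists (f 1), 1 => //=; rewrite in_itv /= ltr01.
  by exists (f 0) => _ [k k0 <-]; move: k0; rewrite /= in_itv /= andbT => /ltW/fm.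
have [_ [k k0 <-] hk] := inf_adherent om0 Si.
move: k0; rewrite /= in_itv /= andbT => k0.
near=> kap.
have kap0 : 0 < kap by near: kap; exact: nbhs_right_gt.
have h1 : f (2 * kap) <= f k.
  apply: fm; rewrite -ler_pdivlMl// mulrC.
  by near: kap; apply: nbhs_right_le; rewrite divr_gt0.
have h2 : inf S <= f kap.
  by apply: ge_inf; [case: Si|exists kap => //=; rewrite in_itv /= kap0].
by move: hk h1 h2; lra.
Unshelve. all: by end_near.
Qed.

(** The window is bounded by the contractions of the node with parameters [kap] and
    [2 * kap]: as functions of the parameter, the values of [H] there are
    monotone, in one direction or the other according to the side of [c] on which
    the node lies. *)
Lemma contract_window (R : realType) (len c y om : R) (H : R -> R) :
  {homo H : x y / x <= y} -> 0 <= c <= len -> 0 <= y <= len -> y != c -> 0 < om ->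
  \forall kap \near 0^'+, exists p q,
    window len (2 * kap * len) y (contract c kap y) p q /\ H q - H p <= om.
Proof.
move=> Hm clen ylen yc om0; have [y0 yl] := andP ylen; have [c0 cl] := andP clen.
have W (kap p q : R) : 0 < kap -> kap < 2^-1 ->
    (p = contract c kap y /\ q = contract c (2 * kap) y \/
     q = contract c kap y /\ p = contract c (2 * kap) y) -> p < q -> 0 < p -> q < len ->
    window len (2 * kap * len) y (contract c kap y) p q.
  move=> k0 k12 pqE pq p0 ql.
  have k20 : 0 <= 2 * kap by lra.
  have := contract_dist (ltW k0) clen ylen; have := contract_dist k20 clen ylen.
  have : kap * len <= 2 * kap * len.
    by rewrite ler_wpM2r// ?(le_trans y0 yl)//; lra.
  rewrite !ler_norml => kl /andP[h1 h2] /andP[h3 h4].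
  have [hp hq hx] : [/\ y - 2 * kap * len <= p, q <= y + 2 * kap * len &
      p <= contract c kap y <= q].
    move: h1 h2 h3 h4 kl; clear -pq pqE.
    by case: pqE => -[<- <-] h1 h2 h3 h4 kl; split; rewrite ?lexx ?(ltW pq)//; lra.
  by split.
case/orP: (lt_total yc) => h.
  have fm : {homo (fun k => H (contract c k y)) : x y / x <= y}.
    move=> k k' kk; apply: Hm; rewrite /contract lerD2l.
    by apply: ler_wnM2r; lra.
  near=> kap.
  have kap0 : 0 < kap by near: kap; exact: nbhs_right_gt.
  have kap2 : kap < 2^-1 by near: kap; apply: nbhs_right_lt; rewrite invr_gt0.
  exists (contract c kap y), (contract c (2 * kap) y); split; last first.
    by near: kap; exact: (monotone_right_osc fm).
  have p1 : 0 < kap * (c - y) by apply: mulr_gt0 => //; lra.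
  have p2 : 0 < (1 - 2 * kap) * (c - y) by apply: mulr_gt0; lra.
  apply: W => //; first by left.
  - by rewrite /contract; move: p1; clear; nra.
  - by rewrite /contract; move: p1 y0; clear; nra.
  - by rewrite /contract; move: p2 cl; clear; nra.
have fm : {homo (fun k => - H (contract c k y)) : x y / x <= y}.
  move=> k k' kk; rewrite lerN2; apply: Hm; rewrite /contract lerD2l.
  by apply: ler_wpM2r; lra.
near=> kap.
have kap0 : 0 < kap by near: kap; exact: nbhs_right_gt.
have kap2 : kap < 2^-1 by near: kap; apply: nbhs_right_lt; rewrite invr_gt0.
exists (contract c (2 * kap) y), (contract c kap y); split; last first.
  rewrite addrC -[H _ in X in _ + X]opprK.
  by near: kap; exact: (monotone_right_osc fm).
have p1 : 0 < kap * (y - c) by apply: mulr_gt0 => //; lra.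
have p2 : 0 < (1 - 2 * kap) * (y - c) by apply: mulr_gt0; lra.
apply: W => //; first by right.
- by rewrite /contract; move: p1; clear; nra.
- by rewrite /contract; move: p2 c0; clear; nra.
- by rewrite /contract; move: p1 yl; clear; nra.
Unshelve. all: by end_near.
Qed.

(** * Lipschitz constants on bounded intervals *)

Definition lip_within (R : realType) (M C : R) (f : R -> R) : Prop :=
  forall x y, `|x| <= M -> `|y| <= M -> `|f x - f y| <= C * `|x - y|.

Lemma locally_lipschitz_near (R : realType) (f : R -> R) (a : R) :
  locally_lipschitz f -> exists r C : R, [/\ 0 < r, 0 < C &
    forall x y, `|x - a| < r -> `|y - a| < r -> `|f x - f y| <= C * `|x - y|].
Proof.
move=> /(_ a) [r r0 [M [_ HM]]]; exists r, (`|M| + 1); split => //.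
have MM : M < `|M| + 1 by apply: le_lt_trans (ler_norm M) _; rewrite ltrDl.
move=> x y xa ya; apply: (HM _ MM (x, y)).
by split; rewrite /ball /= distrC.
Qed.

Lemma locally_lipschitz_continuous (R : realType) (f : R -> R) :
  locally_lipschitz f -> continuous f.
Proof.
move=> lf a; have [r [C [r0 C0 H]]] := locally_lipschitz_near a lf.
apply/cvgrPdist_le => e e0; near=> x.
have xa : `|a - x| < r by near: x; exact: cvgr_dist_lt.
have xe : `|a - x| <= e / C by near: x; apply: cvgr_dist_le => //; exact: divr_gt0.
apply: le_trans (H _ _ _ _) _; rewrite ?subrr ?normr0// 1?distrC//.
by rewrite distrC mulrC -ler_pdivlMr.
Unshelve. all: by end_near.
Qed.

(** By compactness: near each point, pairs of nearby points are handled by the local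
    constant, and pairs of distant points by boundedness. *)
Lemma locally_lipschitz_within (R : realType) (f : R -> R) (M : R) :
  locally_lipschitz f -> exists2 C, 0 <= C & lip_within M C f.
Proof.
move=> lf; have cf := locally_lipschitz_continuous lf.
have [B B0 HB] := tame_bounded (- M) M (tame_continuous cf).
have K := @segment_compact R (- M) M.
have near_lip : \forall C \near +oo, `[(- M), M]%classic `<=`
    (fun x => forall y, `|y| <= M -> `|f x - f y| <= C * `|x - y|).
  move: K; rewrite compact_near_coveringP; apply => a _.
  have [r [C0 [r0 C00 H]]] := locally_lipschitz_near a lf.
  (* a bound of [f] near [a] and on the interval together *)
  pose B' := `|f a| + C0 * r + B.
  near=> x C => y yM.
  have xa : `|x - a| < r / 2.
    by rewrite distrC; near: x; apply: cvgr_dist_lt => //; exact: divr_gt0.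
  have CC : C0 <= C by near: C; apply: nbhs_pinfty_ge; exact: num_real.
  have CB : B' / (r / 2) <= C by near: C; apply: nbhs_pinfty_ge; exact: num_real.
  have xar : `|x - a| < r by apply: lt_trans xa _; rewrite ltr_pdivrMr// ltr_pMr// ltr1n.
  have [ya|ya] := ltP `|y - a| r.
    by apply: le_trans (H _ _ xar ya) _; rewrite ler_wpM2r.
  have xy : r / 2 <= `|x - y|.
    have := ler_distD x y a; rewrite [`|y - x|]distrC.
    by move: xa ya; clear; lra.
  apply: (@le_trans _ _ B'); last first.
    apply: (@le_trans _ _ (C * (r / 2))).
      by rewrite -ler_pdivrMr// divr_gt0.
    by apply: ler_wpM2l => //; exact: le_trans (ltW C00) CC.
  apply: le_trans (ler_normB _ _) _; apply: lerD; last first.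
    by apply: HB; rewrite -ler_norml.
  rewrite -[f x](subrK (f a)) addrC; apply: le_trans (ler_normD _ _) _.
  rewrite lerD2l; apply: le_trans (H _ _ xar _) _; first by rewrite subrr normr0.
  by apply: ler_wpM2l; exact: ltW.
have [C [C0 HC]] : exists C, 0 <= C /\ `[(- M), M]%classic `<=`
    (fun x => forall y, `|y| <= M -> `|f x - f y| <= C * `|x - y|).
  near (+oo : set_system R) => C; exists C; split.
    by near: C; apply: nbhs_pinfty_ge; exact: num_real.
  by near: C.
exists C => // x y xM yM; apply: HC => //.
by rewrite /= in_itv /= -ler_norml.
Unshelve. all: by end_near.
Qed.

Lemma C2_lipschitz_within (R : realType) (F : R -> R) (M : R) :
  C2 F -> exists2 C, 0 <= C & lip_within M C F.
Proof.
move=> [dF ddF _].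
have [C C0 HC] := tame_bounded (- M) M (tame_continuous (derivable_continuous ddF)).
have key x y : `|x| <= M -> `|y| <= M -> x < y -> `|F y - F x| <= C * `|y - x|.
  move=> xM yM xy.
  have cF : {within `[x, y], continuous F}.
    by apply: continuous_subspaceT; exact: derivable_continuous.
  have dF' (z : R) : z \in `]x, y[ -> is_derive z 1 F (derive1 F z).
    by move=> _; rewrite derive1E; exact: derivableP.
  have [z zxy ->] := MVT xy dF' cF.
  rewrite normrM; apply: ler_wpM2r => //; apply: HC.
  move: zxy xM yM; rewrite in_itv /= !ler_norml => /andP[xz zy] /andP[Mx _] /andP[_ yM].
  by rewrite (le_trans Mx (ltW xz)) (le_trans (ltW zy) yM).
exists C => // x y xM yM; have [xy|yx|->] := ltgtP x y.
- by rewrite distrC [`|x - y|]distrC; exact: key.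
- exact: key.
- by rewrite !subrr !normr0 mulr0.
Qed.

Definition clamp (R : realType) (M v : R) : R := Num.max (- M) (Num.min M v).

Lemma clamp_itv (R : realType) (M v : R) : 0 <= M -> `|clamp M v| <= M.
Proof.
by move=> M0; rewrite ler_norml /clamp le_max lexx /= ge_max ge_min lexx /= andbT; lra.
Qed.

Lemma clamp_id (R : realType) (M v : R) : `|v| <= M -> clamp M v = v.
Proof.
by rewrite ler_norml => /andP[h1 h2]; rewrite /clamp min_r// max_r.
Qed.

Lemma clamp_lip (R : realType) (M v w : R) : `|clamp M v - clamp M w| <= `|v - w|.
Proof.
wlog wv : v w / w <= v.
  move=> H; have [h|/ltW h] := leP w v; first exact: H.
  by rewrite distrC [leRHS]distrC; exact: H.
rewrite ger0_norm ?[leRHS]ger0_norm ?subr_ge0//; rewrite /clamp;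
  case: (leP M v) => h1; case: (leP M w) => h2; case: (leP (- M) M) => h3;
  case: (leP (- M) v) => h4; case: (leP (- M) w) => h5; move: wv h1 h2 h3 h4 h5;
  clear; lra.
Qed.

(** Truncating the argument makes a function globally Lipschitz and bounded while
    keeping it on the range of [u] and of the network. *)
Lemma lip_clamp (R : realType) (M C : R) (f : R -> R) :
  0 <= M -> 0 <= C -> lip_within M C f ->
  lip_bounded (C + (`|f 0| + C * M)) (f \o clamp M).
Proof.
move=> M0 C0 fl; have N0 : 0 <= `|f 0| + C * M by rewrite addr_ge0// mulr_ge0.
split=> [v w|v] /=.
  apply: le_trans (fl _ _ (clamp_itv v M0) (clamp_itv w M0)) _.
  by apply: ler_pM => //; [rewrite lerDl|exact: clamp_lip].
have := fl _ 0 (clamp_itv v M0); rewrite normr0 subr0 => /(_ M0) h.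
rewrite -[f (clamp M v)](subrK (f 0)); apply: le_trans (ler_normD _ _) _.
rewrite addrC; apply: (@le_trans _ _ (`|f 0| + C * M)); last by rewrite lerDr.
by rewrite lerD2l; apply: le_trans h _; apply: ler_wpM2l => //; exact: clamp_itv.
Qed.

Lemma lip_boundedW (R : realType) (C C' : R) (A : R -> R) :
  C <= C' -> lip_bounded C A -> lip_bounded C' A.
Proof.
move=> CC [h1 h2]; split=> [v w|v]; last exact: le_trans (h2 v) CC.
by apply: le_trans (h1 v w) _; exact: ler_wpM2r.
Qed.

Lemma lip_boundedN (R : realType) (C : R) (A : R -> R) :
  lip_bounded C A -> lip_bounded C (fun v => - A v).
Proof.
by move=> [h1 h2]; split=> [v w|v]; rewrite ?normrN// -opprD normrN.
Qed.

(** * Oscillations and good decompositions *)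

Lemma osc_le (R : realType) (d : nat) (U : set 'cV[R]_d) (g : 'cV[R]_d -> R)
    (lo hi : R) :
  (forall z, U z -> lo <= g z <= hi) -> (osc U g <= (hi - lo)%:E)%E.
Proof.
move=> H; rewrite EFinB; apply: leeB.
  by apply: ge_ereal_sup => _ [z Uz <-]; rewrite lee_fin; case/andP: (H z Uz).
by apply: le_ereal_inf_tmp => _ [z Uz <-]; rewrite lee_fin; case/andP: (H z Uz).
Qed.

Lemma osc_ge (R : realType) (d : nat) (U : set 'cV[R]_d) (g : 'cV[R]_d -> R)
    (z z' : 'cV[R]_d) :
  U z -> U z' -> ((g z - g z')%:E <= osc U g)%E.
Proof.
move=> Uz Uz'; rewrite EFinB; apply: leeB.
  by apply: ereal_sup_ubound; exists z.
by apply: ereal_inf_lbound; exists z'.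
Qed.

Lemma rectVE (R : realType) (T L : R) (z : 'cV[R]_2) :
  rectV T L z <-> 0 <= z 0 0 <= T /\ 0 <= z 1 0 <= L.
Proof. by rewrite /rectV /rect /pair2 /= !in_itv. Qed.

Lemma cV2E0 (R : realType) (t x : R) : cV2 t x 0 0 = t.
Proof. by rewrite mxE. Qed.

Lemma cV2E1 (R : realType) (t x : R) : cV2 t x 1 0 = x.
Proof. by rewrite mxE. Qed.

Lemma flipE (R : realType) (d : nat) (s : signs d) (z : 'cV[R]_d) i :
  flip s z i 0 = sgb (s i) (z i 0).
Proof. by rewrite mxE. Qed.

Lemma flipK (R : realType) (d : nat) (s : signs d) : involutive (@flip R d s).
Proof. by move=> z; apply/colP => i; rewrite !flipE sgbK. Qed.

Lemma ord2_ind (P : 'I_2 -> Prop) : P 0 -> P 1 -> forall i, P i.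
Proof.
move=> P0 P1 i; have /orP[/eqP ->//|/eqP ->//] : (i == 0) || (i == 1).
by case: i => [[|[|]]].
Qed.

(** The corners of the rectangle at which a component of a decomposition is
    least, and greatest. *)
Definition corner (R : realType) (T L : R) (up : bool) (s : signs 2) : 'cV[R]_2 :=
  cV2 (if s 0 (+) up then T else 0) (if s 1 (+) up then L else 0).

Lemma corner_rectV (R : realType) (T L : R) up (s : signs 2) :
  0 <= T -> 0 <= L -> rectV T L (corner T L up s).
Proof.
by move=> T0 L0; apply/rectVE; rewrite cV2E0 cV2E1; do 2 case: ifP => _; rewrite !lexx ?T0 ?L0.
Qed.

Lemma corner_bounds (R : realType) (T L : R) (g : 'cV[R]_2 -> R) (s : signs 2)
    (z : 'cV[R]_2) : cV_nondecreasing g -> rectV T L z ->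
  g (flip s (corner T L false s)) <= g (flip s z) <= g (flip s (corner T L true s)).
Proof.
move=> gm /rectVE[/andP[z0 zT] /andP[z1 zL]]; apply/andP; split; apply: gm.
  apply: ord2_ind; rewrite !flipE ?cV2E0 ?cV2E1 /sgb ?addbF.
    by case: (s 0); rewrite ?expr1 ?expr0 ?mulN1r ?mul1r ?lerN2.
  by case: (s 1); rewrite ?expr1 ?expr0 ?mulN1r ?mul1r ?lerN2.
apply: ord2_ind; rewrite !flipE ?cV2E0 ?cV2E1 /sgb ?addbT.
  by case: (s 0); rewrite /= ?expr1 ?expr0 ?mulN1r ?mul1r ?lerN2.
by case: (s 1); rewrite /= ?expr1 ?expr0 ?mulN1r ?mul1r ?lerN2.
Qed.

Lemma osc_corner (R : realType) (T L : R) (g : 'cV[R]_2 -> R) (s : signs 2) :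
  0 <= T -> 0 <= L -> cV_nondecreasing g ->
  osc (rectV T L) (fun z => g (flip s z)) =
  (g (flip s (corner T L true s)) - g (flip s (corner T L false s)))%:E.
Proof.
move=> T0 L0 gm; apply/eqP; rewrite eq_le; apply/andP; split.
  by apply: osc_le => z; exact: corner_bounds.
by apply: (osc_ge (fun z => g (flip s z))); exact: corner_rectV.
Qed.

(** The oscillations of the components control that of the sum; hence a function
    of M-variation 0 is constant. *)
Lemma decomposition_osc (R : realType) (d : nat) (U : set 'cV[R]_d)
    (f : 'cV[R]_d -> R) (fs : signs d -> 'cV[R]_d -> R) (z z' : 'cV[R]_d) :
  M_decomposition U f fs -> U z -> U z' ->
  ((f z - f z')%:E <= \sum_(s : signs d) osc U (fun z => fs s (flip s z)))%E.
Proof.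
move=> [_ fE] Uz Uz'; rewrite (fE _ Uz) (fE _ Uz') -sumrB -sumEFin.
by apply: lee_sum => s _; exact: (osc_ge (fun z => fs s (flip s z))).
Qed.

Lemma MVar_ge0 (R : realType) (d : nat) (U : set 'cV[R]_d) (f : 'cV[R]_d -> R)
    (z : 'cV[R]_d) : U z -> (0 <= MVar U f)%E.
Proof.
move=> Uz; apply: le_ereal_inf_tmp => _ [fs H ->].
by have := decomposition_osc H Uz Uz; rewrite subrr.
Qed.

(** The factor 2 leaves room when the M-variation is positive.  When
    it is 0 there is no room, but then the function is constant, and a decomposition
    into constants has no oscillation. *)
Lemma near_optimal_decomposition (R : realType) (T L : R) (f : 'cV[R]_2 -> R) :
  0 <= T -> 0 <= L -> BMV (rectV T L) f ->
  exists2 fs, M_decomposition (rectV T L) f fs &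
    (\sum_(s : signs 2) osc (rectV T L) (fun z => fs s (flip s z)) <=
     2%:E * MVar (rectV T L) f)%E.
Proof.
move=> T0 L0 [fs0 H0].
have R0 : rectV T L (corner T L false [ffun=> false]) by exact: corner_rectV.
have M0 := MVar_ge0 f R0.
have [MN|Mp] := eqVneq (MVar (rectV T L) f) 0%E.
  have fc z z' : rectV T L z -> rectV T L z' -> f z = f z'.
    move=> Rz Rz'; have le a b : rectV T L a -> rectV T L b -> f a <= f b.
      move=> Ra Rb; have : ((f a - f b)%:E <= MVar (rectV T L) f)%E.
        by apply: le_ereal_inf_tmp => _ [fs H ->]; exact: decomposition_osc.
      by rewrite MN lee_fin subr_le0.
    by apply/le_anti; rewrite !le.
  pose c := f (corner T L false [ffun=> false]).
  pose fs (s : signs 2) (z : 'cV[R]_2) := c / #|{: signs 2}|%:R.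
  exists fs.
    split; first by move=> s x y _; exact: lexx.
    move=> z Rz; rewrite (fc _ _ Rz R0) /fs sumr_const -[RHS]mulr_natr divfK//.
    by rewrite pnatr_eq0 card_ffun card_bool card_ord.
  rewrite MN mule0; apply: sume_le0 => s _.
  rewrite -[leRHS]/(0%:E) -[0 in leRHS](subrr (c / #|{: signs 2}|%:R)).
  by apply: osc_le => z _; rewrite lexx.
have Mfin : MVar (rectV T L) f \is a fin_num.
  rewrite ge0_fin_numE//; apply: (@le_lt_trans _ _
    (\sum_(s : signs 2) osc (rectV T L) (fun z => fs0 s (flip s z)))%E).
    by apply: ereal_inf_lbound; exists fs0.
  apply: lte_sum_pinfty => s _; rewrite (osc_corner s T0 L0 (H0.1 s)) ltry//.
have M0' : 0 < fine (MVar (rectV T L) f).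
  by rewrite fine_gt0// lt0e Mp M0 -ge0_fin_numE.
have [_ [fs H ->] h] := lb_ereal_inf_adherent M0' Mfin.
by exists fs => //; apply: (le_trans (ltW h)); rewrite fineK// -mule2n -mule_natl.
Qed.

(** * Components along the two axes *)

Lemma component_t (R : realType) (g : 'cV[R]_2 -> R) (s : signs 2) (x : R) :
  cV_nondecreasing g -> {homo (fun t => sgb (s 0) (g (flip s (cV2 t x)))) : t t' / t <= t'}.
Proof.
move=> gm t t' tt.
rewrite /sgb; case s0 : (s 0); rewrite ?expr1 ?expr0 ?mulN1r ?mul1r ?lerN2;
  apply: gm; apply: ord2_ind; rewrite !flipE ?cV2E0 ?cV2E1//.
  by rewrite s0 /sgb expr1 !mulN1r lerN2.
by rewrite s0 /sgb expr0 !mul1r.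
Qed.

Lemma component_x (R : realType) (g : 'cV[R]_2 -> R) (s : signs 2) (t : R) :
  cV_nondecreasing g -> {homo (fun x => sgb (s 1) (g (flip s (cV2 t x)))) : x x' / x <= x'}.
Proof.
move=> gm x x' xx.
rewrite /sgb; case s1 : (s 1); rewrite ?expr1 ?expr0 ?mulN1r ?mul1r ?lerN2;
  apply: gm; apply: ord2_ind; rewrite !flipE ?cV2E0 ?cV2E1//.
  by rewrite s1 /sgb expr1 !mulN1r lerN2.
by rewrite s1 /sgb expr0 !mul1r.
Qed.

(** The sum of the components is defined on the whole plane, beyond the rectangle
    on which it represents [u]; this avoids boundary cases in the estimates of
    increments. *)
Definition sum_field (R : realType) (fs : signs 2 -> 'cV[R]_2 -> R) (t x : R) : R :=
  \sum_(s : signs 2) fs s (flip s (cV2 t x)).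

Definition var_field (R : realType) (i : 'I_2) (fs : signs 2 -> 'cV[R]_2 -> R)
    (t x : R) : R :=
  \sum_(s : signs 2) sgb (s i) (fs s (flip s (cV2 t x))).

Lemma signed_increment (R : realType) (I : finType) (b : I -> bool)
    (g : I -> R -> R) (y y' : R) :
  (forall i, {homo (fun y => sgb (b i) (g i y)) : x y / x <= y}) -> y <= y' ->
  `|\sum_i g i y' - \sum_i g i y| <=
  \sum_i sgb (b i) (g i y') - \sum_i sgb (b i) (g i y).
Proof.
move=> gm yy; rewrite -!sumrB; apply: le_trans (ler_norm_sum _ _ _) _.
apply: ler_sum => i _; rewrite -(sgb_norm (b i)) ger0_norm// subr_ge0.
exact: gm.
Qed.

Lemma sum_field_bv (R : realType) (fs : signs 2 -> 'cV[R]_2 -> R) :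
  (forall s, cV_nondecreasing (fs s)) ->
  bv_field (sum_field fs) (var_field 0 fs) (var_field 1 fs).
Proof.
move=> fm; split.
- move=> x t t' tt.
  apply: (signed_increment (b := fun s : signs 2 => s 0)
     (g := fun (s : signs 2) t => fs s (flip s (cV2 t x)))) tt => s.
  exact: component_t.
- move=> t x x' xx.
  apply: (signed_increment (b := fun s : signs 2 => s 1)
     (g := fun (s : signs 2) x => fs s (flip s (cV2 t x)))) xx => s.
  exact: component_x.
- move=> t; apply: tame_sum => s; apply: tameM; first exact: tame_cst.
  exact: (tame_signed (component_x s t (fm s))).
- move=> x; apply: tame_sum => s; apply: tameM; first exact: tame_cst.
  exact: (tame_signed (component_t s x (fm s))).
Qed.

(** * Test functions in the weak formulation *)

Lemma step_ordered (R : realType) (p q p' q' s : R) :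
  p < q -> p' < q' -> q <= p' -> 0 <= smooth_step p q s - smooth_step p' q' s.
Proof.
move=> pq pq' qp; rewrite subr_ge0; have [sp|ps] := leP s p'.
  by rewrite [leLHS]smooth_step_le//; case/andP: (smooth_step_itv s pq).
rewrite [leRHS]smooth_step_ge//; last exact: le_trans (ltW ps).
by case/andP: (smooth_step_itv s pq').
Qed.

(** [(A, B)] stands for the pairs (id, F), (- id, - F) and (S, Q), truncated. *)
Definition balanced (R : realType) (T L : R) (U : R -> R -> R)
    (A B : R -> R) : Prop :=
  forall p q p' q' c pi qi pj qj : R,
  p < q -> p' < q' -> q <= p' -> q' < T ->
  0 < pi -> pi < qi -> qi < L -> 0 < pj -> pj < qj -> qj < L ->
  (forall x, 0 <= c + smooth_step pi qi x - smooth_step pj qj x) ->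
  let a s := smooth_step p q s - smooth_step p' q' s in
  let b x := c + smooth_step pi qi x - smooth_step pj qj x in
  is_true (0 <= rint 0 T (fun s => rint 0 L (fun x =>
         A (U s x) * (derive1 a s * b x) + B (U s x) * (a s * derive1 b x)))
       + rint 0 L (fun x => A (U 0 x) * (a 0 * b x))).

(** The entropy inequality for a product of steps, with [u] replaced by its
    representation as a sum of monotone components and the entropy pair by its
    truncation. *)
Lemma weak_balance (R : realType) (T L : R) (A B A0 B0 : R -> R) (u : R * R -> R)
    (U : R -> R -> R) (M : R) :
  0 < T -> 0 < L ->
  (forall t x, 0 <= t <= T -> 0 <= x <= L -> u (t, x) = U t x /\ `|u (t, x)| <= M) ->
  (forall v, `|v| <= M -> A v = A0 v /\ B v = B0 v) ->
  entropy_inequality T L A0 B0 (fun x => u (0, x)) u ->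
  balanced T L U A B.
Proof.
move=> T0 L0 uU AB ent p q p' q' c pi qi pj qj pq pq' qp' q'T pi0 piqi qiL pj0 pjqj qjL b0 a b.
have sN (f : R -> R) : smooth1 f -> smooth1 (fun x => - f x).
  move=> sf k; rewrite (_ : (fun x => - f x) = fun x => -1 * f x).
    by apply: smooth_uptoM; [exact: smooth1_cst|exact: sf].
  by apply/funext => x; rewrite mulN1r.
have sa : smooth1 a.
  move=> k; apply: smooth_uptoD; first exact: smooth_smooth_step.
  by apply: sN; exact: smooth_smooth_step.
have sb : smooth1 b.
  move=> k; apply: smooth_uptoD; last by apply: sN; exact: smooth_smooth_step.
  by apply: smooth_uptoD; [exact: smooth1_cst|exact: smooth_smooth_step].
have test : periodic_test T L (tensor a b).
  apply: (@tensor_periodic_test _ T L q' c) => //.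
  - move=> t qt; rewrite /a !smooth_step_ge ?subrr//.
    by apply: le_trans qt; apply: le_trans qp' _; exact: ltW.
  - near=> x; rewrite /b !smooth_step_le ?addr0 ?subr0//.
      by apply/ltW; near: x; exact: lt_nbhsl.
    by apply/ltW; near: x; exact: lt_nbhsl.
  - near=> x; rewrite /b !smooth_step_ge ?addrK//.
      by apply/ltW; near: x; exact: lt_nbhsr.
    by apply/ltW; near: x; exact: lt_nbhsr.
have pos p0 : (`[0, T[%classic `*` `[0, L]%classic) p0 -> 0 <= tensor a b p0.
  by move=> _; apply: mulr_ge0; [exact: step_ordered|exact: b0].
have [da _] := sa 1%N; have [db _] := sb 1%N.
have E1 : weak_lhs T L (A0 \o u) (B0 \o u) (tensor a b) =
    rint 0 T (fun s => rint 0 L (fun x =>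
         A (U s x) * (derive1 a s * b x) + B (U s x) * (a s * derive1 b x))).
  rewrite /weak_lhs (pd_t_tensor _ da) (pd_x_tensor _ db).
  apply: eq_rint => s sT; apply: eq_rint => x xL; have [uE uM] := uU s x sT xL.
  by have [hA hB] := AB _ uM; rewrite /tensor /= -uE hA hB.
have E2 : rint 0 L (fun x => A0 (u (0, x)) * tensor a b (0, x)) =
    rint 0 L (fun x => A (U 0 x) * (a 0 * b x)).
  apply: eq_rint => x xL; have T0' : 0 <= (0 : R) <= T by rewrite lexx ltW.
  have [uE uM] := uU 0 x T0' xL.
  by have [hA _] := AB _ uM; rewrite -uE hA.
by have := ent _ test pos; rewrite E1 E2 -subr_ge0 opprK.
Unshelve. all: by end_near.
Qed.

(** * One-sided windows at the nodes of a grid *)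

Lemma windowW (R : realType) (len mu mu' x xs p q : R) :
  mu <= mu' -> window len mu x xs p q -> window len mu' x xs p q.
Proof.
move=> mm [p0 pq ql xsp [xl xp qx]]; split => //; split => //.
  by apply: le_trans xp; rewrite lerD2l lerN2.
by apply: (le_trans qx); rewrite lerD2l.
Qed.

Lemma grid_windows (R : realType) (len c om mu : R) (H : R -> R) (n : nat)
    (y : 'I_n -> R) :
  {homo H : x y / x <= y} -> 0 < len -> 0 <= c <= len -> 0 < om -> 0 < mu ->
  (forall i, 0 <= y i <= len /\ y i != c) ->
  \forall kap \near 0^'+, forall i, exists p q,
    window len mu (y i) (contract c kap (y i)) p q /\ H q - H p <= om.
Proof.
move=> Hm len0 clen om0 mu0 ylen; apply: filter_forall => i.
have [yi yc] := ylen i; have := contract_window Hm clen yi yc om0.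
have small : \forall kap \near 0^'+, 2 * kap * len <= mu.
  near=> kap; rewrite -mulrA [kap * _]mulrC mulrA -ler_pdivlMl ?mulr_gt0//.
  by near: kap; apply: nbhs_right_le; rewrite mulr_gt0 ?invr_gt0 ?mulr_gt0.
apply: filterS2 small => kap k1 [p [q [w Hpq]]].
by exists p, q; split => //; exact: windowW w.
Unshelve. all: by end_near.
Qed.

(** * The balance on grid cells *)

(** The condition [0 < t] is there because the step of the initial node rises
    before time 0, possibly far from the node. *)
Definition time_node (R : realType) (T : R) (H : R -> R) (om mu t ts p q : R)
    : Prop :=
  [/\ p < q, q < T, q <= t + mu, (0 < t -> t - mu <= p) &
      time_step T H om mu t ts (smooth_step p q)].

Lemma lip_comp_tame (R : realType) (C : R) (A e : R -> R) :
  lip_bounded C A -> tame e -> tame (fun x => A (e x)).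
Proof.
move=> hA [me be]; split; last by move=> a b; exists C => x _; exact: hA.2.
apply: (@measurableT_comp _ _ _ _ _ _ A) => //.
apply: measurable_realfun.continuous_measurable_fun => a.
have C1 : 0 < C + 1 by rewrite ltr_wpDl ?ltr01 ?(lip_bounded_ge0 hA).
apply/cvgrPdist_le => eps eps0; near=> x.
apply: le_trans (hA.1 _ _) _.
apply: (@le_trans _ _ ((C + 1) * `|a - x|)).
  by apply: ler_wpM2r => //; rewrite lerDl.
rewrite mulrC -ler_pdivlMr//; near: x.
by apply: cvgr_dist_le => //; exact: divr_gt0.
Unshelve. all: by end_near.
Qed.

Lemma rint_sub_le (R : realType) (f : R -> R) (a b len : R) :
  tame f -> (forall x, 0 <= f x) -> 0 <= a -> a <= b -> b <= len ->
  rint a b f <= rint 0 len f.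
Proof.
move=> tf f0 a0 ab bl.
rewrite (rint_split tf a0 (le_trans ab bl)) (rint_split tf ab bl).
have h1 : 0 <= rint 0 a f by apply: rint_ge0 => x _; exact: f0.
have h2 : 0 <= rint b len f by apply: rint_ge0 => x _; exact: f0.
by rewrite addrCA lerDl addr_ge0.
Qed.

Lemma rint_lip_close (R : realType) (C : R) (A e g : R -> R) (a b len del : R) :
  lip_bounded C A -> tame e -> tame g -> 0 <= a -> a <= b -> b <= len ->
  rint 0 len (fun x => `|e x - g x|) <= del ->
  `|rint a b (fun x => A (e x)) - rint a b (fun x => A (g x))| <= C * del.
Proof.
move=> hA te tg a0 ab bl h.
have teg : tame (fun x => `|e x - g x|) by apply: tame_norm; exact: tameB.
apply: (@le_trans _ _ (rint a b (fun x => C * `|e x - g x|))).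
  apply: rint_dist_le.
  - exact: lip_comp_tame hA te.
  - exact: lip_comp_tame hA tg.
  - by apply: tameM => //; exact: tame_cst.
  - by move=> x _; exact: hA.1.
rewrite rintZ//; apply: ler_wpM2l; first exact: lip_bounded_ge0 hA.
exact: le_trans (rint_sub_le teg _ a0 ab bl) h.
Qed.

Lemma rint_xx (R : realType) (f : R -> R) (a : R) : tame f -> rint a a f = 0.
Proof.
move=> tf; have := rint_split tf (lexx a) (lexx a).
by move/eqP; rewrite -subr_eq subrr eq_sym => /eqP.
Qed.

(** The factor in [x] is the difference of two successive steps. *)
Lemma cell_balance (R : realType) (T L : R) (U V1 V2 : R -> R -> R)
    (A B : R -> R) (C om mu t ts p q t' ts' p' q' x xs pi qi x' xs' pj qj : R) :
  0 < T -> 0 < L -> bv_field U V1 V2 -> lip_bounded C A -> lip_bounded C B ->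
  balanced T L U A B ->
  time_node T (fun s => rint 0 L (V1 s)) om mu t ts p q ->
  time_node T (fun s => rint 0 L (V1 s)) om mu t' ts' p' q' ->
  0 <= t -> t + 2 * mu <= t' -> 0 < mu -> t' <= T ->
  window L mu x xs pi qi ->
  rint 0 T (fun s => V2 s qi) - rint 0 T (fun s => V2 s pi) <= om ->
  window L mu x' xs' pj qj ->
  rint 0 T (fun s => V2 s qj) - rint 0 T (fun s => V2 s pj) <= om ->
  x + 2 * mu <= x' ->
  (rint x x' (fun y => A (U ts' y)) - rint x x' (fun y => A (U ts y)))
  + (rint t t' (fun s => B (U s xs')) - rint t t' (fun s => B (U s xs)))
  <= 6 * C * om + 16 * C * mu.
Proof.
move=> T0 L0 bvU hA hB bal [pq qT qt _ th] [pq' qT' _ tp' th'] t0 tt mu0 tT.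
move=> wi Hi wj Hj xx.
have [pi0 piqi qiL _ [xL xpi qix]] := wi; have [pj0 pjqj qjL _ [xL' xpj qjx]] := wj.
have qp' : q <= p' by have := tp' ltac:(lra); lra.
have qpj : qi <= pj by lra.
have c01 : 0 <= (0 : R) <= 1 by rewrite lexx ler01.
have b0 y : 0 <= 0 + smooth_step pi qi y - smooth_step pj qj y.
  by rewrite add0r; exact: step_ordered.
have := balance_inequality T0 L0 bvU hA hB c01 th th' wi Hi wj Hj
  (bal _ _ _ _ _ _ _ _ _ pq pq' qp' qT' pi0 piqi qiL pj0 pjqj qjL b0).
have tA s : tame (fun y => A (U s y)) := tame_field_x s bvU hA.
have tB y : tame (fun s => B (U s y)) := tame_field_t y bvU hB.
have tt' : t <= t' by lra.
have xx' : x <= x' by lra.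
case/andP: xL => x0 xL; case/andP: xL' => x0' xL'.
rewrite !mul0r !add0r !(rint_split (tA _) xx' xL').
rewrite (rint_split (tameB (tB xs) (tB xs')) tt' tT) !addrK.
by rewrite rintB// opprB.
Qed.

(** The factor in [x] is 1 near both ends and vanishes between the extreme
    nodes, so that the mass that it weighs is small and only the two fluxes
    remain. *)
Lemma boundary_balance (R : realType) (T L : R) (U V1 V2 : R -> R -> R)
    (A B : R -> R) (C om mu ts p q ts' p' q' xs pi qi xs' pj qj : R) :
  0 < T -> 0 < L -> bv_field U V1 V2 -> lip_bounded C A -> lip_bounded C B ->
  balanced T L U A B ->
  time_node T (fun s => rint 0 L (V1 s)) om mu 0 ts p q ->
  time_node T (fun s => rint 0 L (V1 s)) om mu T ts' p' q' ->
  2 * mu <= T ->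
  window L mu L xs pi qi ->
  rint 0 T (fun s => V2 s qi) - rint 0 T (fun s => V2 s pi) <= om ->
  window L mu 0 xs' pj qj ->
  rint 0 T (fun s => V2 s qj) - rint 0 T (fun s => V2 s pj) <= om ->
  rint 0 T (fun s => B (U s xs')) - rint 0 T (fun s => B (U s xs))
  <= 6 * C * om + 16 * C * mu.
Proof.
move=> T0 L0 bvU hA hB bal [pq qT qt _ th] [pq' qT' _ tp' th'] muT wi Hi wj Hj.
have [pi0 piqi qiL _ _] := wi; have [pj0 pjqj qjL _ _] := wj.
have qp' : q <= p' by have := tp' T0; lra.
have c01 : 0 <= (1 : R) <= 1 by rewrite lexx ler01.
have b0 y : 0 <= 1 + smooth_step pi qi y - smooth_step pj qj y.
  have /andP[? ?] := smooth_step_itv y piqi; have /andP[? ?] := smooth_step_itv y pjqj.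
  by lra.
have := balance_inequality T0 L0 bvU hA hB c01 th th' wi Hi wj Hj
  (bal _ _ _ _ _ _ _ _ _ pq pq' qp' qT' pi0 piqi qiL pj0 pjqj qjL b0).
have tA s : tame (fun y => A (U s y)) := tame_field_x s bvU hA.
have tB y : tame (fun s => B (U s y)) := tame_field_t y bvU hB.
rewrite !mul1r !(rint_xx L (tA _)) (rint_xx T (tameB (tB xs) (tB xs'))).
by rewrite !addr0 !subrr !subr0 sub0r rintB// opprB.
Qed.

(** * Fitting a network to a decomposition on a grid *)

(** Conjugating the contraction by the reflection [flip s] keeps it increasing in
    each coordinate. *)
Lemma contracted_component (R : realType) (g : 'cV[R]_2 -> R) (s : signs 2)
    (ct cx kap : R) :
  cV_nondecreasing g -> kap <= 1 ->
  cV_nondecreasing (fun z : 'cV[R]_2 => g (flip s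
    (cV2 (contract ct kap (flip s z 0 0)) (contract cx kap (flip s z 1 0))))).
Proof.
move=> gm k1 y z yz; apply: gm.
have key (b : bool) (c v w : R) : v <= w ->
    sgb b (contract c kap (sgb b v)) <= sgb b (contract c kap (sgb b w)).
  move=> vw; rewrite /sgb; case: b; rewrite ?expr1 ?expr0 ?mulN1r ?mul1r ?lerN2;
    by apply: contract_nondecreasing => //; rewrite lerN2.
by apply: ord2_ind; rewrite [leLHS]flipE [leRHS]flipE ?cV2E0 ?cV2E1 !flipE; exact: key.
Qed.

Lemma network_fit (R : realType) (sigma : R -> R) (sm sp : R) (l mt mx : nat)
    (T L cx kap dt dx del : R) (fs : signs 2 -> 'cV[R]_2 -> R) :
  {homo sigma : x y / x <= y} -> sm < sp ->
  sigma x @[x --> -oo] --> sm -> sigma x @[x --> +oo] --> sp ->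
  (3 <= l)%N -> 0 < T -> 0 < L -> (forall s, cV_nondecreasing (fs s)) ->
  0 <= kap <= 1 -> 0 <= cx <= L -> 0 <= dt -> 0 <= dx ->
  mt%:R * dt = T -> mx%:R * dx = L -> 0 < del ->
  exists (N : netA R 2 l) (es : signs 2 -> 'cV[R]_2 -> R),
    [/\ forall s, cV_nondecreasing (es s),
        forall z, netA_eval sigma N z = \sum_(s : signs 2) es s (flip s z),
        (EMVar sigma (rectV T L) N <=
         \sum_(s : signs 2) osc (rectV T L) (fun z => fs s (flip s z)))%E,
        forall s z, fs s (flip s (corner T L false s)) <= es s z
                    <= fs s (flip s (corner T L true s)) &
        forall s i j, (i <= mt)%N -> (j <= mx)%N ->
          `|es s (flip s (cV2 (i%:R * dt) (j%:R * dx))) -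
            fs s (flip s (cV2 (contract 0 kap (i%:R * dt))
                              (contract cx kap (j%:R * dx))))| <= del].
Proof.
move=> smono smp cm cp l3 T0 L0 fm k01 cxL dt0 dx0 mtT mxL del0.
have /andP[k0 k1] := k01.
have grid (d len : R) (m i : nat) : 0 <= d -> m%:R * d = len -> (i <= m)%N ->
    0 <= i%:R * d <= len.
  by move=> d0 <- im; rewrite mulr_ge0//= ler_wpM2r// ler_nat.
have t0L : 0 <= (0 : R) <= T by rewrite lexx ltW.
have in_rect i j : (i <= mt)%N -> (j <= mx)%N -> rectV T L
    (cV2 (contract 0 kap (i%:R * dt)) (contract cx kap (j%:R * dx))).
  move=> im jm; apply/rectVE; rewrite cV2E0 cV2E1.
  split; apply: contract_itv => //.
    exact: (grid _ _ _ _ dt0 mtT im).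
  exact: (grid _ _ _ _ dx0 mxL jm).
pose J := ('I_mt.+1 * 'I_mx.+1)%type.
have fit (s : signs 2) : exists N : mlp R l 2, [/\ mlp_ge0 N,
    forall z, fs s (flip s (corner T L false s)) <= mlp_eval sigma N z
      <= fs s (flip s (corner T L true s)) &
    forall i j, (i <= mt)%N -> (j <= mx)%N ->
      `|mlp_eval sigma N (flip s (cV2 (i%:R * dt) (j%:R * dx))) -
        fs s (flip s (cV2 (contract 0 kap (i%:R * dt))
                          (contract cx kap (j%:R * dx))))| <= del].
  pose P (k : 'I_#|{: J}|) : 'cV[R]_2 :=
    flip s (cV2 ((enum_val k).1%:R * dt) ((enum_val k).2%:R * dx)).
  (* At the reflected grid points, [g] is the component at the contracted ones. *)
  pose g (z : 'cV[R]_2) := fs s (flip s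
    (cV2 (contract 0 kap (flip s z 0 0)) (contract cx kap (flip s z 1 0)))).
  have gE i j : g (flip s (cV2 i j)) =
      fs s (flip s (cV2 (contract 0 kap i) (contract cx kap j))).
    by rewrite /g !flipK cV2E0 cV2E1.
  have R0 : rectV T L (corner T L true s) by apply: corner_rectV; exact: ltW.
  have lohi : fs s (flip s (corner T L false s)) <= fs s (flip s (corner T L true s)).
    by case/andP: (corner_bounds s (fm s) R0).
  have Pb k : fs s (flip s (corner T L false s)) <= g (P k)
      <= fs s (flip s (corner T L true s)).
    rewrite /P gE; apply: corner_bounds => //.
    by apply: in_rect; exact: leq_ord.
  have [N [N0 Nb Ng]] := monotone_interpolation smono smp cm cp l3
    (contracted_component s 0 cx (fm s) k1) lohi Pb del0.
  exists N; split => // i j im jm.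
  have := Ng (enum_rank ((inord i : 'I_mt.+1), (inord j : 'I_mx.+1))).
  by rewrite -/(g _) /P enum_rankK /= !inordK// gE.
have [Nf HN] := choice fit.
have HN0 i : mlp_ge0 (Nf i) by case: (HN i).
pose N := @NetA R 2 l #|{: signs 2}| (fun i => enum_val i)
  (fun i => Nf (enum_val i)) (fun i => HN0 (enum_val i)).
exists N, (fun s => mlp_eval sigma (Nf s)); split.
- by move=> s; apply: mlp_eval_nondecreasing => //; case: (HN s).
- move=> z; rewrite /netA_eval /=.
  rewrite -(big_enum_val (fun s => mlp_eval sigma (Nf s) (flip s z))) /=.
  by apply: eq_bigl.
- rewrite /EMVar /=.
  rewrite -(big_enum_val (fun s => osc (rectV T L) (fun z => mlp_eval sigma (Nf s) (flip s z)))) /=.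
  apply: lee_sum => s _; rewrite (osc_corner s (ltW T0) (ltW L0) (fm s)).
  by apply: osc_le => z _; case: (HN s).
- by move=> s; case: (HN s).
- by move=> s; case: (HN s).
Qed.

(** * The approximating network *)

Lemma small_fraction (R : realType) (len b : R) : 0 < len -> 0 < b ->
  exists2 n : nat, (0 < n)%N & len / n%:R <= b.
Proof.
move=> l0 b0; exists (Num.truncn (len / b)).+1 => //.
by rewrite ler_pdivrMr// mulrC -ler_pdivrMr//; exact/ltW/truncnS_gt.
Qed.

Lemma line_close_eps (R : realType) (I : finType) (b : I -> bool)
    (e g : I -> R -> R) (c kap d del r len W eps : R) (m n : nat) :
  (forall i, {homo (fun y => sgb (b i) (e i y)) : x y / x <= y}) ->
  (forall i, {homo (fun y => sgb (b i) (g i y)) : x y / x <= y}) ->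
  0 <= kap -> 0 <= c <= len -> 0 < d -> (0 < m)%N -> m%:R * d = len ->
  0 < r -> n%:R * r = len -> d + kap * len <= r ->
  (forall k i, (k <= m)%N -> `|e i (k%:R * d) - g i (contract c kap (k%:R * d))| <= del) ->
  r <= 1 ->
  \sum_i sgb (b i) (g i (len + 1)) - \sum_i sgb (b i) (g i (- 1)) <= W ->
  3 * r * W <= eps / 2 -> len * (#|I|%:R * del) <= eps / 2 ->
  rint 0 len (fun y => `|\sum_i e i y - \sum_i g i y|) <= eps.
Proof.
move=> em gm k0 clen d0 m0 md r0 nr dr H r1 hW hr hd.
apply: le_trans (line_close em gm k0 clen d0 m0 md r0 nr dr H) _.
rewrite [leRHS](_ : eps = eps / 2 + eps / 2); last by field.
apply: lerD => //; apply: le_trans hr; rewrite ler_pM2l ?mulr_gt0//.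
apply: le_trans hW; apply: lerB; apply: ler_sum => i _; apply: gm.
  by rewrite lerD2l.
by rewrite lerN2.
Qed.

Lemma rint_nondecreasing (R : realType) (V : R -> R -> R) (len : R) :
  (forall y, tame (V y)) -> (forall x, {homo V^~ x : y y' / y <= y'}) ->
  {homo (fun y => rint 0 len (V y)) : y y' / y <= y'}.
Proof. by move=> tV Vm y y' yy; apply: le_rint => // x _; exact: Vm. Qed.

(** Half the first cell is the centre of the contraction in space: a centre
    that is a node would not be moved to the side of a window. *)
Lemma half_step_neq (R : realType) (h : R) (m : nat) : 0 < h -> m%:R * h != h / 2.
Proof.
move=> h0; case: m => [|m].
  by rewrite mul0r eq_sym mulf_neq0 ?gt_eqF.
rewrite gt_eqF// (@lt_le_trans _ _ h)//.
  by rewrite ltr_pdivrMr// ltr_pMr// ltr1n.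
by rewrite ler_peMl ?(ltW h0)// ler1n.
Qed.

(** The order of the choices matters: the scale [rt], [rx] of the line estimates
    depends on the decomposition and on [eps]; then comes the contraction, small with
    respect to this scale and to the windows; then a grid finer than
    the scale that contains the given nodes; and last the accuracy of the
    network on this grid. *)
Lemma network_approximation (R : realType) (sigma : R -> R) (sm sp : R)
    (l Nx Nt : nat) (T L eps om mu : R) (fs : signs 2 -> 'cV[R]_2 -> R) :
  {homo sigma : x y / x <= y} -> sm < sp ->
  sigma x @[x --> -oo] --> sm -> sigma x @[x --> +oo] --> sp ->
  (3 <= l)%N -> 0 < T -> 0 < L -> (forall s, cV_nondecreasing (fs s)) ->
  (0 < Nx)%N -> (0 < Nt)%N -> 0 < eps -> 0 < om -> 0 < mu ->
  let U := sum_field fs in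
  let H1 s := rint 0 L (var_field 0 fs s) in
  let H2 x := rint 0 T (fun s => var_field 1 fs s x) in
  let tg (k : nat) := k%:R * (T / Nt%:R) in
  let xg (m : nat) := m%:R * (L / Nx%:R) in
  exists (N : netA R 2 l) (es : signs 2 -> 'cV[R]_2 -> R) (ts xs : nat -> R),
    [/\ (forall s, cV_nondecreasing (es s)) /\
        (forall t x, netA_eval sigma N (cV2 t x) = sum_field es t x) /\
        (forall s z, fs s (flip s (corner T L false s)) <= es s z
                    <= fs s (flip s (corner T L true s))),
        (EMVar sigma (rectV T L) N <=
         \sum_(s : signs 2) osc (rectV T L) (fun z => fs s (flip s z)))%E,
        ts 0%N = 0 /\
        (forall k, (k <= Nt)%N -> exists p q, time_node T H1 om mu (tg k) (ts k) p q),
        (forall m, (m <= Nx)%N -> exists p q,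
           window L mu (xg m) (xs m) p q /\ H2 q - H2 p <= om) &
        (forall k, (k <= Nt)%N ->
           rint 0 L (fun x => `|sum_field es (tg k) x - U (ts k) x|) <= eps) /\
        (forall m, (m <= Nx)%N ->
           rint 0 T (fun t => `|sum_field es t (xg m) - U t (xs m)|) <= eps)].
Proof.
move=> smono smp cm cp l3 T0 L0 fm Nx0 Nt0 eps0 om0 mu0 U H1 H2 tg xg.
have [Ut Ux tV1 tV2] := sum_field_bv fm.
pose V1 := var_field 0 fs; pose V2 := var_field 1 fs.
have V1m x : {homo V1^~ x : y y' / y <= y'}.
  by move=> y y' /(Ut x) h; rewrite -subr_ge0; exact: le_trans h.
have V2m t : {homo V2 t : y y' / y <= y'}.
  by move=> y y' /(Ux t) h; rewrite -subr_ge0; exact: le_trans h.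
have H1m : {homo H1 : y y' / y <= y'} by exact: rint_nondecreasing.
have H2m : {homo H2 : y y' / y <= y'}.
  by apply: (@rint_nondecreasing _ (fun x s => V2 s x)) => // s; exact: V2m.
have dT0 : 0 < T / Nt%:R by rewrite divr_gt0// ltr0n.
have h0 : 0 < L / Nx%:R by rewrite divr_gt0// ltr0n.
have tgT : Nt%:R * (T / Nt%:R) = T by rewrite mulrC divfK// pnatr_eq0 -lt0n.
have xgL : Nx%:R * (L / Nx%:R) = L by rewrite mulrC divfK// pnatr_eq0 -lt0n.
have tg_itv k : (k <= Nt)%N -> 0 <= tg k <= T.
  by move=> kN; rewrite /tg mulr_ge0 ?(ltW dT0)//= -[leRHS]tgT ler_pM2r// ler_nat.
have xg_itv m : (m <= Nx)%N -> 0 <= xg m <= L.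
  by move=> mN; rewrite /xg mulr_ge0 ?(ltW h0)//= -[leRHS]xgL ler_pM2r// ler_nat.
pose cx := L / Nx%:R / 2.
have cxL : 0 <= cx <= L.
  rewrite /cx divr_ge0 ?(ltW h0)//= ler_pdivrMr// ler_pdivrMr ?ltr0n//.
  rewrite -mulrA ler_peMr ?(ltW L0)// -natrM ler1n muln_gt0//.
have t0T : 0 <= (0 : R) <= T by rewrite lexx ltW.
(* The scales of the line estimates are at most 1, so that increments over the
   rectangle enlarged by 1 suffice, uniformly in the line. *)
have [W1 W10 hW1] := tame_bounded 0 L (tameB (tV1 (T + 1)) (tV1 (- 1))).
have [W2 W20 hW2] := tame_bounded 0 T (tameB (tV2 (L + 1)) (tV2 (- 1))).
have scale W len : 0 <= W -> 0 < len -> exists n : nat, exists2 r : R, 0 < r &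
    [/\ n%:R * r = len, r <= 1 & 3 * r * W <= eps / 2].
  move=> W0 len0; have b0 : 0 < Num.min 1 (eps / (6 * (W + 1))).
    by rewrite lt_min ltr01 divr_gt0// mulr_gt0// ltr_wpDl.
  have [n n0] := small_fraction len0 b0.
  rewrite le_min => /andP[r1 r2]; exists n, (len / n%:R).
    by rewrite divr_gt0// ltr0n.
  split => //; first by rewrite mulrC divfK// pnatr_eq0 -lt0n.
  have r0 : 0 <= len / n%:R by rewrite divr_ge0// ltW.
  apply: (@le_trans _ _ (3 * (len / n%:R) * (W + 1))).
    by apply: ler_wpM2l; [rewrite mulr_ge0|rewrite lerDl].
  move: r2; rewrite ler_pdivlMr ?mulr_gt0// ?ltr_wpDl//.
  by move: (len / n%:R) (W + 1) => r V; clear; nra.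
have [nt [rt rt0 [ntr rt1 rtW]]] := scale W1 T W10 T0.
have [nx [rx rx0 [nxr rx1 rxW]]] := scale W2 L W20 L0.
have [kap [kap0 kap1 kT kL] [wt wx]] : exists2 kap : R,
    [/\ 0 < kap, kap <= 1, kap <= rt / 2 / T & kap <= rx / 2 / L] &
    (forall i : 'I_Nt, exists p q, window T mu (tg i.+1)
       (contract 0 kap (tg i.+1)) p q /\ H1 q - H1 p <= om) /\
    (forall i : 'I_Nx.+1, exists p q, window L mu (xg i)
       (contract cx kap (xg i)) p q /\ H2 q - H2 p <= om).
  have yt (i : 'I_Nt) : 0 <= tg i.+1 <= T /\ tg i.+1 != 0.
    split; first by apply: tg_itv; exact: ltn_ord.
    by rewrite gt_eqF// mulr_gt0// ltr0n.
  have yx (i : 'I_Nx.+1) : 0 <= xg i <= L /\ xg i != cx.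
    split; first by apply: xg_itv; exact: leq_ord.
    exact: half_step_neq.
  have near_t := grid_windows H1m T0 t0T om0 mu0 yt.
  have near_x := grid_windows H2m L0 cxL om0 mu0 yx.
  have small (r len : R) : 0 < r -> 0 < len -> \forall kap \near 0^'+, kap <= r / 2 / len.
    by move=> r0 len0; apply: nbhs_right_le; rewrite !divr_gt0.
  have ev : \forall kap \near 0^'+, ([/\ 0 < kap, kap <= 1, kap <= rt / 2 / T &
      kap <= rx / 2 / L] /\
      (forall i : 'I_Nt, exists p q, window T mu (tg i.+1)
       (contract 0 kap (tg i.+1)) p q /\ H1 q - H1 p <= om)) /\
      (forall i : 'I_Nx.+1, exists p q, window L mu (xg i)
       (contract cx kap (xg i)) p q /\ H2 q - H2 p <= om).
    apply: filterI near_x; apply: filterI near_t.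
    near=> kap; split.
    - by near: kap; exact: nbhs_right_gt.
    - by near: kap; exact: nbhs_right_le.
    - by near: kap; exact: small.
    - by near: kap; exact: small.
  by have [kap [[h1 h2] h3]] := filter_ex ev; exists kap.
have refine Nn (len r : R) : (0 < Nn)%N -> 0 < len -> 0 < r -> kap <= r / 2 / len ->
    exists2 n1 : nat, (0 < n1)%N &
    [/\ 0 < len / (Nn * n1)%:R, (Nn * n1)%:R * (len / (Nn * n1)%:R) = len,
        len / (Nn * n1)%:R + kap * len <= r &
        forall k : nat, k%:R * (len / Nn%:R) = (k * n1)%:R * (len / (Nn * n1)%:R)].
  move=> Nn0 len0 r0 kr; have [n1 n10 hn] := small_fraction len0 (half_pos r0).
  have Nu : Nn%:R != 0 :> R by rewrite pnatr_eq0 -lt0n.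
  have nu : n1%:R != 0 :> R by rewrite pnatr_eq0 -lt0n.
  exists n1 => //; split.
  - by rewrite divr_gt0// ltr0n muln_gt0 Nn0.
  - by rewrite mulrC divfK// natrM mulf_neq0.
  - rewrite (_ : r = r / 2 + r / 2); last by field.
    apply: lerD; last by rewrite -ler_pdivlMr.
    apply: le_trans hn; apply: ler_wpM2l; first exact: ltW.
    by rewrite lef_pV2 ?posrE ?ltr0n ?muln_gt0 ?Nn0// ler_nat leq_pmull.
  - by move=> k; rewrite !natrM; field; rewrite Nu nu.
have [n1 n10 [dt0 dtT dtr tgE]] := refine Nt T rt Nt0 T0 rt0 kT.
have [n2 n20 [dx0 dxL dxr xgE]] := refine Nx L rx Nx0 L0 rx0 kL.
pose K : R := #|{: signs 2}|%:R.
have K0 : 0 < K by rewrite ltr0n card_ffun card_bool card_ord.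
pose del := eps / (2 * (K * (T + L))).
have TL0 : 0 < T + L by exact: addr_gt0.
have del0 : 0 < del by rewrite divr_gt0// !mulr_gt0.
have delK len : 0 < len -> len <= T + L -> len * (K * del) <= eps / 2.
  move=> len0 lenTL; rewrite /del.
  rewrite (_ : _ * _ = (len / (T + L)) * (eps / 2)); last first.
    by field; rewrite !gt_eqF.
  by rewrite ler_piMl ?divr_ge0 ?(ltW eps0)// ler_pdivrMr// mul1r.
have k01 : 0 <= kap <= 1 by rewrite (ltW kap0).
have [N [es [em NE Nosc eb fit]]] := network_fit smono smp cm cp l3 T0 L0 fm k01 cxL
  (ltW dt0) (ltW dx0) dtT dxL del0.
have kn k : (k <= Nt)%N -> (k * n1 <= Nt * n1)%N by move=> kN; rewrite leq_mul2r kN orbT.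
have mn m : (m <= Nx)%N -> (m * n2 <= Nx * n2)%N by move=> mN; rewrite leq_mul2r mN orbT.
exists N, es, (fun k => contract 0 kap (tg k)), (fun m => contract cx kap (xg m)).
split => //.
- split; first by rewrite /tg /contract mul0r subrr mulr0 addr0.
  case=> [|k] kN.
    have -> : tg 0%N = 0 by rewrite /tg mul0r.
    have -> : contract 0 kap (0 : R) = 0 by rewrite /contract subrr mulr0 addr0.
    (* any window to the left of time 0 will do *)
    exists (- 2), (- 1); split; rewrite ?ltxx//.
    + by rewrite ltrN2 ltr1n.
    + by rewrite (lt_trans _ T0)// oppr_lt0.
    + by rewrite add0r (le_trans _ (ltW mu0))// oppr_le0.
    + by apply: initial_time_step => //; exact: ltW.
  have [p [q [w Hpq]]] := wt (Ordinal kN); exists p, q.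
  have [p0 pq qT _ [_ tp qt]] := w.
  by split => //; exact: window_time_step w Hpq.
- move=> m mN; have [p [q w]] := wx (Ordinal (mN : (m < Nx.+1)%N)).
  by exists p, q.
- split=> [k kN|m mN].
  + pose e (s : signs 2) x := es s (flip s (cV2 (tg k) x)).
    pose g (s : signs 2) x := fs s (flip s (cV2 (contract 0 kap (tg k)) x)).
    have bnd : \sum_(s : signs 2) sgb (s 1) (g s (L + 1)) - \sum_(s : signs 2) sgb (s 1) (g s (- 1)) <= W2.
      apply: le_trans (hW2 (contract 0 kap (tg k)) _); first exact: ler_norm.
      by apply: contract_itv => //; exact: tg_itv.
    apply: (@line_close_eps _ _ (fun s : signs 2 => s 1) e g cx kap _ del rx L W2 eps
      _ nx _ _ (ltW kap0) cxL dx0 _ dxL rx0 nxr dxr _ rx1 bnd rxW) => //.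
    * by move=> s; exact: component_x.
    * by move=> s; exact: component_x.
    * by rewrite muln_gt0 Nx0.
    * by move=> j s jN; rewrite /e /g /tg tgE; apply: fit => //; exact: kn.
    * by apply: delK => //; rewrite lerDr ltW.
  + pose e (s : signs 2) t := es s (flip s (cV2 t (xg m))).
    pose g (s : signs 2) t := fs s (flip s (cV2 t (contract cx kap (xg m)))).
    have bnd : \sum_(s : signs 2) sgb (s 0) (g s (T + 1)) - \sum_(s : signs 2) sgb (s 0) (g s (- 1)) <= W1.
      apply: le_trans (hW1 (contract cx kap (xg m)) _); first exact: ler_norm.
      by apply: contract_itv => //; exact: xg_itv.
    apply: (@line_close_eps _ _ (fun s : signs 2 => s 0) e g 0 kap _ del rt T W1 eps
      _ nt _ _ (ltW kap0) t0T dt0 _ dtT rt0 ntr dtr _ rt1 bnd rtW) => //.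
    * by move=> s; exact: component_t.
    * by move=> s; exact: component_t.
    * by rewrite muln_gt0 Nt0.
    * by move=> j s jN; rewrite /e /g /xg xgE; apply: fit => //; exact: mn.
    * by apply: delK => //; rewrite lerDl ltW.
Unshelve. all: by end_near.
Qed.

(** * From the contracted solution to the network *)

(** This holds for every function: if the integrals of both its positive and its
    negative part are infinite, then the two sides are 0. *)
Lemma rint_opp (R : realType) (f : R -> R) (a b : R) :
  rint a b (fun x => - f x) = - rint a b f.
Proof.
rewrite /Rintegral integralE [in RHS]integralE.
have -> : (fun x => (- f x)%:E) = (\- (fun x => (f x)%:E))%E by [].
rewrite funeposN funenegN.
have p0 : (0 <= \int[@lebesgue_measure R]_(x in `[a, b]) ((fun x => (f x)%:E)^\+ x))%E.
  exact: integral_ge0.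
have n0 : (0 <= \int[@lebesgue_measure R]_(x in `[a, b]) ((fun x => (f x)%:E)^\- x))%E.
  exact: integral_ge0.
move: p0 n0; move: (\int[_]_(_ in _) _)%E (\int[_]_(_ in _) _)%E.
by move=> [x| |] [y| |] //= _ _; rewrite ?opprB ?oppr0.
Qed.

Lemma weak_lhs_opp (R : realType) (T L : R) (v w phi : R * R -> R) :
  weak_lhs T L (fun p => - v p) (fun p => - w p) phi = - weak_lhs T L v w phi.
Proof.
rewrite /weak_lhs -rint_opp; apply: eq_rint => t _; rewrite -rint_opp.
by apply: eq_rint => x _; rewrite opprD !mulNr.
Qed.

Lemma weak_solution_entropy (R : realType) (T L : R) (F : R -> R) (u0 : R -> R)
    (u : R * R -> R) : weak_solution T L F u0 u ->
  entropy_inequality T L id F u0 u /\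
  entropy_inequality T L (fun v => - v) (fun v => - F v) u0 u.
Proof.
move=> wsol; split=> phi test _; first by rewrite (wsol phi test) lexx.
have -> : weak_lhs T L ((fun v => - v) \o u) ((fun v => - F v) \o u) phi =
    - weak_lhs T L u (F \o u) phi by exact: weak_lhs_opp.
rewrite (wsol phi test) opprK -rint_opp le_eqVlt; apply/orP; left; apply/eqP.
by apply: eq_rint => x _; rewrite mulNr opprK.
Qed.

Lemma tame_sum_field_x (R : realType) (fs : signs 2 -> 'cV[R]_2 -> R) (t : R) :
  (forall s, cV_nondecreasing (fs s)) -> tame (sum_field fs t).
Proof.
by move=> fm; apply: tame_sum => s; exact: (tame_signed (component_x s t (fm s))).
Qed.

Lemma tame_sum_field_t (R : realType) (fs : signs 2 -> 'cV[R]_2 -> R) (x : R) :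
  (forall s, cV_nondecreasing (fs s)) -> tame (fun t => sum_field fs t x).
Proof.
by move=> fm; apply: tame_sum => s; exact: (tame_signed (component_t s x (fm s))).
Qed.

(** Each of three error terms gets a quarter of [eps]; the denominator [C + 1]
    is positive also when [C] is 0. *)
Lemma budget (R : realFieldType) (k C eps : R) : 0 < k -> 0 <= C -> 0 <= eps ->
  k * C * (eps / (4 * k * (C + 1))) <= eps / 4.
Proof.
move=> k0 C0 e0; have C1 : 0 < C + 1 by rewrite ltr_wpDl.
rewrite (_ : _ * _ = (C / (C + 1)) * (eps / 4)); last by field; rewrite !gt_eqF.
by rewrite ler_piMl ?divr_ge0// ler_pdivrMr// mul1r lerDl.
Qed.

Lemma perturbed_balance (R : realFieldType)
    (a1 a2 b1 b2 a1' a2' b1' b2' C om mu e2 eps : R) :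
  `|a1 - a1'| <= C * e2 -> `|a2 - a2'| <= C * e2 ->
  `|b1 - b1'| <= C * e2 -> `|b2 - b2'| <= C * e2 ->
  (a1' - a2') + (b1' - b2') <= 6 * C * om + 16 * C * mu ->
  6 * C * om <= eps / 4 -> 16 * C * mu <= eps / 4 -> 4 * C * e2 <= eps / 4 ->
  0 <= eps ->
  (a1 - a2) + (b1 - b2) <= eps.
Proof.
rewrite !ler_norml => /andP[? ?] /andP[? ?] /andP[? ?] /andP[? ?]; lra.
Qed.

Theorem theorem4p6 (R : realType) (T L : R) (F S Q : R -> R)
    (u : R * R -> R) (Nx Nt : nat) (eps : R) (l : nat) (sigma : R -> R)
    (sigma_minus sigma_plus : R) :
  0 < T -> 0 < L ->
  C2 F -> strictly_convex F ->
  in_Linfty (@lebesgue_measure R) `[0, L]%classic (fun x => u (0, x)) ->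
  weak_admissible_solution T L F S Q (fun x => u (0, x)) u ->
  BMV (rectV T L) (u \o @pair2 R) ->
  (0 < Nx)%N -> (0 < Nt)%N ->
  0 < eps ->
  (3 <= l)%N ->
  {homo sigma : x y / x <= y} ->
  sigma_minus < sigma_plus ->
  sigma x @[x --> -oo] --> sigma_minus ->
  sigma x @[x --> +oo] --> sigma_plus ->
  let dt := T / Nt%:R in
  let h := L / Nx%:R in
  let xg (m : nat) : R := m%:R * h in
  let tg (k : nat) : R := k%:R * dt in
  exists N : netA R 2 l,
    let eta (t x : R) : R := netA_eval sigma N (cV2 t x) in
    [/\
        forall k m : nat, (1 <= k <= Nt)%N -> (1 <= m <= Nx)%N ->
          `| \int[@lebesgue_measure R]_(x in `[xg m.-1, xg m])
               (eta (tg k) x - eta (tg k.-1) x) +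
             \int[@lebesgue_measure R]_(t in `[tg k.-1, tg k])
               (F (eta t (xg m)) - F (eta t (xg m.-1))) | <= eps,
        forall k m : nat, (1 <= k <= Nt)%N -> (1 <= m <= Nx)%N ->
          \int[@lebesgue_measure R]_(x in `[xg m.-1, xg m])
             (S (eta (tg k) x) - S (eta (tg k.-1) x)) +
          \int[@lebesgue_measure R]_(t in `[tg k.-1, tg k])
             (Q (eta t (xg m)) - Q (eta t (xg m.-1))) <= eps,
        (EMVar sigma (rectV T L) N <=
         2%:E * (MVar (rectV T L) (u \o @pair2 R) +
                 Linfty_norm (lebesgue2 R) (rect T L) u))%E,
        (\int[@lebesgue_measure R]_(x in `[0%R, L])
           `| eta 0 x - u (0%R, x) |%:E <= eps%:E)%E &
        `| \int[@lebesgue_measure R]_(t in `[0, T])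
             (F (eta t 0) - F (eta t L)) | <= eps].
Proof.
move=> T0 L0 C2F _ _ [_ wsol [lS lQ _ _] ent] bmv Nx0 Nt0 eps0 l3 smono smp cm cp.
move=> dt h xg tg.
have [fs Hfs osc2] := near_optimal_decomposition (ltW T0) (ltW L0) bmv.
have [fm fE] := Hfs.
pose lo s := fs s (flip s (corner T L false s)).
pose hi s := fs s (flip s (corner T L true s)).
(* [M] bounds [u] on the rectangle, and the network everywhere. *)
pose M := \sum_(s : signs 2) (`|lo s| + `|hi s|).
have M0 : 0 <= M by apply: sumr_ge0 => s _; rewrite addr_ge0.
have sum_bound (w : signs 2 -> R) : (forall s, lo s <= w s <= hi s) ->
    `|\sum_s w s| <= M.
  move=> wb; apply: le_trans (ler_norm_sum _ _ _) _; apply: ler_sum => s _.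
  have /andP[w1 w2] := wb s; have := ler_norm (hi s); have := ler_norm (- lo s).
  rewrite normrN ler_norml; move: (normr_ge0 (lo s)) (normr_ge0 (hi s)) w1 w2; clear.
  by move=> ? ? ? ? ? ?; apply/andP; split; lra.
pose U := sum_field fs.
have uU t x : 0 <= t <= T -> 0 <= x <= L -> u (t, x) = U t x /\ `|u (t, x)| <= M.
  move=> tT xL; have Rz : rectV T L (cV2 t x) by apply/rectVE; rewrite cV2E0 cV2E1.
  have -> : u (t, x) = U t x.
    by rewrite /U /sum_field -(fE _ Rz) /= /pair2 cV2E0 cV2E1.
  by split => //; apply: sum_bound => s; exact: corner_bounds.
have bvU := sum_field_bv fm.
have [CF CF0 lF] := C2_lipschitz_within M C2F.
have [CS CS0 lS'] := locally_lipschitz_within M lS.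
have [CQ CQ0 lQ'] := locally_lipschitz_within M lQ.
have lid : lip_within M 1 (@id R) by move=> x y _ _; rewrite mul1r.
have bid := lip_clamp M0 ler01 lid; have bF := lip_clamp M0 CF0 lF.
have bS := lip_clamp M0 CS0 lS'; have bQ := lip_clamp M0 CQ0 lQ'.
have [C C0 [{}bid {}bF {}bS {}bQ]] : exists2 C, 0 <= C &
    [/\ lip_bounded C (id \o clamp M), lip_bounded C (F \o clamp M),
        lip_bounded C (S \o clamp M) & lip_bounded C (Q \o clamp M)].
  have c1 := lip_bounded_ge0 bid; have c2 := lip_bounded_ge0 bF.
  have c3 := lip_bounded_ge0 bS; have c4 := lip_bounded_ge0 bQ.
  move: (1 + _) (CF + _) (CS + _) (CQ + _) bid bF bS bQ c1 c2 c3 c4.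
  move=> C1 C2 C3 C4 b1 b2 b3 b4 c1 c2 c3 c4.
  exists (C1 + C2 + C3 + C4); first by rewrite !addr_ge0.
  by split; [apply: lip_boundedW b1|apply: lip_boundedW b2|
    apply: lip_boundedW b3|apply: lip_boundedW b4];
    move: c1 c2 c3 c4; clear; lra.
have C10 : 0 < C + 1 by rewrite ltr_wpDl.
pose om := eps / (4 * 6 * (C + 1)); pose e2 := eps / (4 * 4 * (C + 1)).
pose mu0 := eps / (4 * 16 * (C + 1)).
have dt0 : 0 < dt by rewrite divr_gt0// ltr0n.
have h0 : 0 < h by rewrite divr_gt0// ltr0n.
have om0 : 0 < om by rewrite divr_gt0// !mulr_gt0.
have e20 : 0 < e2 by rewrite divr_gt0// !mulr_gt0.
(* Half a cell bounds the windows as well, to keep those of neighbouring nodes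
   disjoint. *)
pose mu := Num.min mu0 (Num.min (dt / 2) (h / 2)).
have mu00 : 0 < mu0 by rewrite divr_gt0// !mulr_gt0.
have mu_gt0 : 0 < mu by rewrite /mu !lt_min mu00 !half_pos.
have mudt : 2 * mu <= dt.
  by rewrite mulrC -ler_pdivlMr// /mu !ge_min lexx !orbT.
have muh : 2 * mu <= h.
  by rewrite mulrC -ler_pdivlMr// /mu !ge_min lexx !orbT.
have Bom : 6 * C * om <= eps / 4 by apply: budget => //; exact: ltW.
have Be2 : 4 * C * e2 <= eps / 4 by apply: budget => //; exact: ltW.
have Bmu : 16 * C * mu <= eps / 4.
  apply: (@le_trans _ _ (16 * C * mu0)); last by apply: budget => //; exact: ltW.
  by apply: ler_wpM2l; [rewrite mulr_ge0|rewrite /mu ge_min lexx].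
have [N [es [ts [xs [[em [NE eb]] Nosc [ts0 tnode] xnode [tline xline]]]]]] :=
  network_approximation smono smp cm cp l3 T0 L0 fm Nx0 Nt0 e20 om0 mu_gt0.
exists N; rewrite /=.
pose E := sum_field es.
have NEE t x : netA_eval sigma N (cV2 t x) = E t x := NE t x.
have EM t x : `|E t x| <= M by apply: sum_bound => s; exact: eb.
have tEx t : tame (E t) := tame_sum_field_x t em.
have tEt x : tame (E^~ x) := tame_sum_field_t x em.
have tUx t : tame (U t) := tame_sum_field_x t fm.
have tUt x : tame (U^~ x) := tame_sum_field_t x fm.
have tgS k : (0 < k)%N -> tg k = tg k.-1 + dt.
  by case: k => // k _; rewrite /tg /= -natr1 mulrDl mul1r.
have xgS m : (0 < m)%N -> xg m = xg m.-1 + h.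
  by case: m => // m _; rewrite /xg /= -natr1 mulrDl mul1r.
have tgT : tg Nt = T by rewrite /tg /dt mulrC divfK// pnatr_eq0 -lt0n.
have xgL : xg Nx = L by rewrite /xg /h mulrC divfK// pnatr_eq0 -lt0n.
have tg0 : tg 0%N = 0 by rewrite /tg mul0r.
have xg0 : xg 0%N = 0 by rewrite /xg mul0r.
have tg_ge0 k : 0 <= tg k by rewrite mulr_ge0// ltW.
have xg_ge0 m : 0 <= xg m by rewrite mulr_ge0// ltW.
have tg_le k : (k <= Nt)%N -> tg k <= T by move=> kN; rewrite -tgT ler_pM2r// ler_nat.
have xg_le m : (m <= Nx)%N -> xg m <= L by move=> mN; rewrite -xgL ler_pM2r// ler_nat.
have pair A0 B0 : lip_bounded C (A0 \o clamp M) -> lip_bounded C (B0 \o clamp M) ->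
    entropy_inequality T L A0 B0 (fun x => u (0, x)) u ->
    (forall k m : nat, (1 <= k <= Nt)%N -> (1 <= m <= Nx)%N ->
      rint (xg m.-1) (xg m) (fun x => A0 (E (tg k) x) - A0 (E (tg k.-1) x)) +
      rint (tg k.-1) (tg k) (fun t => B0 (E t (xg m)) - B0 (E t (xg m.-1))) <= eps) /\
    rint 0 T (fun t => B0 (E t 0) - B0 (E t L)) <= eps.
  move=> hA hB hent; pose A := A0 \o clamp M; pose B := B0 \o clamp M.
  have AB v : `|v| <= M -> A v = A0 v /\ B v = B0 v by move=> vM; rewrite /A /B /= clamp_id.
  have bal : balanced T L U A B.
    exact: weak_balance T0 L0 uU AB hent.
  have tA e : tame e -> tame (fun x => A (e x)) by exact: lip_comp_tame hA.
  have tB e : tame e -> tame (fun x => B (e x)) by exact: lip_comp_tame hB.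
  split=> [k m /andP[k1 kN] /andP[m1 mN]|].
    have kN' : (k.-1 <= Nt)%N by exact: leq_trans (leq_pred k) kN.
    have mN' : (m.-1 <= Nx)%N by exact: leq_trans (leq_pred m) mN.
    have [p [q tn]] := tnode _ kN'; have [p' [q' tn']] := tnode _ kN.
    have [pi [qi [wi Hi]]] := xnode _ mN'; have [pj [qj [wj Hj]]] := xnode _ mN.
    have tt : tg k.-1 + 2 * mu <= tg k by rewrite (tgS k k1) lerD2l.
    have xx : xg m.-1 + 2 * mu <= xg m by rewrite (xgS m m1) lerD2l.
    have kk : tg k.-1 <= tg k by rewrite (tgS k k1) lerDl ltW.
    have mm : xg m.-1 <= xg m by rewrite (xgS m m1) lerDl ltW.
    have main := cell_balance T0 L0 bvU hA hB bal tn tn' (tg_ge0 _) tt mu_gt0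
      (tg_le _ kN) wi Hi wj Hj xx.
    have -> : rint (xg m.-1) (xg m) (fun x => A0 (E (tg k) x) - A0 (E (tg k.-1) x)) =
      rint (xg m.-1) (xg m) (fun x => A (E (tg k) x)) -
      rint (xg m.-1) (xg m) (fun x => A (E (tg k.-1) x)).
      rewrite -rintB; [|exact: tA|exact: tA].
      apply: eq_rint => x _; have [-> _] := AB _ (EM (tg k) x).
      by have [-> _] := AB _ (EM (tg k.-1) x).
    have -> : rint (tg k.-1) (tg k) (fun t => B0 (E t (xg m)) - B0 (E t (xg m.-1))) =
      rint (tg k.-1) (tg k) (fun t => B (E t (xg m))) -
      rint (tg k.-1) (tg k) (fun t => B (E t (xg m.-1))).
      rewrite -rintB; [|exact: tB|exact: tB].
      apply: eq_rint => t _; have [_ ->] := AB _ (EM t (xg m)).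
      by have [_ ->] := AB _ (EM t (xg m.-1)).
    have lA := rint_lip_close hA (tEx _) (tUx _) (xg_ge0 _) mm (xg_le _ mN).
    have lB := rint_lip_close hB (tEt _) (tUt _) (tg_ge0 _) kk (tg_le _ kN).
    exact: (perturbed_balance (lA _ _ _ (tline k kN)) (lA _ _ _ (tline _ kN'))
      (lB _ _ _ (xline m mN)) (lB _ _ _ (xline _ mN')) main Bom Bmu Be2 (ltW eps0)).
  have [p [q tn]] := tnode _ (leq0n Nt); have [p' [q' tn']] := tnode _ (leqnn Nt).
  have [pi [qi [wi Hi]]] := xnode _ (leqnn Nx).
  have [pj [qj [wj Hj]]] := xnode _ (leq0n Nx).
  have muT : 2 * mu <= T by apply: (le_trans mudt); rewrite -tgT ler_peMl ?ler1n// ltW.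
  move: tn tn' wi wj; rewrite -/(tg _) -/(tg _) -/(xg _) -/(xg _) tg0 tgT xg0 xgL.
  move=> tn tn' wi wj.
  have main := boundary_balance T0 L0 bvU hA hB bal tn tn' muT wi Hi wj Hj.
  have -> : rint 0 T (fun t => B0 (E t 0) - B0 (E t L)) =
      rint 0 T (fun t => B (E t 0)) - rint 0 T (fun t => B (E t L)).
    rewrite -rintB; [|exact: tB|exact: tB].
    apply: eq_rint => t _; have [_ ->] := AB _ (EM t 0).
    by have [_ ->] := AB _ (EM t L).
  have lB x y := rint_lip_close hB (tEt x) (tUt y) (lexx 0) (ltW T0) (lexx T).
  have := xline _ (leqnn Nx); have := xline _ (leq0n Nx).
  rewrite -/(xg _) -/(xg _) xg0 xgL => xl0 xlL.
  (* There is no space integral here: the first two terms of the balance are 0. *)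
  have z : `|(0 : R) - (0 : R)| <= C * e2 by rewrite subrr normr0 mulr_ge0// ltW.
  have := @perturbed_balance _ 0 0 _ _ 0 0 _ _ C om mu e2 eps z z
    (lB _ _ _ xl0) (lB _ _ _ xlL).
  by rewrite !subrr !add0r; apply => //; exact: ltW.
have [ent1 ent2] := weak_solution_entropy wsol.
have [cell1 bd1] := pair _ _ bid bF ent1.
have [cell2 bd2] := pair _ _ (lip_boundedN bid) (lip_boundedN bF) ent2.
have [cellS _] := pair _ _ bS bQ ent.
split.
- move=> k m kN mN; under eq_Rintegral do rewrite !NEE.
  under [X in _ + X]eq_Rintegral do rewrite !NEE.
  rewrite ler_norml cell1// andbT lerNl opprD -!rint_opp.
  apply: le_trans (cell2 k m kN mN); rewrite le_eqVlt; apply/orP; left; apply/eqP.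
  by congr (_ + _); apply: eq_rint => y _ /=; rewrite opprB opprK addrC.
- move=> k m kN mN; under eq_Rintegral do rewrite !NEE.
  under [X in _ + X]eq_Rintegral do rewrite !NEE.
  exact: cellS.
- apply: (le_trans Nosc); apply: (le_trans osc2).
  apply: lee_wpmul2l; first by rewrite lee_fin.
  by rewrite leeDl// /Linfty_norm Lnorm_ge0.
- have tl := tline _ (leq0n Nt); rewrite ts0 -/(tg _) tg0 in tl.
  have tn : tame (fun x => `|E 0 x - U 0 x|) by apply: tame_norm; exact: tameB.
  have -> : (\int[@lebesgue_measure R]_(x in `[0%R, L])
      `|netA_eval sigma N (cV2 0 x) - u (0%R, x)|%:E =
      \int[@lebesgue_measure R]_(x in `[0%R, L]) (`|E 0 x - U 0 x|)%:E)%E.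
    apply: eq_integral => x; rewrite inE /= in_itv /= => xL.
    have T00 : 0 <= (0 : R) <= T by rewrite lexx ltW.
    by rewrite NEE; have [-> _] := uU 0 x T00 xL.
  rewrite -(fineK (integrable_fin_num _ (tame_integrable 0 L tn)))// lee_fin.
  apply: le_trans tl _; rewrite /e2 ler_pdivrMr ?mulr_gt0// ler_peMr ?(ltW eps0)//.
  by move: C0; clear; lra.
- under eq_Rintegral do rewrite !NEE.
  rewrite ler_norml bd1 andbT lerNl -rint_opp; apply: le_trans bd2.
  rewrite le_eqVlt; apply/orP; left; apply/eqP.
  by apply: eq_rint => y _ /=; rewrite opprB opprK addrC.
Qed.
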